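(* Let $A$ be a ribbon Hopf algebra over a (non-trivial) commutative ring $\Bbbk$ and let $W$ be a finite-free left $A$-module. Let $RT_W:\mathcal{T}^{\mathrm{up}}\to(\mathsf{fMod}_A^{\mathrm{str}})_W$ be the open-traced Reshetikhin-Turaev functor, let $RT_W:\mathcal{T}\to\mathsf{fMod}_A^{\mathrm{str}}$ be the usual Reshetikhin-Turaev functor, and let $i:\mathcal{T}^{\mathrm{up}}\hookrightarrow\mathcal{T}$ and $k:(\mathsf{fMod}_A^{\mathrm{str}})_W\hookrightarrow\mathsf{fMod}_A^{\mathrm{str}}$ be the inclusions. Then $k\circ RT_W=RT_W\circ i$.
   Context: Ribbon Hopf algebras. All Hopf algebras have invertible antipode $S$. A quasi-triangular structure on a Hopf algebra $A$ over $\Bbbk$ is an invertible $R=\sum_i\alpha_i\otimes\beta_i\in A\otimes A$ with $(\Delta\otimes\mathrm{id})(R)=R_{13}R_{23}$, $(\mathrm{id}\otimes\Delta)(R)=R_{13}R_{12}$, $\Delta^{\mathrm{op}}=R\,\Delta(-)\,R^{-1}$. Put $u=\sum_iS(\beta_i)\alpha_i$. A ribbon structure is an element $\kappa\in A$ with $\kappa^2=uS(u^{-1})$, $\Delta(\kappa)=\kappa\otimes\kappa$, $S^2=\kappa(-)\kappa^{-1}$; then $(A,R,\kappa)$ is a ribbon Hopf algebra with ribbon element $v=\kappa^{-1}u$. Modules. $\mathsf{fMod}_A$ is the ribbon category of left $A$-modules that are free of finite rank over $\Bbbk$ (finite-free), with $\otimes=\otimes_\Bbbk$ (action through $\Delta$),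 braiding $\tau_{V,W}(v\otimes w)=\sum_i\beta_iw\otimes\alpha_iv$, duals $V^*$ with $(a\omega)(v)=\omega(S(a)v)$, twist $\theta_W(w)=v^{-1}w$. $\mathsf{fMod}_A^{\mathrm{str}}$ is its strictification: objects are finite sequences of objects, morphisms are the morphisms between the left-parenthesised tensor products, and the monoidal product is concatenation. It is traced: for $f:X\otimes U\to Y\otimes U$, $\mathrm{tr}_{X,Y}^U(f)=(\mathrm{id}_Y\otimes\widetilde{\mathrm{ev}}_U)(f\otimes\mathrm{id}_{U^*})(\mathrm{id}_X\otimes\mathrm{coev}_U)$ with $\widetilde{\mathrm{ev}}_U=\mathrm{ev}_U\tau_{U,U^*}(\theta_U\otimes\mathrm{id}_{U^*})$. Tangles. $\mathcal{T}$ is the category of framed oriented tangles in the cube (objects words in $\pm$, composition by stacking on top, $\otimes$ juxtaposition), the free strict ribbon category on $+$, with $\tau_{+,+}$ the positive crossing (both strands up, the strand from bottom left to top right over) and $\theta_+$ the strand with framing $+1$. The usual Reshetikhin-Turaev functor $RT_W:\mathcal{T}\to\mathsf{fMod}_A^{\mathrm{str}}$ is the unique strict monoidal functor with $+\mapsto(W)$ preserving the ribbon structure. $\mathcal{T}^+\subset\mathcal{T}$ is the full subcategory on the objects $+^n$, $n\ge0$ (the free traced monoidal category on one object, with trace given by closing up the rightmost strands with parallel planar arcs to the right). $\mathcal{T}^{\mathrm{up}}\subset\mathcal{T}^+$ is the monoidal subcategory on the same objects and tangles without closed components. $\sigma_T\in\mathfrak{S}_n$ sends $i$ to the end position of the strand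 of $T$ starting at position $i$. Open-traced structures. $\mathfrak{S}$ is the strict balanced monoidal category with objects $n\ge0$, $\mathrm{End}(n)=\mathfrak{S}_n$, no other morphisms, block product, braiding $\tau_{n,m}:i\mapsto i+m\pmod{n+m}$ and identity twist. An open-traced structure on a strict balanced monoidal category $\mathcal{C}$ consists of a strict monoidal functor $P:\mathcal{C}\to\mathfrak{S}$ preserving braiding and twist and a natural partial trace $\mathrm{tr}^U_{X,Y}$ with values in $\mathrm{Hom}(X,Y)$, satisfying the Joyal-Street-Verity trace axioms, defined on the $(X,Y,U)$-admissible morphisms: those $f:X\otimes U\to Y\otimes U$ such that, with $n=P(X)=P(Y)$ and $m=P(U)$, the permutation $P(f)\in\mathfrak{S}_{n+m}$ has no cycle of length $\le m$ (fixed points included) consisting only of elements of $\{n+1,\dots,n+m\}$. $\mathcal{T}^{\mathrm{up}}$ is open-traced with structure functor $+^n\mapsto n$, $T\mapsto\sigma_T$, and $\mathrm{tr}_{+^n,+^n}^{+^m}(T)$ obtained from an admissible $T$ by closing up the $m$ rightmost strands. The category $(\mathsf{fMod}_A^{\mathrm{str}})_W$. Let $F$ be the composite $\mathcal{T}^{\mathrm{up}}\hookrightarrow\mathcal{T}^+\to\mathsf{fMod}_A^{\mathrm{str}}$, the second functor being the unique strict monoidal functor with $+\mapsto(W)$ preserving braiding, twist and trace. $(\mathsf{fMod}_A^{\mathrm{str}})_W$ is the image of $F$: the subcategory of $\mathsf{fMod}_A^{\mathrm{str}}$ with objects $(W)^{\otimes n}=(W,\dots,W)$, $n\ge0$, and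 morphisms $F(T)$ for $T$ an upwards tangle. It is a strict open-traced monoidal category with the monoidal and balanced structure of $\mathsf{fMod}_A^{\mathrm{str}}$, structure functor $P:(\mathsf{fMod}_A^{\mathrm{str}})_W\to\mathfrak{S}$ given by $P((W)^{\otimes n})=n$, $P(F(T))=\sigma_T$, and open trace $\mathrm{tr}_{W^{\otimes n},W^{\otimes n}}^{W^{\otimes m}}(F(T)):=F(\mathrm{tr}_{+^n,+^n}^{+^m}(T))$ for $T$ a $(+^n,+^n,+^m)$-admissible upwards tangle. The open-traced Reshetikhin-Turaev functor $RT_W:\mathcal{T}^{\mathrm{up}}\to(\mathsf{fMod}_A^{\mathrm{str}})_W$ is the unique strict monoidal functor with $+\mapsto(W)$ preserving the open-traced structure, i.e. the braiding, the twist, the open trace of admissible morphisms, and with $P(RT_W(T))=\sigma_T$. *)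

(* Defs.v *)
From HB Require Import structures.
From Stdlib Require Import Relation_Operators.
From mathcomp Require Import all_boot all_order all_algebra perm.
From mathcomp Require Import boolp.

Set Implicit Arguments.
Unset Strict Implicit.
Unset Printing Implicit Defensive.

Import GRing.Theory VectorInternalTheory.
Local Open Scope ring_scope.
Local Open Scope quotient_scope.

Section Bilinear.
Variables (k : comNzRingType).

Definition bilinear_fun (M N P : lmodType k) (f : M -> N -> P) : Prop :=
  (forall y, linear (f^~ y)) /\ (forall x, linear (f x)).

End Bilinear.

(* The tensor product of two modules over k.  Elements are classes of finite
   formal sums of pairs, two sums being identified when every bilinear map
   takes the same value on them. *)
Section TensorProduct.
Variables (k : comNzRingType) (M N : lmodType k).

Definition same_tensor (s t : seq (M * N)) : bool :=
  `[< forall (P : lmodType k) (f : M -> N -> P), bilinear_fun f ->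
      \sum_(p <- s) f p.1 p.2 = \sum_(p <- t) f p.1 p.2 >].

Lemma same_tensor_equiv : equiv_class_of same_tensor.
Proof.
split=> [s|s t|t s u].
- exact/asboolP.
- by apply/asboolP/asboolP => h P f /h ->.
- by move=> /asboolP h1 /asboolP h2; apply/asboolP => P f hf; rewrite h1 ?h2.
Qed.
Canonical same_tensor_rel := EquivRelPack same_tensor_equiv.

Definition tensor := {eq_quot same_tensor}.
HB.instance Definition _ := EqQuotient.on tensor.
HB.instance Definition _ := Choice.on tensor.

Definition tsum (s : seq (M * N)) : tensor := \pi_tensor s.

Lemma tsumP s t :
  (forall (P : lmodType k) (f : M -> N -> P), bilinear_fun f ->
      \sum_(p <- s) f p.1 p.2 = \sum_(p <- t) f p.1 p.2) <-> tsum s = tsum t.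
Proof. by split=> [h|/eqmodP/asboolP//]; apply/eqmodP/asboolP. Qed.

Lemma tsumK (t : tensor) : tsum (repr t) = t.
Proof. exact: reprK. Qed.

(* The linear map induced by f, when f is bilinear (tlift_linear, tlift_pure);
   \sum_i f x_i y_i on a sum of pure tensors. *)
Definition tlift (P : lmodType k) (f : M -> N -> P) (t : tensor) : P :=
  \sum_(p <- repr t) f p.1 p.2.

Lemma tlift_sum (P : lmodType k) (f : M -> N -> P) s : bilinear_fun f ->
  tlift f (tsum s) = \sum_(p <- s) f p.1 p.2.
Proof. by move=> hf; apply: (tsumP (repr _) s).2 => //; rewrite tsumK. Qed.

Definition tadd (x y : tensor) : tensor := tsum (repr x ++ repr y).
Definition tscale (c : k) (x : tensor) : tensor :=
  tsum [seq (c *: p.1, p.2) | p <- repr x].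

Lemma tadd_sum s t : tadd (tsum s) (tsum t) = tsum (s ++ t).
Proof.
apply/tsumP => P f hf; rewrite !big_cat /=.
by rewrite -![\sum_(p <- repr _) _]/(tlift f _) !tlift_sum.
Qed.

Lemma bil_scalel (P : lmodType k) (f : M -> N -> P) : bilinear_fun f ->
  forall c x y, f (c *: x) y = c *: f x y.
Proof.
move=> [hf _] c x y; have h0 : f 0 y = 0.
  have := hf y 1 0 0; rewrite !scale1r !addr0 => /eqP.
  by rewrite -subr_eq0 opprD addrA subrr add0r oppr_eq0 => /eqP.
by have := hf y c x 0; rewrite !addr0 h0 addr0.
Qed.

Lemma bil_scaler (P : lmodType k) (f : M -> N -> P) : bilinear_fun f ->
  forall c x y, f x (c *: y) = c *: f x y.
Proof.
move=> [_ hf] c x y; have h0 : f x 0 = 0.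
  have := hf x 1 0 0; rewrite !scale1r !addr0 => /eqP.
  by rewrite -subr_eq0 opprD addrA subrr add0r oppr_eq0 => /eqP.
by have := hf x c y 0; rewrite !addr0 h0 addr0.
Qed.

Lemma bil_addl (P : lmodType k) (f : M -> N -> P) : bilinear_fun f ->
  forall x x' y, f (x + x') y = f x y + f x' y.
Proof. by move=> [hf _] x x' y; rewrite -[x]scale1r hf !scale1r. Qed.

Lemma bil_addr (P : lmodType k) (f : M -> N -> P) : bilinear_fun f ->
  forall x y y', f x (y + y') = f x y + f x y'.
Proof. by move=> [_ hf] x y y'; rewrite -[y]scale1r hf !scale1r. Qed.

Lemma tscale_sum c s : tscale c (tsum s) = tsum [seq (c *: p.1, p.2) | p <- s].
Proof.
apply/tsumP => P f hf; rewrite !big_map /=.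
under eq_bigr do rewrite bil_scalel //.
under [RHS]eq_bigr do rewrite bil_scalel //.
by rewrite -!scaler_sumr -![\sum_(p <- repr _) _]/(tlift f _) tlift_sum.
Qed.

Lemma taddA : associative tadd.
Proof.
move=> x y z; rewrite -[x]tsumK -[y]tsumK -[z]tsumK !tadd_sum.
by rewrite catA.
Qed.

Lemma taddC : commutative tadd.
Proof.
move=> x y; rewrite -[x]tsumK -[y]tsumK !tadd_sum.
by apply/tsumP => P f hf; rewrite !big_cat /= addrC.
Qed.

Lemma tadd0 : left_id (tsum [::]) tadd.
Proof. by move=> x; rewrite -[x]tsumK tadd_sum. Qed.

Lemma taddN : left_inverse (tsum [::]) (tscale (-1)) tadd.
Proof.
move=> x; rewrite -[x]tsumK tscale_sum tadd_sum.
apply/tsumP => P f hf; rewrite big_cat /= big_map big_nil.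
under eq_bigr do rewrite bil_scalel //.
by rewrite -scaler_sumr scaleN1r addNr.
Qed.

HB.instance Definition _ :=
  GRing.isZmodule.Build tensor taddA taddC tadd0 taddN.

Lemma tsum_cat s t : tsum (s ++ t) = tsum s + tsum t.
Proof. by rewrite -tadd_sum. Qed.

Lemma tscaleA a b x : tscale a (tscale b x) = tscale (a * b) x.
Proof.
rewrite -[x]tsumK !tscale_sum -map_comp /=; congr tsum.
by apply: eq_map => p /=; rewrite scalerA.
Qed.
Lemma tscale1 : left_id 1 tscale.
Proof.
move=> x; rewrite -[x]tsumK !tscale_sum; congr tsum.
by rewrite -[RHS]map_id; apply: eq_map => -[p q] /=; rewrite scale1r.
Qed.
Lemma tscaleDr : right_distributive tscale +%R.
Proof.
by move=> a x y; rewrite -[x]tsumK -[y]tsumK -tsum_cat !tscale_sum map_cat tsum_cat.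
Qed.
Lemma tscaleDl x : {morph tscale^~ x : a b / a + b}.
Proof.
move=> a b; rewrite -[x]tsumK !tscale_sum -tsum_cat.
apply/tsumP => P f hf; rewrite big_cat /= !big_map -big_split /=.
by apply: eq_bigr => p _; rewrite scalerDl bil_addl.
Qed.
HB.instance Definition _ :=
  GRing.Zmodule_isLmodule.Build k tensor tscaleA tscale1 tscaleDr tscaleDl.

Lemma scale_tsum c s : c *: tsum s = tsum [seq (c *: p.1, p.2) | p <- s].
Proof. exact: tscale_sum. Qed.

Definition tpure (x : M) (y : N) : tensor := tsum [:: (x, y)].

Lemma tpure_bilinear : bilinear_fun tpure.
Proof.
split=> [y|x] c z z'; rewrite /tpure scale_tsum -tsum_cat;
  by apply/tsumP => P f hf; rewrite !big_cons !big_nil /= !addr0 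
     ?(bil_scalel hf) ?(bil_addl hf) ?(bil_addr hf) ?(bil_scalel hf) ?(bil_scaler hf).
Qed.

Lemma tsumE s : tsum s = \sum_(p <- s) tpure p.1 p.2.
Proof.
elim: s => [|[x y] s IHs]; first by rewrite big_nil.
by rewrite big_cons -IHs -cat1s tsum_cat.
Qed.

Lemma tensorP (t : tensor) : exists s, t = \sum_(p <- s) tpure p.1 p.2.
Proof. by exists (repr t); rewrite -tsumE tsumK. Qed.

Lemma tlift_pure (P : lmodType k) (f : M -> N -> P) x y :
  bilinear_fun f -> tlift f (tpure x y) = f x y.
Proof. by move=> hf; rewrite tlift_sum // big_seq1. Qed.

Lemma tlift_linear (P : lmodType k) (f : M -> N -> P) :
  bilinear_fun f -> linear (tlift f).
Proof.
move=> hf c x y; rewrite -[x]tsumK -[y]tsumK scale_tsum.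
rewrite -tsum_cat !tlift_sum // big_cat big_map /= scaler_sumr.
by congr +%R; apply: eq_bigr => p _; rewrite bil_scalel.
Qed.

Lemma tlift_suml (P : lmodType k) (f : M -> N -> P) I (r : seq I) (t : I -> tensor) :
  bilinear_fun f -> tlift f (\sum_(i <- r) t i) = \sum_(i <- r) tlift f (t i).
Proof.
move=> /tlift_linear hf.
pose F : {linear _ -> _} := HB.pack (tlift f) (GRing.isLinear.Build _ _ _ _ _ hf).
by rewrite -[tlift f]/(F : _ -> _) linear_sum.
Qed.

Lemma tliftZ (P : lmodType k) (f : M -> N -> P) c t :
  bilinear_fun f -> tlift f (c *: t) = c *: tlift f t.
Proof.
move=> /tlift_linear hf.
pose F : {linear _ -> _} := HB.pack (tlift f) (GRing.isLinear.Build _ _ _ _ _ hf).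
by rewrite -[tlift f]/(F : _ -> _) linearZ.
Qed.

Lemma tpureZl c x y : tpure (c *: x) y = c *: tpure x y.
Proof. exact: (bil_scalel tpure_bilinear). Qed.

Lemma tpureZr c x y : tpure x (c *: y) = c *: tpure x y.
Proof. exact: (bil_scaler tpure_bilinear). Qed.

Lemma tpureDl x x' y : tpure (x + x') y = tpure x y + tpure x' y.
Proof. exact: (bil_addl tpure_bilinear). Qed.

Lemma tpureDr x y y' : tpure x (y + y') = tpure x y + tpure x y'.
Proof. exact: (bil_addr tpure_bilinear). Qed.

Lemma tpure_suml I (r : seq I) (x : I -> M) y :
  tpure (\sum_(i <- r) x i) y = \sum_(i <- r) tpure (x i) y.
Proof.
elim/big_ind2: _ => // [|x1 x2 y1 y2 <- <-]; last exact: tpureDl.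
by rewrite -(scale0r 0) tpureZl scale0r.
Qed.

Lemma tpure_sumr I (r : seq I) x (y : I -> N) :
  tpure x (\sum_(i <- r) y i) = \sum_(i <- r) tpure x (y i).
Proof.
elim/big_ind2: _ => // [|x1 x2 y1 y2 <- <-]; last exact: tpureDr.
by rewrite -(scale0r 0) tpureZr scale0r.
Qed.

End TensorProduct.

Arguments tpure {k M N} x y.
Notation "x ⊗ y" := (tpure x y) (at level 39, left associativity) : ring_scope.

Lemma tensor_ext (k : comNzRingType) (M N P : lmodType k) (f g : tensor M N -> P) :
  linear f -> linear g -> (forall x y, f (x ⊗ y) = g (x ⊗ y)) -> f =1 g.
Proof.
move=> hf hg h t; have [s ->] := tensorP t.
pose F : {linear _ -> _} := HB.pack f (GRing.isLinear.Build _ _ _ _ f hf).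
pose G : {linear _ -> _} := HB.pack g (GRing.isLinear.Build _ _ _ _ g hg).
by rewrite -[f]/(F : _ -> _) -[g]/(G : _ -> _) !linear_sum; apply: eq_bigr => p _; exact: h.
Qed.

Section TensorVect.
Variables (k : comNzRingType) (V W : vectType k).

Let f (v : V) (w : W) : 'rV[k]_(dim V * dim W) := mxvec ((v2r v)^T *m v2r w).
Let f_bil : bilinear_fun f.
Proof.
split=> [w|v] c x y; rewrite /f [v2r (_ + _)]linearP.
  by rewrite [(_ + _)^T]linearP mulmxDl -scalemxAl linearP.
by rewrite mulmxDr -scalemxAr linearP.
Qed.
Let e (i : 'I_(dim V)) : V := r2v (delta_mx 0 i).
Let e' (j : 'I_(dim W)) : W := r2v (delta_mx 0 j).
Let g (m : 'rV[k]_(dim V * dim W)) : tensor V W :=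
  \sum_i \sum_j vec_mx m i j *: (e i ⊗ e' j).

Lemma tensor_vect_iso : Vector.axiom (dim V * dim W) (tensor V W).
Proof.
exists (tlift f); first exact: tlift_linear.
have g_lin : linear g.
  move=> c x y; rewrite /g scaler_sumr -big_split; apply: eq_bigr => i _.
  rewrite scaler_sumr -big_split; apply: eq_bigr => j _ /=.
  by rewrite linearP !mxE scalerDl scalerA.
have f_lin := tlift_linear f_bil.
exists g => [t|m].
  apply: (tensor_ext (f := g \o tlift f) (g := id)) => //.
    by move=> c x y /=; rewrite f_lin g_lin.
  move=> v w /=; rewrite tlift_pure // /f /g mxvecK.
  have ve : v = \sum_i v2r v 0 i *: e i.
    rewrite -{1}(v2rK v) {1}(row_sum_delta (v2r v)) linear_sum.
    by apply: eq_bigr => i _; rewrite linearZ.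
  have we : w = \sum_j v2r w 0 j *: e' j.
    rewrite -{1}(v2rK w) {1}(row_sum_delta (v2r w)) linear_sum.
    by apply: eq_bigr => j _; rewrite linearZ.
  rewrite [in RHS]ve tpure_suml; apply: eq_bigr => i _.
  rewrite [in RHS]we tpure_sumr; apply: eq_bigr => j _.
  by rewrite tpureZl tpureZr scalerA !mxE big_ord1 !mxE.
rewrite {2}(_ : m = mxvec (\sum_i \sum_j vec_mx m i j *: delta_mx i j)); last first.
  by rewrite -matrix_sum_delta vec_mxK.
rewrite (tlift_suml _ _ f_bil) linear_sum; apply: eq_bigr => i _.
rewrite (tlift_suml _ _ f_bil) linear_sum; apply: eq_bigr => j _.
rewrite (tliftZ _ _ f_bil) tlift_pure // /f /e /e' !r2vK trmx_delta mul_delta_mx.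
by rewrite linearZ.
Qed.
HB.instance Definition _ :=
  Lmodule_hasFinDim.Build k (tensor V W) tensor_vect_iso.
End TensorVect.

Section TensorMaps.
Variable k : comNzRingType.

Definition tmap (M N M' N' : lmodType k) (f : M -> M') (g : N -> N') :
    tensor M N -> tensor M' N' :=
  tlift (fun x y => f x ⊗ g y).

(* (x ⊗ y, x' ⊗ y') |-> f x x' ⊗ g y y'. *)
Definition tapp (M N M' N' P P' : lmodType k)
    (f : M -> N -> P) (g : M' -> N' -> P') (s : tensor M M') (t : tensor N N') :
    tensor P P' :=
  tlift (fun x y => tlift (fun x' y' => f x x' ⊗ g y y') t) s.

Definition tswap (M N : lmodType k) : tensor M N -> tensor N M :=
  tlift (fun x y => y ⊗ x).

Definition tassoc (M N P : lmodType k) :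
    tensor (tensor M N) P -> tensor M (tensor N P) :=
  tlift (fun t z => tlift (fun x y => x ⊗ (y ⊗ z)) t).

Definition tassocV (M N P : lmodType k) :
    tensor M (tensor N P) -> tensor (tensor M N) P :=
  tlift (fun x t => tlift (fun y z => x ⊗ y ⊗ z) t).

Lemma linear_sumP (M P : lmodType k) (f : M -> P) : linear f ->
  forall I (r : seq I) (F : I -> M), f (\sum_(i <- r) F i) = \sum_(i <- r) f (F i).
Proof.
move=> hf I r F.
pose G : {linear _ -> _} := HB.pack f (GRing.isLinear.Build _ _ _ _ f hf).
by rewrite -[f]/(G : _ -> _) linear_sum.
Qed.

Lemma tlift_bilin_param (M N P Q : lmodType k) (h : Q -> M -> N -> P) t :
  (forall x y, linear (fun q => h q x y)) -> linear (fun q => tlift (h q) t).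
Proof.
move=> hl c q q'; rewrite /tlift scaler_sumr -big_split.
by apply: eq_bigr => p _; rewrite hl.
Qed.

Lemma tassoc_bil (M N P : lmodType k) :
  bilinear_fun (fun (t : tensor M N) (z : P) => tlift (fun x y => x ⊗ (y ⊗ z)) t).
Proof.
split=> [z|t]; last first.
  by apply: tlift_bilin_param => x y c u v; rewrite !tpureDr !tpureZr.
move=> c u v; apply: tlift_linear; split=> [y|x] a w w';
  by rewrite ?tpureDl ?tpureZl ?tpureDr ?tpureZr.
Qed.

Section Tapp.
Variables (M N M' N' P P' : lmodType k) (f : M -> N -> P) (g : M' -> N' -> P').
Hypotheses (hf : bilinear_fun f) (hg : bilinear_fun g).

Let inner_bil x y : bilinear_fun (fun x' y' => f x x' ⊗ g y y').
Proof.
by split=> z c u v; rewrite ?(bil_addr hf) ?(bil_scaler hf) ?(bil_addr hg)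
  ?(bil_scaler hg) ?tpureDl ?tpureZl ?tpureDr ?tpureZr.
Qed.

Let outer_bil t :
  bilinear_fun (fun x y => tlift (fun x' y' => f x x' ⊗ g y y') t).
Proof.
split=> z; apply: tlift_bilin_param => x y c u v.
- by rewrite (bil_addl hf) (bil_scalel hf) tpureDl tpureZl.
- by rewrite (bil_addl hg) (bil_scalel hg) tpureDr tpureZr.
Qed.

Lemma tapp_bilinear : bilinear_fun (tapp f g).
Proof.
split=> [t|s]; first exact: tlift_linear.
move=> c t t'; rewrite /tapp /tlift scaler_sumr -big_split.
apply: eq_bigr => p _; exact: (tlift_linear (inner_bil _ _)).
Qed.

Lemma tapp_pure x y x' y' :
  tapp f g (x ⊗ y) (x' ⊗ y') = f x x' ⊗ g y y'.
Proof. by rewrite /tapp !tlift_pure. Qed.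

End Tapp.

End TensorMaps.

Lemma mul_bilinear (k : comNzRingType) (A : algType k) :
  bilinear_fun (fun x y : A => x * y).
Proof.
by split=> x c y z; rewrite ?mulrDl ?mulrDr -?scalerAl -?scalerAr.
Qed.

Section HopfAlgebra.
Variables (k : comNzRingType) (A : algType k).

Definition mulAA : tensor A A -> tensor A A -> tensor A A :=
  tapp (fun x y : A => x * y) (fun x y : A => x * y).
Definition mulAAA : tensor (tensor A A) A -> tensor (tensor A A) A ->
    tensor (tensor A A) A :=
  tapp mulAA (fun x y : A => x * y).

Lemma mulAA_bilinear : bilinear_fun mulAA.
Proof. exact: tapp_bilinear (mul_bilinear A) (mul_bilinear A). Qed.

Record hopf_algebra := HopfAlgebra {
  coprod : {linear A -> tensor A A};
  counit : {lrmorphism A -> k^o};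
  antipode : {linear A -> A};
  coprod1 : coprod 1 = 1 ⊗ 1;
  coprodM : forall a b, coprod (a * b) = mulAA (coprod a) (coprod b);
  coprodA : forall a,
    tassoc (tmap coprod id (coprod a)) = tmap id coprod (coprod a);
  counitl : forall a, tlift (fun x y => (counit x : k) *: y) (coprod a) = a;
  counitr : forall a, tlift (fun x y => (counit y : k) *: x) (coprod a) = a;
  antipodel : forall a,
    tlift (fun x y => antipode x * y) (coprod a) = (counit a : k) *: 1;
  antipoder : forall a,
    tlift (fun x y => x * antipode y) (coprod a) = (counit a : k) *: 1;
  antipode_bij : bijective antipode }.

Section Antipode.
Variable H : hopf_algebra.
Let S := antipode H.
Let eps (a : A) : k := counit H a.
Let sw (a : A) : seq (A * A) := repr (coprod H a).

Let coprod_sw a : coprod H a = \sum_(p <- sw a) p.1 ⊗ p.2.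
Proof. by rewrite -tsumE tsumK. Qed.

Let swA (P : lmodType k) (g : A -> A -> A -> P) a :
  (forall y z, linear (fun x => g x y z)) ->
  (forall x z, linear (fun y => g x y z)) ->
  (forall x y, linear (fun z => g x y z)) ->
  \sum_(p <- sw a) \sum_(q <- sw p.2) g p.1 q.1 q.2 =
  \sum_(p <- sw a) \sum_(q <- sw p.1) g q.1 q.2 p.2.
Proof.
move=> g1 g2 g3.
have gb x : bilinear_fun (g x) by split=> ?; [exact: g2 | exact: g3].
have gb' z : bilinear_fun (fun x y => g x y z).
  by split=> ?; [exact: g1 | exact: g2].
have Gb : bilinear_fun (fun x t => tlift (g x) t).
  split=> [t|x]; last exact: tlift_linear.
  by apply: tlift_bilin_param => y z; exact: g1.
have Hb : bilinear_fun (fun t z => tlift (fun x y => g x y z) t).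
  split=> [z|t]; first by move=> c u v; exact: tlift_linear.
  by apply: tlift_bilin_param => x y; exact: g3.
have lhs : tlift (fun x t => tlift (g x) t) (tmap id (coprod H) (coprod H a)) =
   \sum_(p <- sw a) \sum_(q <- sw p.2) g p.1 q.1 q.2.
  rewrite /tmap {2}/tlift (tlift_suml _ _ Gb); apply: eq_bigr => p _.
  by rewrite tlift_pure.
rewrite -lhs -coprodA.
rewrite /tmap {3}/tlift /tassoc (tlift_suml _ _ (tassoc_bil _ _ _)).
rewrite (tlift_suml _ _ Gb); apply: eq_bigr => p _.
rewrite (tlift_pure _ _ (tassoc_bil _ _ _)).
rewrite {2}/tlift (tlift_suml _ _ Gb); apply: eq_bigr => q _.
by rewrite !tlift_pure.
Qed.

Let S_l (P : lmodType k) (f : A -> P) a : linear f ->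
  \sum_(p <- sw a) f (S p.1 * p.2) = eps a *: f 1.
Proof.
move=> hf; rewrite -(linear_sumP hf).
have -> : \sum_(p <- sw a) S p.1 * p.2 = eps a *: 1 by exact: antipodel.
pose G : {linear _ -> _} := HB.pack f (GRing.isLinear.Build _ _ _ _ f hf).
by rewrite -[f]/(G : _ -> _) linearZ.
Qed.

Let eps_l (P : lmodType k) (f : A -> P) a : linear f ->
  \sum_(p <- sw a) eps p.1 *: f p.2 = f a.
Proof.
move=> hf; rewrite -[in RHS](counitl H a) (linear_sumP hf); apply: eq_bigr => p _.
pose G : {linear _ -> _} := HB.pack f (GRing.isLinear.Build _ _ _ _ f hf).
by rewrite -[f]/(G : _ -> _) linearZ.
Qed.

Let eps_r (P : lmodType k) (f : A -> P) a : linear f ->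
  \sum_(p <- sw a) eps p.2 *: f p.1 = f a.
Proof.
move=> hf; rewrite -[in RHS](counitr H a) (linear_sumP hf); apply: eq_bigr => p _.
pose G : {linear _ -> _} := HB.pack f (GRing.isLinear.Build _ _ _ _ f hf).
by rewrite -[f]/(G : _ -> _) linearZ.
Qed.

Let S_r2 a b :
  \sum_(p <- sw a) \sum_(q <- sw b) (p.1 * q.1) * S (p.2 * q.2) = eps (a * b) *: 1.
Proof.
have fb : bilinear_fun (fun x y : A => x * S y).
  by split=> x c y z; rewrite ?linearP ?mulrDl ?mulrDr -?scalerAl -?scalerAr.
rewrite -[RHS](antipoder H) coprodM /mulAA.
have mb := mul_bilinear A.
have [_ br] := tapp_bilinear mb mb; have [bl _] := tapp_bilinear mb mb.
rewrite (coprod_sw a) (linear_sumP (bl _)) (tlift_suml _ _ fb).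
apply: eq_bigr => p _.
rewrite (coprod_sw b) (linear_sumP (br _)) (tlift_suml _ _ fb).
by apply: eq_bigr => q _; rewrite tapp_pure // tlift_pure.
Qed.

Lemma antipode1 : antipode H 1 = 1.
Proof.
have := antipodel H 1; rewrite coprod1 tlift_pure; last first.
  by split=> x c y z; rewrite ?linearP ?mulrDl ?mulrDr -?scalerAl -?scalerAr.
by rewrite mulr1 rmorph1 scale1r.
Qed.

Lemma antipodeM a b : antipode H (a * b) = antipode H b * antipode H a.
Proof.
pose T := \sum_(p <- sw a) \sum_(q <- sw p.2) \sum_(r <- sw b) \sum_(s <- sw r.2)
   S r.1 * S p.1 * ((q.1 * s.1) * S (q.2 * s.2)).
transitivity T; last first.
  rewrite /T -[RHS](eps_r (f := fun x => S b * S x)); last first.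
    by move=> c x y; rewrite linearP mulrDr scalerAr.
  apply: eq_bigr => p _; rewrite exchange_big /=.
  rewrite -(eps_r (f := fun x => S x * S p.1)); last first.
    by move=> c x y; rewrite linearP mulrDl scalerAl.
  rewrite scaler_sumr; apply: eq_bigr => r _.
  under eq_bigr do rewrite -mulr_sumr.
  rewrite -mulr_sumr S_r2 -scalerAr mulr1 scalerA; congr (_ *: _).
  by rewrite /eps rmorphM.
rewrite /T (swA (g := fun x y z => \sum_(r <- sw b) \sum_(s <- sw r.2)
   S r.1 * S x * ((y * s.1) * S (z * s.2)))); last 3 first.
- move=> y z c u v; rewrite scaler_sumr -big_split; apply: eq_bigr => r _.
  rewrite scaler_sumr -big_split; apply: eq_bigr => s _ /=.
  by rewrite linearP mulrDr mulrDl -scalerAr -scalerAl.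
- move=> y z c u v; rewrite scaler_sumr -big_split; apply: eq_bigr => r _.
  rewrite scaler_sumr -big_split; apply: eq_bigr => s _ /=.
  by rewrite !mulrDl mulrDr -!scalerAl -scalerAr.
- move=> y z c u v; rewrite scaler_sumr -big_split; apply: eq_bigr => r _.
  rewrite scaler_sumr -big_split; apply: eq_bigr => s _ /=.
  by rewrite mulrDl linearD !mulrDr -scalerAl linearZ -!scalerAr.
transitivity (\sum_(p <- sw a) eps p.1 *: \sum_(r <- sw b) \sum_(s <- sw r.2)
    S r.1 * (s.1 * S (p.2 * s.2))); last first.
  apply: eq_bigr => p _; rewrite exchange_big /= scaler_sumr.
  apply: eq_bigr => r _; rewrite exchange_big /= scaler_sumr.
  apply: eq_bigr => s _.
  rewrite -[s.1 * _ in LHS]mul1r -(S_l (f := fun x => S r.1 * (x * (s.1 * S (p.2 * s.2))))).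
    by apply: eq_bigr => q _; rewrite !mulrA.
  by move=> c u v; rewrite mulrDl mulrDr -scalerAl -scalerAr.
rewrite (eps_l (f := fun x => \sum_(r <- sw b) \sum_(s <- sw r.2)
    S r.1 * (s.1 * S (x * s.2)))); last first.
  move=> c u v; rewrite scaler_sumr -big_split; apply: eq_bigr => r _.
  rewrite scaler_sumr -big_split; apply: eq_bigr => s _ /=.
  by rewrite mulrDl linearD !mulrDr -scalerAl linearZ -!scalerAr.
rewrite (swA (g := fun x y z => S x * (y * S (a * z)))); last 3 first.
- by move=> y z c u v; rewrite linearP mulrDl scalerAl.
- by move=> y z c u v; rewrite mulrDl mulrDr -scalerAl -scalerAr.
- by move=> y z c u v; rewrite mulrDr linearD !mulrDr -scalerAr linearZ -!scalerAr.
rewrite -(eps_l (f := fun x => S (a * x))); last first.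
  by move=> c u v; rewrite mulrDr linearD -scalerAr linearZ.
apply: eq_bigr => r _.
rewrite -[S _ in LHS]mul1r -(S_l (f := fun x => x * S (a * r.2))).
  by apply: eq_bigr => q _; rewrite !mulrA.
by move=> c u v; rewrite mulrDl scalerAl.
Qed.

End Antipode.

(* (A ⊗ A) ⊗ A is used for the triple tensor power: for R = a ⊗ b, the
   elements R13, R23 and R12 are (a ⊗ 1) ⊗ b, (1 ⊗ a) ⊗ b and
   R ⊗ 1 respectively. *)
Record quasitriangular (H : hopf_algebra) := Quasitriangular {
  Rmx : tensor A A;
  Rmx_inv : tensor A A;
  Rmx_mulV : mulAA Rmx Rmx_inv = 1 ⊗ 1;
  Rmx_mulVr : mulAA Rmx_inv Rmx = 1 ⊗ 1;
  Rmx_hexl : tmap (coprod H) id Rmx =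
    mulAAA (tmap (fun x => x ⊗ 1) id Rmx) (tmap (tpure 1) id Rmx);
  Rmx_hexr : tassocV (tmap id (coprod H) Rmx) =
    mulAAA (tmap (fun x => x ⊗ 1) id Rmx) (Rmx ⊗ 1);
  Rmx_coprod : forall a,
    tswap (coprod H a) = mulAA (mulAA Rmx (coprod H a)) Rmx_inv }.

Definition drinfeld (H : hopf_algebra) (R : quasitriangular H) : A :=
  tlift (fun x y => antipode H y * x) (Rmx R).

(* The inverses of u and kappa are recorded as data; they are unique. *)
Record ribbon_structure (H : hopf_algebra) (R : quasitriangular H) :=
  RibbonStructure {
  drinfeld_inv : A;
  drinfeld_mulV : drinfeld R * drinfeld_inv = 1;
  drinfeld_mulVr : drinfeld_inv * drinfeld R = 1;
  kappa : A;
  kappa_inv : A;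
  kappa_mulV : kappa * kappa_inv = 1;
  kappa_mulVr : kappa_inv * kappa = 1;
  kappa_sqr : kappa ^+ 2 = drinfeld R * antipode H drinfeld_inv;
  kappa_coprod : coprod H kappa = kappa ⊗ kappa;
  kappa_conj : forall a,
    antipode H (antipode H a) = kappa * a * kappa_inv }.

Record ribbon_hopf_algebra := RibbonHopfAlgebra {
  rib_hopf :> hopf_algebra;
  rib_R : quasitriangular rib_hopf;
  rib_kappa : ribbon_structure rib_R }.

Definition ribbon_elt (H : ribbon_hopf_algebra) : A :=
  kappa_inv (rib_kappa H) * drinfeld (rib_R H).
Definition ribbon_elt_inv (H : ribbon_hopf_algebra) : A :=
  drinfeld_inv (rib_kappa H) * kappa (rib_kappa H).

Lemma ribbon_elt_mulV H : ribbon_elt H * ribbon_elt_inv H = 1.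
Proof.
rewrite /ribbon_elt /ribbon_elt_inv mulrA -(mulrA (kappa_inv _)).
by rewrite drinfeld_mulV mulr1 kappa_mulVr.
Qed.

Lemma ribbon_elt_mulVr H : ribbon_elt_inv H * ribbon_elt H = 1.
Proof.
rewrite /ribbon_elt /ribbon_elt_inv mulrA -(mulrA (drinfeld_inv _)).
by rewrite kappa_mulV mulr1 drinfeld_mulVr.
Qed.

End HopfAlgebra.

Section Modules.
Variables (k : comNzRingType) (A : algType k) (H : ribbon_hopf_algebra A).

(* vectType k is the class of the k-modules isomorphic to some 'rV[k]_n, that
   is, of the free modules of finite rank; rank 0 is allowed. *)
Record fmodule := FModule {
  fcar :> vectType k;
  fact : A -> fcar -> fcar;
  fact_bilinear : bilinear_fun fact;
  fact1 : forall x, fact 1 x = x;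
  factM : forall a b x, fact (a * b) x = fact a (fact b x) }.

Definition unit_act (a : A) (c : k^o) : k^o := counit H a * c.
Fact unit_act_bilinear : bilinear_fun unit_act.
Proof.
split=> c a x y; rewrite /unit_act; first by rewrite linearP mulrDl -mulrA.
by rewrite mulrDr [_ *: _]/GRing.scale /= mulrCA.
Qed.
Fact unit_act1 x : unit_act 1 x = x.
Proof. by rewrite /unit_act rmorph1 mul1r. Qed.
Fact unit_actM a b x : unit_act (a * b) x = unit_act a (unit_act b x).
Proof. by rewrite /unit_act rmorphM mulrA. Qed.
Definition unit_mod := FModule unit_act_bilinear unit_act1 unit_actM.

Section TensorModule.
Variables V W : fmodule.
Definition tensor_act (a : A) : tensor V W -> tensor V W :=
  tapp (@fact V) (@fact W) (coprod H a).
Let bV := fact_bilinear V.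
Let bW := fact_bilinear W.
Fact tensor_act_bilinear : bilinear_fun tensor_act.
Proof.
have [bl br] := tapp_bilinear bV bW.
split=> [t c a b|a]; last exact: br.
by rewrite /tensor_act linearP bl.
Qed.
Fact tensor_act1 t : tensor_act 1 t = t.
Proof.
apply: (tensor_ext (f := tensor_act 1) (g := id)) => //.
  exact: tensor_act_bilinear.2.
by move=> x y; rewrite /tensor_act coprod1 tapp_pure // !fact1.
Qed.
Fact tensor_actM a b t : tensor_act (a * b) t = tensor_act a (tensor_act b t).
Proof.
have [bl br] := tapp_bilinear bV bW.
have [ml mr] := mulAA_bilinear A.
rewrite /tensor_act coprodM.
apply: (tensor_ext (f := fun s => tapp _ _ (mulAA s _) _)
  (g := fun s => tapp _ _ s (tapp _ _ _ _))) => [c s s'|c s s'|x y].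
- by rewrite ml bl.
- by rewrite bl.
apply: (tensor_ext (f := fun s => tapp _ _ (mulAA _ s) _)
  (g := fun s => tapp _ _ _ (tapp _ _ s _))) => [c s s'|c s s'|x' y'].
- by rewrite mr bl.
- by rewrite bl br.
apply: (tensor_ext (f := fun s => tapp _ _ _ s)
  (g := fun s => tapp _ _ _ (tapp _ _ _ s))) => [c s s'|c s s'|v w].
- by rewrite br.
- by rewrite !br.
rewrite /mulAA !tapp_pure ?factM //; exact: mul_bilinear.
Qed.
Definition tensor_mod := FModule tensor_act_bilinear tensor_act1 tensor_actM.
End TensorModule.

Section DualModule.
Variable V : fmodule.
Definition dual_act (a : A) (w : 'Hom(V, k^o)) : 'Hom(V, k^o) :=
  linfun (fun x => w (fact (antipode H a) x)).
Fact dual_actE a w x : dual_act a w x = w (fact (antipode H a) x).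
Proof.
have hl : linear (fun x => w (fact (antipode H a) x)).
  by move=> c y z; rewrite (fact_bilinear V).2 linearP.
pose F : {linear _ -> _} := HB.pack (fun x => w (fact (antipode H a) x))
  (GRing.isLinear.Build _ _ _ _ _ hl).
exact: (lfunE F).
Qed.
Fact dual_act_bilinear : bilinear_fun dual_act.
Proof.
split=> [w|a] c x y; apply/lfunP => z; rewrite !(dual_actE, lfun_simp) //=.
by rewrite linearP (fact_bilinear V).1 linearP.
Qed.
Fact dual_act1 w : dual_act 1 w = w.
Proof. by apply/lfunP => z; rewrite dual_actE antipode1 fact1. Qed.
Fact dual_actM a b w : dual_act (a * b) w = dual_act a (dual_act b w).
Proof. by apply/lfunP => z; rewrite !dual_actE antipodeM factM. Qed.
Definition dual_mod := FModule dual_act_bilinear dual_act1 dual_actM.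
End DualModule.

End Modules.

(* The operations of a strict balanced (resp. traced) monoidal category.
   Preservation of structure only refers to the operations, so the laws are
   not recorded. *)
Record traced_data := TracedData {
  obj : Type;
  hom : obj -> obj -> Type;
  idm : forall x, hom x x;
  comp : forall x y z, hom y z -> hom x y -> hom x z;
  unt : obj;
  ten : obj -> obj -> obj;
  tenm : forall x x' y y', hom x x' -> hom y y' -> hom (ten x y) (ten x' y');
  braid : forall x y, hom (ten x y) (ten y x);
  twist : forall x, hom x x;
  ptr : forall x y u, hom (ten x u) (ten y u) -> hom x y }.
Arguments idm {t} x.
Arguments comp {t x y z} g f.
Arguments unt {t}.
Arguments ten {t} x y.
Arguments tenm {t x x' y y'} f g.
Arguments braid {t} x y.
Arguments twist {t} x.
Arguments ptr {t x y u} f.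

(* Strictness makes objects such as F (x ⊗ y) and F x ⊗ F y equal, but
   not convertible: morphisms are compared as arrows, i.e., together with
   their source and target. *)
Definition arrow (C : traced_data) := {p : obj C * obj C & hom p.1 p.2}.
Definition arr (C : traced_data) (x y : obj C) (f : hom x y) : arrow C :=
  existT (fun p : obj C * obj C => hom p.1 p.2) (x, y) f.

Record subcat (C : traced_data) := Subcat {
  sobj : obj C -> Prop;
  sarr : arrow C -> Prop }.

Definition sub_obj C (S : subcat C) := {x : obj C | sobj S x}.
Definition sub_hom C (S : subcat C) (x y : sub_obj S) :=
  {f : hom (sval x) (sval y) | sarr S (arr f)}.

(* S need not be known to be closed under composition: functoriality is
   stated for the identities and composites which lie in S. *)
Record functor C D (S : subcat C) (S' : subcat D) := Functor {
  fobj : sub_obj S -> sub_obj S';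
  fmap : forall x y, sub_hom x y -> sub_hom (fobj x) (fobj y);
  fmap_id : forall x (e : sub_hom x x),
    sval e = idm (sval x) -> sval (fmap e) = idm (sval (fobj x));
  fmap_comp : forall x y z (g : sub_hom y z) (f : sub_hom x y) (h : sub_hom x z),
    sval h = comp (sval g) (sval f) ->
    sval (fmap h) = comp (sval (fmap g)) (sval (fmap f)) }.

Definition functor_eq C D (S : subcat C) (S' : subcat D) (F G : functor S S') :=
  (forall x, sval (fobj F x) = sval (fobj G x)) /\
  (forall x y (f : sub_hom x y), arr (sval (fmap F f)) = arr (sval (fmap G f))).

Section FunctorComp.
Variables (C D E : traced_data) (S : subcat C) (S' : subcat D) (S'' : subcat E).
Variables (G : functor S' S'') (F : functor S S').

Definition functor_comp : functor S S''.
Proof.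
exists (fun x => fobj G (fobj F x)) (fun x y f => fmap G (fmap F f)).
- by move=> x e /(fmap_id F) /(fmap_id G).
- by move=> x y z g f h /(fmap_comp F) /(fmap_comp G).
Defined.
End FunctorComp.

Definition functor_incl C (S S' : subcat C)
  (ho : forall x, sobj S x -> sobj S' x)
  (ha : forall a, sarr S a -> sarr S' a) : functor S S'.
Proof.
exists (fun x => exist _ (sval x) (ho _ (svalP x)))
       (fun x y (f : sub_hom x y) => exist
         (fun f0 : hom (sval x) (sval y) => sarr S' (arr f0))
         (sval f) (ha _ (svalP f))) => //=.
Defined.

Section StructurePreservation.
Variables (C D : traced_data) (S : subcat C) (S' : subcat D) (F : functor S S').

(* The graph of F on objects and on arrows.  In the preservation properties
   below an equation is required whenever the arrows involved lie in S. *)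
Definition sends_obj (x : obj C) (X : obj D) : Prop :=
  exists x' : sub_obj S, sval x' = x /\ sval (fobj F x') = X.
Definition sends (a : arrow C) (b : arrow D) : Prop :=
  exists (x y : sub_obj S) (f : sub_hom x y),
    arr (sval f) = a /\ arr (sval (fmap F f)) = b.

Definition strict_monoidal : Prop :=
  [/\ forall X, sends_obj unt X -> X = unt,
      forall x y X Y Z, sends_obj x X -> sends_obj y Y ->
        sends_obj (ten x y) Z -> Z = ten X Y &
      forall x x' y y' (f : hom x x') (g : hom y y')
        X X' Y Y' (f' : hom X X') (g' : hom Y Y') b,
        sends (arr f) (arr f') -> sends (arr g) (arr g') ->
        sends (arr (tenm f g)) b -> b = arr (tenm f' g')].

Definition preserves_braiding : Prop :=
  forall x y X Y b, sends_obj x X -> sends_obj y Y ->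
    sends (arr (braid x y)) b -> b = arr (braid X Y).

Definition preserves_twist : Prop :=
  forall x X b, sends_obj x X -> sends (arr (twist x)) b -> b = arr (twist X).

Definition preserves_trace : Prop :=
  forall x y u (f : hom (ten x u) (ten y u))
    X Y U (g : hom (ten X U) (ten Y U)) b,
    sends_obj x X -> sends_obj y Y -> sends_obj u U ->
    sends (arr f) (arr g) -> sends (arr (ptr f)) b -> b = arr (ptr g).

End StructurePreservation.

(* p has no cycle of length at most m inside the last m of the n + m points,
   which are numbered from 0. *)
Definition admissible (n m : nat) (p : {N : nat & 'S_N}) : Prop :=
  forall c, c \in porbits (tagged p) ->
    ~ ((#|c| <= m)%N /\ forall i, i \in c -> (n <= i < n + m)%N).

(* The structure functor to the symmetric groups (on objects and on arrows)
   and the partial trace, given by their graphs. *)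
Record open_trace C (S : subcat C) := OpenTrace {
  ot_obj : obj C -> nat -> Prop;
  ot_perm : arrow C -> {N : nat & 'S_N} -> Prop;
  ot_tr : forall x y u : obj C, hom (ten x u) (ten y u) -> hom x y -> Prop }.
Arguments ot_tr {C S} o {x y u} f g.

Definition preserves_open_trace C D (S : subcat C) (S' : subcat D)
    (o : open_trace S) (o' : open_trace S') (F : functor S S') : Prop :=
  [/\ forall x X n, sends_obj F x X -> ot_obj o x n -> ot_obj o' X n,
      forall a b p, sends F a b -> ot_perm o a p -> ot_perm o' b p &
      forall x y u (f : hom (ten x u) (ten y u)) (h : hom x y)
        X Y U (g : hom (ten X U) (ten Y U)) (h' : hom X Y),
        sends_obj F x X -> sends_obj F y Y -> sends_obj F u U ->
        sends F (arr f) (arr g) -> sends F (arr h) (arr h') ->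
        ot_tr o f h -> ot_tr o' g h'].

Section Image.
Variables (C D : traced_data) (S : subcat C) (S' : subcat D) (F : functor S S').

(* On the image of F the structure is P (F T) := P T and
   tr (F T) := F (tr T).  If F identifies two arrows T of different
   permutations (F T = F T' can happen, e.g., on modules of rank one), then
   this P is not single-valued, hence the use of graphs. *)
Definition image_subcat : subcat D :=
  Subcat (fun X => exists x, sends_obj F x X) (fun b => exists a, sends F a b).

Definition image_open_trace (o : open_trace S) : open_trace image_subcat :=
  @OpenTrace D image_subcat
    (fun X n => exists x, sends_obj F x X /\ ot_obj o x n)
    (fun b p => exists a, sends F a b /\ ot_perm o a p)
    (fun X Y U g h' => exists x y u (f : hom (ten x u) (ten y u)) (h : hom x y),
      [/\ sends_obj F x X, sends_obj F y Y & sends_obj F u U] /\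
      [/\ sends F (arr f) (arr g), sends F (arr h) (arr h') & ot_tr o f h]).

Fact image_sobj X : sobj image_subcat X -> sobj S' X.
Proof. by case=> x [x' [_ <-]]; exact: (proj2_sig (fobj F x')). Qed.
Fact image_sarr a : sarr image_subcat a -> sarr S' a.
Proof. by case=> b [x [y [f [_ <-]]]]; exact: (proj2_sig (fmap F f)). Qed.
Definition image_incl : functor image_subcat S' :=
  functor_incl image_sobj image_sarr.

End Image.

Section FMod.
Variables (k : comNzRingType) (A : algType k) (H : ribbon_hopf_algebra A).
Local Notation fm := (fmodule A).
Local Notation tmod := (tensor_mod H).
Local Notation dmod := (dual_mod H).

Definition tensH (V V' W W' : fm) (f : 'Hom(V, V')) (g : 'Hom(W, W')) :
    'Hom(tmod V W, tmod V' W') := linfun (tmap f g).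

(* Maps out of a tensor product are given by (tlift of) their value on pure
   tensors. *)
Definition braidH (V W : fm) : 'Hom(tmod V W, tmod W V) :=
  linfun (tlift (fun (x : V) (y : W) =>
    tlift (fun a b => fact b y ⊗ fact a x) (Rmx (rib_R H)))).

Definition twistH (V : fm) : 'Hom(V, V) :=
  linfun (fact (ribbon_elt_inv H)).

Definition evH (V : fm) : 'Hom(tmod (dmod V) V, unit_mod H) :=
  linfun (tlift (fun (w : 'Hom(V, k^o)) (x : V) => w x)).

Definition coev_elt (V : fm) : tensor V 'Hom(V, k^o) :=
  \sum_(i < dim V)
    (r2v (delta_mx 0 i) ⊗ linfun (fun x : V => v2r x 0 i : k^o)).

Definition coevH (V : fm) : 'Hom(unit_mod H, tmod V (dmod V)) :=
  linfun (fun c : k^o => (c : k) *: coev_elt V).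

(* The right evaluation ev tau (theta ⊗ id). *)
Definition evrH (V : fm) : 'Hom(tmod V (dmod V), unit_mod H) :=
  (evH V \o braidH V (dmod V) \o tensH (twistH V) \1)%VF.

Definition assocH (U V W : fm) :
    'Hom(tmod (tmod U V) W, tmod U (tmod V W)) :=
  linfun (@tassoc k U V W).
Definition assocVH (U V W : fm) :
    'Hom(tmod U (tmod V W), tmod (tmod U V) W) :=
  linfun (@tassocV k U V W).
Definition runitH (V : fm) : 'Hom(tmod V (unit_mod H), V) :=
  linfun (tlift (fun (x : V) (c : k^o) => (c : k) *: x)).
Definition runitVH (V : fm) : 'Hom(V, tmod V (unit_mod H)) :=
  linfun (fun x : V => x ⊗ (1 : k^o)).
Definition lunitH (V : fm) : 'Hom(tmod (unit_mod H) V, V) :=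
  linfun (tlift (fun (c : k^o) (x : V) => (c : k) *: x)).
Definition lunitVH (V : fm) : 'Hom(V, tmod (unit_mod H) V) :=
  linfun (fun x : V => (1 : k^o) ⊗ x).

Definition traceH (V W U : fm) (f : 'Hom(tmod V U, tmod W U)) :
    'Hom(V, W) :=
  (runitH W \o tensH \1 (evrH U) \o assocH W U (dmod U) \o tensH f \1
   \o assocVH V U (dmod U) \o tensH \1 (coevH U) \o runitVH V)%VF.

(* The left-parenthesised tensor product ((V1 ⊗ V2) ⊗ V3) ⊗ ... *)
Definition par (X : seq fm) : fm :=
  if X is V :: X' then foldl tmod V X' else unit_mod H.

(* Mutually inverse maps; see glue_inv. *)
Definition hpair (V W : fm) := ('Hom(V, W) * 'Hom(W, V))%type.

Fixpoint foldlH (V W : fm) (f : hpair V W) (Y : seq fm) :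
    hpair (foldl tmod V Y) (foldl tmod W Y) :=
  if Y is U :: Y' then foldlH (tensH f.1 \1, tensH f.2 \1)%VF Y' else f.

Fixpoint glue1 (V U : fm) (Y : seq fm) :
    hpair (tmod V (foldl tmod U Y))
          (foldl tmod (tmod V U) Y) :=
  if Y is T :: Y' then
    let f := glue1 V (tmod U T) Y' in
    let g := foldlH (assocVH V U T, assocH V U T) Y' in
    (g.1 \o f.1, f.2 \o g.2)%VF
  else (\1, \1)%VF.

Fixpoint glue_cons (V : fm) (X : seq fm) (U : fm) (Y : seq fm) :
    hpair (tmod (foldl tmod V X) (foldl tmod U Y))
          (foldl tmod V (X ++ U :: Y)) :=
  if X is T :: X' then glue_cons (tmod V T) X' U Y else glue1 V U Y.

Fixpoint glue_nil (V : fm) (X : seq fm) :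
    hpair (tmod (foldl tmod V X) (unit_mod H))
          (foldl tmod V (X ++ [::])) :=
  if X is T :: X' then glue_nil (tmod V T) X' else (runitH V, runitVH V).

(* The isomorphism par X ⊗ par Y -> par (X ++ Y) composed of associators
   and unitors. *)
Definition glue (X Y : seq fm) :
    hpair (tmod (par X) (par Y)) (par (X ++ Y)) :=
  match X, Y with
  | [::], _ => (lunitH (par Y), lunitVH (par Y))
  | V :: X', [::] => glue_nil V X'
  | V :: X', U :: Y' => glue_cons V X' U Y'
  end.

Definition str_hom (X Y : seq fm) := 'Hom(par X, par Y).

(* The strictification of the finite-free A-modules, with all k-linear maps
   as morphisms; fMod is the subcategory of A-linear maps. *)
Definition str_fMod : traced_data := {|
  obj := seq fm;
  hom := str_hom;
  idm X := \1%VF;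
  comp X Y Z g f := (g \o f)%VF;
  unt := [::];
  ten := cat;
  tenm X X' Y Y' f g := ((glue X' Y').1 \o tensH f g \o (glue X Y).2)%VF;
  braid X Y := ((glue Y X).1 \o braidH (par X) (par Y) \o (glue X Y).2)%VF;
  twist X := twistH (par X);
  ptr X Y U f := traceH ((glue Y U).2 \o f \o (glue X U).1)%VF |}.

Definition fMod : subcat str_fMod :=
  @Subcat str_fMod (fun _ => True)
    (fun f => forall a x, tagged f (fact a x) = fact a (tagged f x)).

End FMod.

Lemma linfunE (R : comNzRingType) (U V : vectType R) (f : U -> V) :
  linear f -> linfun f =1 f.
Proof.
move=> hf.
pose F : {linear _ -> _} := HB.pack f (GRing.isLinear.Build _ _ _ _ f hf).
exact: (lfunE F).
Qed.

Section Glue.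
Variables (k : comNzRingType) (A : algType k) (H : ribbon_hopf_algebra A).
Local Notation fm := (fmodule A).
Local Notation tmod := (tensor_mod H).

Lemma tensH_pure (V V' W W' : fm) (f : 'Hom(V, V')) (g : 'Hom(W, W')) x y :
  tensH H f g (x ⊗ y) = f x ⊗ g y.
Proof.
have b : bilinear_fun (fun (x : V) (y : W) => f x ⊗ g y).
  by split=> ? c u v; rewrite linearP ?tpureDl ?tpureZl ?tpureDr ?tpureZr.
rewrite /tensH linfunE; first by rewrite /tmap tlift_pure.
exact: (tlift_linear b).
Qed.

Lemma assocH_pure (U V W : fm) x y z :
  assocH H U V W (x ⊗ y ⊗ z) = x ⊗ (y ⊗ z).
Proof.
rewrite /assocH linfunE; last exact/tlift_linear/tassoc_bil.
rewrite /tassoc (tlift_pure _ _ (tassoc_bil _ _ _)) tlift_pure //.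
by split=> ? c u v; rewrite ?tpureDl ?tpureZl ?tpureDr ?tpureZr.
Qed.

Lemma assocVH_pure (U V W : fm) x y z :
  assocVH H U V W (x ⊗ (y ⊗ z)) = x ⊗ y ⊗ z.
Proof.
have b x' : bilinear_fun (fun (y : V) (z : W) => (x' : U) ⊗ y ⊗ z).
  by split=> ? c u v; rewrite ?(tpureDr, tpureZr, tpureDl, tpureZl).
have b' : bilinear_fun (fun (x : U) t => tlift (fun (y : V) (z : W) => x ⊗ y ⊗ z) t).
  split=> [t|x']; last exact: tlift_linear.
  by apply: tlift_bilin_param => y' z' c u v; rewrite !tpureDl !tpureZl.
rewrite /assocVH linfunE; last exact: (tlift_linear b').
by rewrite /tassocV !tlift_pure.
Qed.

Definition mutually_inverse (V W : fm) (f : hpair V W) : Prop :=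
  (f.1 \o f.2 = \1)%VF /\ (f.2 \o f.1 = \1)%VF.

Lemma lfun_tensor_ext (V W : fm) (U : vectType k) (f g : 'Hom(tmod V W, U)) :
  (forall x y, f (x ⊗ y) = g (x ⊗ y)) -> f = g.
Proof.
move=> h; apply/lfunP; apply: (@tensor_ext k V W U f g) => // c x y.
  exact: (linearP f).
exact: (linearP g).
Qed.

Lemma tensH_comp (V V' V'' W W' W'' : fm) (f : 'Hom(V', V'')) (g : 'Hom(W', W''))
    (f' : 'Hom(V, V')) (g' : 'Hom(W, W')) :
  (tensH H f g \o tensH H f' g' = tensH H (f \o f') (g \o g'))%VF.
Proof.
by apply: lfun_tensor_ext => x y; rewrite comp_lfunE !tensH_pure !comp_lfunE.
Qed.

Lemma tensH1 (V W : fm) : tensH H (\1%VF : 'Hom(V, V)) (\1%VF : 'Hom(W, W)) = \1%VF.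
Proof. by apply: lfun_tensor_ext => x y; rewrite tensH_pure !id_lfunE. Qed.

Lemma foldlH_inv (V W : fm) (f : hpair V W) Y :
  mutually_inverse f -> mutually_inverse (foldlH H f Y).
Proof.
elim: Y V W f => [|U Y IHY] V W f //= [f1 f2]; apply: IHY.
by split; rewrite /= tensH_comp ?f1 ?f2 comp_lfun1l tensH1.
Qed.

Lemma assoc_inv (U V W : fm) :
  mutually_inverse (assocVH H U V W, assocH H U V W).
Proof.
split.
  apply: (@lfun_tensor_ext (tmod U V) W) => t z; rewrite id_lfunE.
  apply: (tensor_ext (f := fun t : tensor U V => (assocVH H U V W \o assocH H U V W)%VF (t ⊗ z))
     (g := fun t : tensor U V => t ⊗ z)) => [c u v|c u v|x y].
  - by rewrite tpureDl tpureZl linearP.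
  - by rewrite tpureDl tpureZl.
  - by rewrite comp_lfunE assocH_pure assocVH_pure.
apply: (@lfun_tensor_ext U (tmod V W)) => x t; rewrite id_lfunE.
apply: (tensor_ext (f := fun t : tensor V W => (assocH H U V W \o assocVH H U V W)%VF (x ⊗ t))
     (g := fun t : tensor V W => x ⊗ t)) => [c u v|c u v|y z].
- by rewrite tpureDr tpureZr linearP.
- by rewrite tpureDr tpureZr.
- by rewrite comp_lfunE assocVH_pure assocH_pure.
Qed.

Lemma runit_bil (V : fm) : bilinear_fun (fun (x : V) (c : k^o) => (c : k) *: x).
Proof.
split=> [c a x y|x a c d]; first by rewrite scalerDr !scalerA mulrC.
by rewrite scalerDl [_ *: c]/GRing.scale /= -scalerA.
Qed.

Lemma runit_inv (V : fm) : mutually_inverse (runitH H V, runitVH H V).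
Proof.
have vE x : runitVH H V x = x ⊗ (1 : k^o).
  by rewrite /runitVH linfunE // => c u v; rewrite tpureDl tpureZl.
have uE x c : runitH H V (x ⊗ c) = (c : k) *: x.
  rewrite /runitH linfunE; first by rewrite tlift_pure //; exact: runit_bil.
  exact/tlift_linear/runit_bil.
split.
  by apply/lfunP => x; rewrite comp_lfunE vE uE scale1r id_lfunE.
apply: (@lfun_tensor_ext V (unit_mod H)) => x c; rewrite comp_lfunE uE vE id_lfunE.
by rewrite tpureZl -tpureZr [_ *: _]/GRing.scale /= mulr1.
Qed.

Lemma lunit_bil (V : fm) : bilinear_fun (fun (c : k^o) (x : V) => (c : k) *: x).
Proof. by case: (runit_bil V) => h1 h2; split. Qed.

Lemma lunit_inv (V : fm) : mutually_inverse (lunitH H V, lunitVH H V).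
Proof.
have vE x : lunitVH H V x = (1 : k^o) ⊗ x.
  by rewrite /lunitVH linfunE // => c u v; rewrite tpureDr tpureZr.
have uE x c : lunitH H V (c ⊗ x) = (c : k) *: x.
  rewrite /lunitH linfunE; first by rewrite tlift_pure //; exact: lunit_bil.
  exact/tlift_linear/lunit_bil.
split.
  by apply/lfunP => x; rewrite comp_lfunE vE uE scale1r id_lfunE.
apply: (@lfun_tensor_ext (unit_mod H) V) => c x; rewrite comp_lfunE uE vE id_lfunE.
by rewrite tpureZr -tpureZl [_ *: _]/GRing.scale /= mulr1.
Qed.

Lemma id_inv (V : fm) : mutually_inverse ((\1 : 'Hom(V, V)), (\1 : 'Hom(V, V)))%VF.
Proof. by split; rewrite comp_lfun1l. Qed.

Lemma glue1_inv (V U : fm) Y : mutually_inverse (glue1 H V U Y).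
Proof.
elim: Y U => [|T Y IHY] U /=; first exact: id_inv.
have [f1 f2] := IHY (tmod U T).
have [g1 g2] := foldlH_inv Y (assoc_inv V U T).
split=> /=; rewrite comp_lfunA -[X in (X \o _)%VF]comp_lfunA.
  by rewrite f1 comp_lfun1r g1.
by rewrite g2 comp_lfun1r f2.
Qed.

Lemma glue_inv X Y : mutually_inverse (glue H X Y).
Proof.
case: X => [|V X]; first exact: lunit_inv.
case: Y => [|U Y] /=.
  by elim: X V => [|T X IHX] V /=; [exact: runit_inv | exact: IHX].
by elim: X V => [|T X IHX] V /=; [exact: glue1_inv | exact: IHX].
Qed.

End Glue.

(* Framed oriented tangles are represented by generic diagrams with the
   blackboard framing, modulo planar isotopy and the framed Reidemeister
   moves.  A strand which is oriented upwards (resp. downwards) at a level of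
   the diagram has the sign + = true (resp. - = false) there. *)
Definition sign := bool.
Definition word := seq sign.

(* Cross o a b : [a; b] -> [b; a] is the crossing in which the strand from
   bottom left to top right, of sign a, passes over iff o = true.
   Cup a : [] -> [a; - a] and Cap a : [a; - a] -> []. *)
Inductive gen := Cross of bool & sign & sign | Cup of sign | Cap of sign.

Definition gsrc (g : gen) : word :=
  match g with
  | Cross _ a b => [:: a; b]
  | Cup _ => [::]
  | Cap a => [:: a; ~~ a]
  end.

Definition gtgt (g : gen) : word :=
  match g with
  | Cross _ a b => [:: b; a]
  | Cup a => [:: a; ~~ a]
  | Cap _ => [::]
  end.

Definition gen_code (g : gen) : (bool * bool * bool) + (bool + bool) :=
  match g with
  | Cross o a b => inl (o, a, b)
  | Cup a => inr (inl a)
  | Cap a => inr (inr a)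
  end.
Definition gen_decode (c : (bool * bool * bool) + (bool + bool)) : gen :=
  match c with
  | inl (o, a, b) => Cross o a b
  | inr (inl a) => Cup a
  | inr (inr a) => Cap a
  end.
Fact gen_codeK : cancel gen_code gen_decode. Proof. by case. Qed.
HB.instance Definition _ := Countable.copy gen (can_type gen_codeK).

(* A slice (l, g, r) is g between vertical strands; a diagram is the list of
   its slices from bottom to top. *)
Definition slice := (word * gen * word)%type.
Definition ssrc (e : slice) : word := e.1.1 ++ gsrc e.1.2 ++ e.2.
Definition stgt (e : slice) : word := e.1.1 ++ gtgt e.1.2 ++ e.2.

Definition whisker (l r : word) (D : seq slice) : seq slice :=
  [seq (l ++ e.1.1, e.1.2, e.2 ++ r) | e <- D].

Fixpoint is_diag (s : word) (D : seq slice) (t : word) : bool :=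
  if D is e :: D' then (s == ssrc e) && is_diag (stgt e) D' t else s == t.

Lemma is_diag_cat s D t E r :
  is_diag s D t -> is_diag t E r -> is_diag s (D ++ E) r.
Proof.
elim: D s => [|e D IHD] s /=; first by move=> /eqP ->.
by move=> /andP[-> /IHD h] /h.
Qed.

Lemma is_diag_whisker l r s D t :
  is_diag s D t -> is_diag (l ++ s ++ r) (whisker l r D) (l ++ t ++ r).
Proof.
elim: D s => [|e D IHD] s /=; first by move=> /eqP ->.
move=> /andP[/eqP -> /IHD]; rewrite /ssrc /stgt /= -!catA => ->.
by rewrite eqxx.
Qed.

Lemma is_diag_whiskerl l s D t :
  is_diag s D t -> is_diag (l ++ s) (whisker l [::] D) (l ++ t).
Proof. by move=> /(is_diag_whisker l [::]); rewrite !cats0. Qed.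

Lemma is_diag_whiskerr r s D t :
  is_diag s D t -> is_diag (s ++ r) (whisker [::] r D) (t ++ r).
Proof. exact: (@is_diag_whisker [::]). Qed.

Record diag (s t : word) := Diag { slices :> seq slice; _ : is_diag s slices t }.
HB.instance Definition _ s t := [isSub for @slices s t].
HB.instance Definition _ s t := [Choice of diag s t by <:].

Lemma diagP s t (D : diag s t) : is_diag s D t. Proof. by case: D. Qed.

Definition right_curl (o : bool) (a : sign) : seq slice :=
  [:: ([:: a], Cup a, [::]); ([::], Cross o a a, [:: ~~ a]);
      ([:: a], Cap a, [::])].
Definition left_curl (o : bool) (a : sign) : seq slice :=
  [:: ([::], Cup (~~ a), [:: a]); ([:: ~~ a], Cross o a a, [::]);
      ([::], Cap (~~ a), [:: a])].

(* Exchange, Zigzag* and Slide* generate the planar isotopies.  The curls of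
   Reidemeister1 have the same writhe and opposite rotation numbers, so that
   the move preserves the framing. *)
Inductive tangle_move : seq slice -> seq slice -> Prop :=
| Exchange g h m : tangle_move
    [:: ([::], g, m ++ gsrc h); (gtgt g ++ m, h, [::])]
    [:: (gsrc g ++ m, h, [::]); ([::], g, m ++ gtgt h)]
| ZigzagL a : tangle_move
    [:: ([::], Cup a, [:: a]); ([:: a], Cap (~~ a), [::])] [::]
| ZigzagR a : tangle_move
    [:: ([:: a], Cup (~~ a), [::]); ([::], Cap a, [:: a])] [::]
| SlideCup o a b : tangle_move
    [:: ([::], Cup a, [:: b])]
    [:: ([:: b], Cup a, [::]); ([::], Cross o b a, [:: ~~ a]);
        ([:: a], Cross o b (~~ a), [::])]
| SlideCap o a b : tangle_move
    [:: ([:: b], Cap a, [::])]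
    [:: ([::], Cross o b a, [:: ~~ a]); ([:: a], Cross o b (~~ a), [::]);
        ([::], Cap a, [:: b])]
| Reidemeister1 o a : tangle_move (right_curl o a) (left_curl o a)
| Reidemeister2 o a b : tangle_move
    [:: ([::], Cross o a b, [::]); ([::], Cross (~~ o) b a, [::])] [::]
| Reidemeister3 o a b c : tangle_move
    [:: ([::], Cross o a b, [:: c]); ([:: b], Cross o a c, [::]);
        ([::], Cross o b c, [:: a])]
    [:: ([:: a], Cross o b c, [::]); ([::], Cross o a c, [:: b]);
        ([:: c], Cross o a b, [::])].

Section Tangle.
Variables s t : word.

Definition diag_step (D E : diag s t) : Prop :=
  exists P Q l r L M, [/\ tangle_move L M,
    D = P ++ whisker l r L ++ Q :> seq slice &
    E = P ++ whisker l r M ++ Q :> seq slice].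

Definition isotopic (D E : diag s t) : bool :=
  `[< clos_refl_sym_trans _ diag_step D E >].

Lemma isotopic_equiv : equiv_class_of isotopic.
Proof.
split=> [D|D E|E D F].
- by apply/asboolP; exact: rst_refl.
- by apply/asboolP/asboolP; exact: rst_sym.
- by move=> /asboolP h1 /asboolP h2; apply/asboolP; exact: rst_trans h1 h2.
Qed.
Canonical isotopic_rel := EquivRelPack isotopic_equiv.

Definition tangle := {eq_quot isotopic}.
HB.instance Definition _ := EqQuotient.on tangle.

End Tangle.

Definition tclass s t (D : seq slice) (hD : is_diag s D t) : tangle s t :=
  \pi_(tangle s t) (Diag hD).

Lemma whisker_whisker l r l' r' D :
  whisker l r (whisker l' r' D) = whisker (l ++ l') (r' ++ r) D.
Proof. by rewrite /whisker -map_comp; apply: eq_map => e /=; rewrite !catA. Qed.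

Lemma tclass_context s t s' t' (P Q : seq slice) (l r : word) (D E : diag s t)
    (hD : is_diag s' (P ++ whisker l r D ++ Q) t')
    (hE : is_diag s' (P ++ whisker l r E ++ Q) t') :
  (forall F : diag s t, is_diag s' (P ++ whisker l r F ++ Q) t') ->
  isotopic D E -> tclass hD = tclass hE.
Proof.
move=> h /asboolP DE; have -> : hD = h D by exact: bool_irrelevance.
have -> : hE = h E by exact: bool_irrelevance.
elim: DE => {D E hD hE} [D E|D|D E _ ->|D E F _ -> _ ->] //.
move=> [P' [Q' [l' [r' [L [M [LM eD eE]]]]]]].
apply/eqmodP/asboolP/rst_step.
exists (P ++ whisker l r P'), (whisker l r Q' ++ Q), (l ++ l'), (r' ++ r), L, M.
split=> //=; rewrite -whisker_whisker.
  by rewrite eD /whisker !map_cat -!catA.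
by rewrite eE /whisker !map_cat -!catA.
Qed.

Lemma repr_tclass s t (D : diag s t) (hD : is_diag s D t) :
  isotopic (repr (tclass hD)) D.
Proof.
have e : Diag hD = D by exact: val_inj.
by rewrite -[X in isotopic _ X]e; apply/eqmodP; rewrite reprK.
Qed.

(* The dual of a word; cups u and caps u are u nested parallel arcs. *)
Definition dual_word (u : word) : word := rev (map negb u).

Fixpoint cups (u : word) : seq slice :=
  if u is a :: u' then ([::], Cup a, [::]) :: whisker [:: a] [:: ~~ a] (cups u')
  else [::].
Fixpoint caps (u : word) : seq slice :=
  if u is a :: u' then whisker [:: a] [:: ~~ a] (caps u') ++ [:: ([::], Cap a, [::])]
  else [::].

Fixpoint cross1 (a : sign) (t : word) : seq slice :=
  if t is b :: t' then
    ([::], Cross true a b, t') :: whisker [:: b] [::] (cross1 a t')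
  else [::].
(* The strands of s pass over those of t. *)
Fixpoint crossing (s t : word) : seq slice :=
  if s is a :: s' then
    whisker [:: a] [::] (crossing s' t) ++ whisker [::] s' (cross1 a t)
  else [::].
Fixpoint full_twist (s : word) : seq slice :=
  if s is a :: s' then
    whisker [::] s' (right_curl true a) ++ whisker [:: a] [::] (full_twist s')
    ++ crossing [:: a] s' ++ crossing s' [:: a]
  else [::].

Lemma dual_word_cons a u : dual_word (a :: u) = dual_word u ++ [:: ~~ a].
Proof. by rewrite /dual_word /= rev_cons cats1. Qed.

Fact cups_diag u : is_diag [::] (cups u) (u ++ dual_word u).
Proof.
elim: u => [|a u IHu] //; rewrite dual_word_cons /=.
by have := is_diag_whisker [:: a] [:: ~~ a] IHu; rewrite /= -catA.
Qed.
Fact caps_diag u : is_diag (u ++ dual_word u) (caps u) [::].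
Proof.
elim: u => [|a u IHu] //; rewrite dual_word_cons /=.
have := is_diag_whisker [:: a] [:: ~~ a] IHu; rewrite /= -catA => h.
by apply: is_diag_cat h _; rewrite /= /ssrc eqxx.
Qed.
Fact cross1_diag a t : is_diag (a :: t) (cross1 a t) (t ++ [:: a]).
Proof.
elim: t => [|b t IHt] /=; first by rewrite eqxx.
rewrite /ssrc /stgt /= eqxx /=.
exact: (is_diag_whiskerl [:: b] IHt).
Qed.
Fact crossing_diag s t : is_diag (s ++ t) (crossing s t) (t ++ s).
Proof.
elim: s => [|a s IHs] /=; first by rewrite cats0.
apply: is_diag_cat (is_diag_whiskerl [:: a] IHs) _.
by have := is_diag_whiskerr s (cross1_diag a t); rewrite -catA.
Qed.
Fact right_curl_diag o a : is_diag [:: a] (right_curl o a) [:: a].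
Proof. by rewrite /= /ssrc /stgt /= !eqxx. Qed.
Fact full_twist_diag s : is_diag s (full_twist s) s.
Proof.
elim: s => [|a s IHs] //=.
apply: (is_diag_cat (is_diag_whiskerr s (right_curl_diag true a))).
apply: (is_diag_cat (is_diag_whiskerl [:: a] IHs)).
exact: (is_diag_cat (crossing_diag [:: a] s) (crossing_diag s [:: a])).
Qed.

Fact gen_diag g : is_diag (gsrc g) [:: ([::], g, [::])] (gtgt g).
Proof. by rewrite /= /ssrc /stgt /= !cats0 !eqxx. Qed.

Fact tensor_diag s t s' t' (D : diag s t) (D' : diag s' t') :
  is_diag (s ++ s') (whisker [::] s' D ++ whisker t [::] D') (t ++ t').
Proof.
apply: is_diag_cat (is_diag_whiskerr _ (diagP D)) _.
exact: is_diag_whiskerl (diagP D').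
Qed.

(* The diagram D with its rightmost strands closed up by parallel arcs to the
   right. *)
Definition closing (s t u : word) (D : seq slice) : seq slice :=
  whisker s [::] (cups u) ++ whisker [::] (dual_word u) D
  ++ whisker t [::] (caps u).
Fact closing_diag s t u (D : diag (s ++ u) (t ++ u)) :
  is_diag s (closing s t u D) t.
Proof.
have := is_diag_whiskerl s (cups_diag u); rewrite cats0 catA => h1.
have := is_diag_whiskerl t (caps_diag u); rewrite cats0 catA => h2.
exact: is_diag_cat h1 (is_diag_cat (is_diag_whiskerr _ (diagP D)) h2).
Qed.

(* The operations do not depend on the choice of representatives: see
   comp_tclass, tenm_tclass and ptr_tclass. *)
Definition tangles : traced_data := {|
  obj := word;
  hom := tangle;
  idm s := @tclass s s [::] (eqxx s);
  comp s t r y x := tclass (is_diag_cat (diagP (repr x)) (diagP (repr y)));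
  unt := [::];
  ten := cat;
  tenm s t s' t' x y := tclass (tensor_diag (repr x) (repr y));
  braid s t := tclass (crossing_diag s t);
  twist s := tclass (full_twist_diag s);
  ptr s t u x := tclass (closing_diag (repr x)) |}.

Lemma whisker0 D : whisker [::] [::] D = D.
Proof. by rewrite -[RHS]map_id; apply: eq_map => -[[l g] r] /=; rewrite cats0. Qed.

Lemma comp_tclass s t r (D : diag s t) (E : diag t r) :
  @comp tangles s t r (tclass (diagP E)) (tclass (diagP D)) =
  tclass (is_diag_cat (diagP D) (diagP E)).
Proof.
set D' := repr (tclass (diagP D) : tangle s t).
set E' := repr (tclass (diagP E) : tangle t r).
transitivity (tclass (is_diag_cat (diagP D) (diagP E'))).
  have h (F : diag s t) : is_diag s ([::] ++ whisker [::] [::] F ++ E') r.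
    by rewrite whisker0; exact: is_diag_cat (diagP F) (diagP E').
  have := tclass_context (h D') (h D) h (repr_tclass _).
  by move: (h D') (h D); rewrite /= !whisker0 => h1 h2; 
     rewrite (bool_irrelevance h1 (is_diag_cat (diagP D') (diagP E')))
     (bool_irrelevance h2 (is_diag_cat (diagP D) (diagP E'))).
have h (F : diag t r) : is_diag s (D ++ whisker [::] [::] F ++ [::]) r.
  by rewrite whisker0 cats0; exact: is_diag_cat (diagP D) (diagP F).
have := tclass_context (h E') (h E) h (repr_tclass _).
by move: (h E') (h E); rewrite /= !whisker0 !cats0 => h1 h2; 
   rewrite (bool_irrelevance h1 (is_diag_cat (diagP D) (diagP E')))
   (bool_irrelevance h2 (is_diag_cat (diagP D) (diagP E))).
Qed.

Lemma tenm_tclass s t s' t' (D : diag s t) (E : diag s' t') :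
  @tenm tangles s t s' t' (tclass (diagP D)) (tclass (diagP E)) =
  tclass (tensor_diag D E).
Proof.
set D' := repr (tclass (diagP D) : tangle s t).
set E' := repr (tclass (diagP E) : tangle s' t').
transitivity (tclass (tensor_diag D E')).
  exact: (@tclass_context s t _ _ [::] (whisker t [::] E') [::] s' D' D _ _
    (fun F => tensor_diag F E') (repr_tclass _)).
have h (F : diag s' t') :
    is_diag (s ++ s') (whisker [::] s' D ++ whisker t [::] F ++ [::]) (t ++ t').
  by rewrite cats0; exact: tensor_diag.
have := tclass_context (h E') (h E) h (repr_tclass _).
by move: (h E') (h E); rewrite /= !cats0 => h1 h2; 
   rewrite (bool_irrelevance h1 (tensor_diag D E'))
   (bool_irrelevance h2 (tensor_diag D E)).
Qed.

Lemma ptr_tclass s t u (D : diag (s ++ u) (t ++ u)) :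
  @ptr tangles s t u (tclass (diagP D)) =
  tclass (closing_diag D).
Proof.
exact: (@tclass_context (s ++ u) (t ++ u) s t _ _ _ _ _ D _ _
  (@closing_diag s t u) (repr_tclass _)).
Qed.

Definition tgen (g : gen) : tangle (gsrc g) (gtgt g) := tclass (gen_diag g).

(* The point (i, j) is the j-th point, from the left, of the i-th level of a
   diagram: level 0 is its source and level (size D) its target.  Two points
   are linked when a strand of one slice joins them. *)
Definition levels (s : word) (D : seq slice) : seq word :=
  s :: map stgt D.

Inductive link (D : seq slice) : nat * nat -> nat * nat -> Prop :=
| LinkLeft i l g r j : onth D i = Some (l, g, r) -> (j < size l)%N ->
    link D (i, j) (i.+1, j)
| LinkRight i l g r j : onth D i = Some (l, g, r) -> (j < size r)%N ->
    link D (i, size l + size (gsrc g) + j)%N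
           (i.+1, size l + size (gtgt g) + j)%N
| LinkCrossLR i l o a b r : onth D i = Some (l, Cross o a b, r) ->
    link D (i, size l) (i.+1, (size l).+1)
| LinkCrossRL i l o a b r : onth D i = Some (l, Cross o a b, r) ->
    link D (i, (size l).+1) (i.+1, size l)
| LinkCup i l a r : onth D i = Some (l, Cup a, r) ->
    link D (i.+1, size l) (i.+1, (size l).+1)
| LinkCap i l a r : onth D i = Some (l, Cap a, r) ->
    link D (i, size l) (i, (size l).+1).

Definition same_component (D : seq slice) := clos_refl_sym_trans _ (link D).

(* Every component meets the boundary.  This and end_perm are invariant under
   the moves; they are applied to tangles through a representative. *)
Definition no_closed_component s t (D : diag s t) : Prop :=
  forall i j, (i <= size D)%N -> (j < size (nth [::] (levels s D) i))%N ->
    exists i' j', (i' = 0 \/ i' = size D)%N /\ same_component D (i, j) (i', j').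

Definition strand s t (D : diag s t) (i j : nat) : Prop :=
  same_component D (0, i)%N (size D, j).

(* The permutation mapping i to the end of the strand starting at i, which
   exists and is unique if D is a diagram of an upwards tangle. *)
Definition end_perm s t (D : diag s t) : {N : nat & 'S_N} :=
  Tagged (fun N => 'S_N) (odflt (1%g : 'S_(size s))
    [pick p : 'S_(size s) | `[< forall i : 'I_(size s), strand D i (p i) >]]).

Definition Tall : subcat tangles := @Subcat tangles (fun _ => True) (fun _ => True).
(* Tplus is the full subcategory of the words +^n; the arrows of Tup are the
   upwards tangles. *)
Definition Tplus : subcat tangles :=
  @Subcat tangles (fun s => all id s) (fun _ => True).
Definition Tup : subcat tangles :=
  @Subcat tangles (fun s => all id s)
    (fun x => no_closed_component (repr (tagged x : tangle _ _))).

Definition Tup_open_trace : open_trace Tup :=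
  @OpenTrace tangles Tup
    (fun s n => size s = n)
    (fun x p => end_perm (repr (tagged x : tangle _ _)) = p)
    (fun s t u x y =>
      [/\ sarr Tup (arr x), admissible (size s) (size u) (end_perm (repr (x : tangle _ _)))
        & y = ptr x]).

Definition Tup_incl_plus : functor Tup Tplus :=
  @functor_incl _ Tup Tplus (fun _ h => h) (fun _ _ => I).
Definition Tup_incl : functor Tup Tall :=
  @functor_incl _ Tup Tall (fun _ _ => I) (fun _ _ => I).

Section RT.
Variables (k : comNzRingType) (A : algType k) (H : ribbon_hopf_algebra A).
Variable W : fmodule A.

(* The usual functor: + goes to (W), - to (W^* ), and the braiding, the twist
   and the duality maps of + are preserved; the other cups and caps are
   obtained from these.  (The dual of (W^* ) is not equal to (W), so
   preservation of duals can only be strict for +.) *)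
Definition is_RT (F : functor Tall (fMod H)) : Prop :=
  [/\ forall X, sends_obj F [:: true] X -> X = [:: W],
      forall X, sends_obj F [:: false] X -> X = [:: dual_mod H W] &
      strict_monoidal F] /\
  [/\ preserves_braiding F, preserves_twist F,
      forall b, sends F (arr (tgen (Cap false) : hom (t := tangles) _ _)) b ->
        b = arr (evH H W : hom (t := str_fMod H) [:: dual_mod H W; W] [::]) &
      forall b, sends F (arr (tgen (Cup true) : hom (t := tangles) _ _)) b ->
        b = arr (coevH H W : hom (t := str_fMod H) [::] [:: W; dual_mod H W])].

Definition is_traced_RT (F : functor Tplus (fMod H)) : Prop :=
  [/\ forall X, sends_obj F [:: true] X -> X = [:: W], strict_monoidal F,
      preserves_braiding F, preserves_twist F & preserves_trace F].

Definition fMod_W (F : functor Tplus (fMod H)) : subcat (str_fMod H) :=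
  image_subcat (functor_comp F Tup_incl_plus).

Definition fMod_W_incl (F : functor Tplus (fMod H)) :
  functor (fMod_W F) (fMod H) := image_incl (functor_comp F Tup_incl_plus).

Definition fMod_W_open_trace (F : functor Tplus (fMod H)) :
  open_trace (fMod_W F) :=
  image_open_trace (functor_comp F Tup_incl_plus) Tup_open_trace.

Definition is_open_traced_RT (Fplus : functor Tplus (fMod H))
    (F : functor Tup (fMod_W Fplus)) : Prop :=
  [/\ forall X, sends_obj F [:: true] X -> X = [:: W], strict_monoidal F,
      preserves_braiding F, preserves_twist F &
      preserves_open_trace Tup_open_trace (fMod_W_open_trace Fplus) F].

End RT.

(* Main.v *)
(* Colour the strands of a diagram by booleans, constantly along each strand.
   Which boundary colourings extend, and whether they extend uniquely, is
   invariant under isotopy and determines the permutation of an upwards tangle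
   and the absence of closed components.

   Bending the downward strands at the top of a prefix P of a diagram down to the
   bottom turns P into an upwards tangle P#. Adding a crossing or a cup to P
   multiplies P# by crossings and curls; adding a cap closes up one strand of P#,
   which is an admissible trace because the whole diagram has no closed component.
   Hence every upwards tangle is generated by crossings under composition, tensor
   product and admissible traces. The usual functor preserves the latter: by the
   Whitney trick the clockwise cap is ev tau (theta ⊗ id) already among tangles,
   and it is sent to the right evaluation which defines the trace of module maps.
   So the two functors agree on the generators and respect the operations. *)

From Stdlib Require Import Relation_Operators Setoid Morphisms.
From Pilot Require Import Defs.
From mathcomp Require Import all_boot all_order all_algebra perm.
From mathcomp Require Import boolp zify.
Import Pilot.Defs.

Set Implicit Arguments.
Unset Strict Implicit.
Unset Printing Implicit Defensive.

(** In the comb every upward strand passes over all bent strands, so a slice below it is pushed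
    through by interchange, naturality of a crossing strand and the slide moves. What is left over
    are crossings and curls of upward strands, and a curl is itself a crossing with one strand
    closed up. Words appear as [rev v] because the comb treats the rightmost strand first.

    That composites stay in [Tup] and that closures are admissible has to be proved along the way,
    so each diagram carries its permutation ([realizes]). Colourings make this local: they solve
    linear equations over the field with two elements, invariance is a check on each move, and a
    closed component is a non-zero solution with zero boundary.

    Two obstacles are formal. The open trace on the image category is a graph, whose values may come
    from other tangles with the same image; preservation of traces by [RTplus] still identifies them
    with module traces. And words such as [plus n ++ [:: true]] and [plus n.+1] are equal without
    being convertible, whence relations on bare slice lists and on arrows. *)

Lemma catsI (T : Type) (s : seq T) : injective (cat s).
Proof. by elim: s => //= x s IHs t u [/IHs]. Qed.

Lemma catIs (T : Type) (s : seq T) : injective (cat^~ s).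
Proof. by move=> t u /(congr1 rev); rewrite !rev_cat => /catsI /(can_inj revK). Qed.

Lemma is_diag_catP s D E r :
  reflect (exists2 t, is_diag s D t & is_diag t E r) (is_diag s (D ++ E) r).
Proof.
apply: (iffP idP) => [|[t]]; last exact: is_diag_cat.
elim: D s => [|e D IHD] s /=; first by exists s.
by case/andP=> -> /IHD[t]; exists t.
Qed.

Lemma is_diag_uniq s D t t' : is_diag s D t -> is_diag s D t' -> t = t'.
Proof.
elim: D s => [|e D IHD] s /=; first by move=> /eqP <- /eqP.
by move=> /andP[_ h] /andP[_]; exact: IHD h.
Qed.

Lemma whisker_cat l r D E : whisker l r (D ++ E) = whisker l r D ++ whisker l r E.
Proof. exact: map_cat. Qed.

(** The empty diagram is excluded: whiskering leaves it empty, and it is then typed at every word,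
    whatever [l] and [r] are. *)
Lemma is_diag_unwhisker l r s D t : D <> [::] -> is_diag s (whisker l r D) t ->
  exists s0 t0, [/\ s = l ++ s0 ++ r, t = l ++ t0 ++ r & is_diag s0 D t0].
Proof.
elim: D s => [|e D IHD] s //= _ /andP[/eqP -> h].
have [D0|/IHD{}IHD] := pselect (D = [::]).
  rewrite D0 in h *; move: h => /= /eqP <-.
  exists (ssrc e), (stgt e); rewrite /= !eqxx.
  by rewrite /ssrc /stgt /= !catA.
have [s0 [t0 [e1 -> h0]]] := IHD _ h.
exists (ssrc e), t0; split => //; first by rewrite /ssrc /= !catA.
rewrite eqxx /=; suff -> : stgt e = s0 by [].
by move: e1; rewrite /stgt /= -!catA => /catsI; rewrite !catA => /catIs.
Qed.

(** * Isotopy of bare slice lists *)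

Definition isotopic_at (s t : word) (D E : seq slice) : Prop :=
  exists D' E' : diag s t, [/\ slices D' = D, slices E' = E & isotopic D' E'].

Lemma isotopic_at_refl s t D : is_diag s D t -> isotopic_at s t D D.
Proof. by move=> h; exists (Diag h), (Diag h); split=> //; apply/asboolP/rst_refl. Qed.

Lemma isotopic_at_sym s t D E : isotopic_at s t D E -> isotopic_at s t E D.
Proof.
by move=> [D' [E' [<- <- /asboolP h]]]; exists E', D'; split=> //; apply/asboolP/rst_sym.
Qed.

Lemma isotopic_at_trans s t D E F :
  isotopic_at s t D E -> isotopic_at s t E F -> isotopic_at s t D F.
Proof.
move=> [D' [E' [<- <- /asboolP h]]] [E2 [F' [/val_inj -> <- /asboolP h']]].
by exists D', F'; split=> //; apply/asboolP; apply: rst_trans h h'.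
Qed.

Lemma isotopic_at_diag s t D E : isotopic_at s t D E -> is_diag s D t /\ is_diag s E t.
Proof. by move=> [D' [E' [<- <- _]]]; split; exact: diagP. Qed.

Lemma isotopic_at_tclass s t D E (hD : is_diag s D t) (hE : is_diag s E t) :
  isotopic_at s t D E -> tclass hD = tclass hE.
Proof.
move=> [[D' hD'] [[E' hE'] [/= eD eE h]]]; subst.
rewrite /tclass (bool_irrelevance hD hD') (bool_irrelevance hE hE').
exact/eqmodP.
Qed.

(** A move inside the inner diagram is a move of the outer one: its context absorbs [P], [Q] and the
    whiskers. *)
Lemma isotopic_at_context s t s' t' P Q l r D E :
  isotopic_at s t D E -> is_diag s' P (l ++ s ++ r) -> is_diag (l ++ t ++ r) Q t' ->
  isotopic_at s' t' (P ++ whisker l r D ++ Q) (P ++ whisker l r E ++ Q).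
Proof.
move=> [D' [E' [<- <- /asboolP h]]] hP hQ.
have hF (F : diag s t) : is_diag s' (P ++ whisker l r F ++ Q) t'.
  by apply: is_diag_cat hP (is_diag_cat _ hQ); apply: is_diag_whisker (diagP F).
exists (Diag (hF D')), (Diag (hF E')); split => //; apply/asboolP.
elim: h => {D E D' E'} [D E|D|D E _|D E F _ h1 _ h2]; last 3 first.
- exact: rst_refl.
- exact: rst_sym.
- exact: rst_trans h1 h2.
move=> [P' [Q' [l' [r' [L [M [LM eD eE]]]]]]]; apply: rst_step.
exists (P ++ whisker l r P'), (whisker l r Q' ++ Q), (l ++ l'), (r' ++ r), L, M.
by split=> //=; rewrite -whisker_whisker ?eD ?eE /whisker !map_cat -!catA.
Qed.

Lemma isotopic_at_move s t L M : tangle_move L M -> is_diag s L t -> is_diag s M t ->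
  isotopic_at s t L M.
Proof.
move=> LM hL hM; exists (Diag hL), (Diag hM); split=> //.
apply/asboolP/rst_step; exists [::], [::], [::], [::], L, M.
by split=> //; rewrite /= whisker0 cats0.
Qed.

(* Rewriting D into E is allowed wherever D makes sense, so that words need not
   be tracked; an empty D, which makes sense everywhere, only refines itself. *)
Variant refines (D E : seq slice) : Prop :=
  Refines of forall s t, is_diag s D t -> isotopic_at s t D E.
Notation "D ⊑ E" := (refines D E) (at level 70).
Definition refeq (D E : seq slice) : Prop := D ⊑ E /\ E ⊑ D.
Notation "D ≃ E" := (refeq D E) (at level 70).

Lemma refines_at D E s t : D ⊑ E -> is_diag s D t -> isotopic_at s t D E.
Proof. by case=> h /h. Qed.

Lemma refines_refl D : D ⊑ D.
Proof. by split=> s t; exact: isotopic_at_refl. Qed.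

Lemma refines_trans D E F : D ⊑ E -> E ⊑ F -> D ⊑ F.
Proof.
move=> h1 h2; split=> s t /(refines_at h1) h.
by have [_ /(refines_at h2)] := isotopic_at_diag h; exact: isotopic_at_trans h.
Qed.

Lemma refines_nil D : [::] ⊑ D -> D = [::].
Proof.
(* The empty diagram is typed at [[::]] and at [[:: true]], whereas the first slice of a non-empty
   one fixes its source. *)
case: D => // e D h; have /isotopic_at_diag[_ /= /andP[/eqP h1 _]] := @refines_at _ _ [::] [::] h (eqxx _).
have /isotopic_at_diag[_ /= /andP[/eqP h2 _]] := @refines_at _ _ [:: true] [:: true] h (eqxx _).
by rewrite -h1 in h2.
Qed.

Lemma refines_context P Q l r D E : D ⊑ E ->
  P ++ whisker l r D ++ Q ⊑ P ++ whisker l r E ++ Q.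
Proof.
move=> h; have [D0|Dn] := pselect (D = [::]).
  by rewrite D0 in h *; rewrite (refines_nil h); exact: refines_refl.
split=> s t /is_diag_catP[s' hP /is_diag_catP[t' /is_diag_unwhisker []// s0 [t0 [e1 e2 h0]] hQ]].
by rewrite e1 in hP; rewrite e2 in hQ; exact: isotopic_at_context (refines_at h h0) hP hQ.
Qed.

Lemma refeq_refl D : D ≃ D. Proof. by split; exact: refines_refl. Qed.
Lemma refeq_sym D E : D ≃ E -> E ≃ D. Proof. by case. Qed.
Lemma refeq_trans D E F : D ≃ E -> E ≃ F -> D ≃ F.
Proof. by move=> [h1 h2] [h3 h4]; split; [exact: refines_trans h1 h3|exact: refines_trans h4 h2]. Qed.

Lemma refines_cat D D' E E' : D ⊑ D' -> E ⊑ E' -> D ++ E ⊑ D' ++ E'.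
Proof.
move=> h1 h2; apply: (@refines_trans _ (D' ++ E)).
  by have := @refines_context [::] E [::] [::] _ _ h1; rewrite /= !whisker0.
by have := @refines_context D' [::] [::] [::] _ _ h2; rewrite /= !whisker0 !cats0.
Qed.

Lemma refines_whisker l r D D' : D ⊑ D' -> whisker l r D ⊑ whisker l r D'.
Proof. by move=> /(@refines_context [::] [::] l r); rewrite /= !cats0. Qed.

#[export] Instance refines_preorder : PreOrder refines.
Proof. by split; [exact: refines_refl | exact: refines_trans]. Qed.
#[export] Instance refeq_equivalence : Equivalence refeq.
Proof. by split; [exact: refeq_refl | exact: refeq_sym | exact: refeq_trans]. Qed.
#[export] Instance refeq_refines : subrelation refeq refines.
Proof. by move=> D E []. Qed.
#[export] Instance refeq_refines_flip : subrelation refeq (Basics.flip refines).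
Proof. by move=> D E []. Qed.
#[export] Instance cat_refines :
  Proper (refines ++> refines ++> refines) (@cat slice).
Proof. by move=> D D' h E E' h'; exact: refines_cat. Qed.
#[export] Instance whisker_refines l r :
  Proper (refines ++> refines) (whisker l r).
Proof. by move=> D D' h; exact: refines_whisker. Qed.
#[export] Instance cat_refeq :
  Proper (refeq ==> refeq ==> refeq) (@cat slice).
Proof. by move=> D D' [? ?] E E' [? ?]; split; exact: refines_cat. Qed.
#[export] Instance whisker_refeq l r :
  Proper (refeq ==> refeq) (whisker l r).
Proof. by move=> D D' [? ?]; split; exact: refines_whisker. Qed.

(** The first slice of a non-empty diagram fixes its source, and thereby its target, so an isotopy
    at one type serves at all types. *)
Lemma isotopic_at_refeq s t D E : isotopic_at s t D E ->
  D <> [::] -> E <> [::] -> D ≃ E.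
Proof.
move=> h; have [hD hE] := isotopic_at_diag h.
move=> Dn En.
suff aux D1 E1 : D1 <> [::] -> is_diag s D1 t -> isotopic_at s t D1 E1 -> D1 ⊑ E1.
  by split; apply: aux => //; exact: isotopic_at_sym.
case: D1 => // e D1 _ /= /andP[/eqP es h1] h0; split=> s' t' /= /andP[/eqP es' h1'].
by rewrite es' -es -(is_diag_uniq h1 h1').
Qed.

(** Only this direction survives: the converse would insert a non-empty [D] at words where it makes
    no sense. *)
Lemma isotopic_at_nil s t D : isotopic_at s t D [::] -> D ⊑ [::].
Proof.
move=> h; have [hD /= /eqP est] := isotopic_at_diag h; move: h hD; rewrite -{t}est => h hD.
case: D h hD => [_ _|e D h hD]; first exact: refines_refl.
split=> s' t' hD'.
move: (hD) (hD') => /= /andP[/eqP es h1] /andP[/eqP es' h1'].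
by rewrite es' -es -(is_diag_uniq h1 h1').
Qed.

#[export] Hint Resolve refines_refl refeq_refl : core.

Lemma move_refeq s t L M : tangle_move L M -> is_diag s L t -> is_diag s M t ->
  L <> [::] -> M <> [::] -> L ≃ M.
Proof. by move=> /isotopic_at_move h hL hM; apply: isotopic_at_refeq (h _ _ hL hM). Qed.

Lemma move_nil s L : tangle_move L [::] -> is_diag s L s -> L ⊑ [::].
Proof. by move=> /isotopic_at_move h hL; apply: isotopic_at_nil (h _ _ hL (eqxx s)). Qed.

Lemma refeq_ctx P Q l r D E X Y : D ≃ E ->
  X = P ++ whisker l r D ++ Q -> Y = P ++ whisker l r E ++ Q -> X ≃ Y.
Proof. by move=> h -> ->; rewrite h. Qed.

(** In [Exchange] no strand lies outside [g] and [h]. The inner whiskers of the two slices go into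
    its middle word, the outer ones become the context. *)
Lemma interchange1 (e f : slice) m :
  [:: (e.1.1, e.1.2, e.2 ++ m ++ ssrc f); (stgt e ++ m ++ f.1.1, f.1.2, f.2)] ≃
  [:: (ssrc e ++ m ++ f.1.1, f.1.2, f.2); (e.1.1, e.1.2, e.2 ++ m ++ stgt f)].
Proof.
move: e f => [[l g] r] [[l' h] r'].
have hx := Exchange g h (r ++ m ++ l').
apply: (@refeq_ctx [::] [::] l r' _ _ _ _ (move_refeq hx
  (s := gsrc g ++ (r ++ m ++ l') ++ gsrc h)
  (t := gtgt g ++ (r ++ m ++ l') ++ gtgt h) _ _ _ _)) => //=;
  by rewrite /ssrc /stgt /= -?catA ?cats0 -?catA ?eqxx.
Qed.

Lemma interchange_slice e s' t' m E : is_diag s' E t' ->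
  [:: (e.1.1, e.1.2, e.2 ++ m ++ s')] ++ whisker (stgt e ++ m) [::] E ≃
  whisker (ssrc e ++ m) [::] E ++ [:: (e.1.1, e.1.2, e.2 ++ m ++ t')].
Proof.
elim: E s' => [|f E IHE] s' /=; first by move=> /eqP ->.
move=> /andP[/eqP -> /IHE{}IHE].
apply: (@refeq_trans _ ([:: ((ssrc e ++ m) ++ f.1.1, f.1.2, f.2 ++ [::])] ++ (
  [:: (e.1.1, e.1.2, e.2 ++ m ++ stgt f)] ++ whisker (stgt e ++ m) [::] E))).
  have := interchange1 e f m; rewrite -!catA !cats0 => h.
  by apply: (@refeq_ctx [::] (whisker (stgt e ++ m) [::] E) [::] [::] _ _ _ _ h);
     rewrite /= -?catA !cats0 -?catA.
by rewrite IHE.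
Qed.

(** Functoriality of the tensor product, obtained slice by slice; [m] is the word of idle strands
    between the two diagrams. *)
Lemma diag_interchange s t s' t' m D E : is_diag s D t -> is_diag s' E t' ->
  whisker [::] (m ++ s') D ++ whisker (t ++ m) [::] E ≃
  whisker (s ++ m) [::] E ++ whisker [::] (m ++ t') D.
Proof.
move=> hD hE; elim: D s hD => [|e D IHD] s.
  by move=> /eqP <-; rewrite /= cats0.
move=> /= /andP[/eqP -> /IHD {}IHD].
rewrite -[_ :: _ ++ _]cat1s IHD (catA [:: _] (whisker _ _ E)).
by rewrite (interchange_slice _ _ hE) -catA.
Qed.

(** * Rewriting of diagrams *)

Section Moves.
Implicit Types (o : bool) (a b c : sign) (l r s t : word).

Lemma zigzagL a : [:: ([::], Cup a, [:: a]); ([:: a], Cap (~~ a), [::])] ⊑ [::].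
Proof. by apply: (move_nil (s := [:: a])); [exact: ZigzagL | case: a]. Qed.

Lemma zigzagR a : [:: ([:: a], Cup (~~ a), [::]); ([::], Cap a, [:: a])] ⊑ [::].
Proof. by apply: (move_nil (s := [:: a])); [exact: ZigzagR | case: a]. Qed.

Lemma slide_cup o a b :
  [:: ([::], Cup a, [:: b])] ≃
  [:: ([:: b], Cup a, [::]); ([::], Cross o b a, [:: ~~ a]); ([:: a], Cross o b (~~ a), [::])].
Proof.
apply: (move_refeq (s := [:: b]) (t := [:: a; ~~ a; b])) => //.
- exact: SlideCup.
- by case: a b => [] [].
- by case: a b => [] [].
Qed.

Lemma slide_cap o a b :
  [:: ([:: b], Cap a, [::])] ≃
  [:: ([::], Cross o b a, [:: ~~ a]); ([:: a], Cross o b (~~ a), [::]); ([::], Cap a, [:: b])].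
Proof.
apply: (move_refeq (s := [:: b; a; ~~ a]) (t := [:: b])) => //.
- exact: SlideCap.
- by case: a b => [] [].
- by case: a b => [] [].
Qed.

Lemma reidemeister1 o a : right_curl o a ≃ left_curl o a.
Proof.
apply: (move_refeq (s := [:: a]) (t := [:: a])) => //.
- exact: Reidemeister1.
- by case: a.
- by case: a.
Qed.

Lemma reidemeister2 o a b :
  [:: ([::], Cross o a b, [::]); ([::], Cross (~~ o) b a, [::])] ⊑ [::].
Proof.
by apply: (move_nil (s := [:: a; b])); [exact: Reidemeister2 | case: a b => [] []].
Qed.

Lemma reidemeister3 o a b c :
  [:: ([::], Cross o a b, [:: c]); ([:: b], Cross o a c, [::]); ([::], Cross o b c, [:: a])] ≃
  [:: ([:: a], Cross o b c, [::]); ([::], Cross o a c, [:: b]); ([:: c], Cross o a b, [::])].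
Proof.
apply: (move_refeq (s := [:: a; b; c]) (t := [:: c; b; a])) => //.
- exact: Reidemeister3.
- by case: a b c => [] [] [].
- by case: a b c => [] [] [].
Qed.
End Moves.
Arguments diag_interchange {s t s' t'} m {D E} _ _.

(** One rewriting step with its place made explicit: [P] below, [Q] above, [l] and [r] aside. The
    equation on [X] leaves reassociation of lists to normalisation. *)
Lemma refines_step P Q l r D E X Y : D ⊑ E -> X = P ++ whisker l r D ++ Q ->
  P ++ whisker l r E ++ Q ⊑ Y -> X ⊑ Y.
Proof. by move=> h -> h'; apply: refines_trans h'; exact: refines_context. Qed.

Lemma refeq_step P Q l r D E X Y : D ≃ E -> X = P ++ whisker l r D ++ Q ->
  P ++ whisker l r E ++ Q ≃ Y -> X ≃ Y.
Proof. by move=> h -> h'; apply: refeq_trans h'; rewrite h. Qed.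

(** Cancelling crossings can be removed anywhere but not introduced. An equivalence that needs their
    introduction is proved by simplifying one larger diagram [D] in two ways. *)
Lemma refeq_common s t D L M : D ⊑ L -> D ⊑ M -> is_diag s D t ->
  L <> [::] -> M <> [::] -> L ≃ M.
Proof.
move=> h1 h2 hD; apply: (isotopic_at_refeq (s := s) (t := t)).
exact: isotopic_at_trans (isotopic_at_sym (refines_at h1 hD)) (refines_at h2 hD).
Qed.

Lemma refines_refeq s t D E : D ⊑ E -> is_diag s D t -> D <> [::] -> E <> [::] -> D ≃ E.
Proof. by move=> h hD Dn En; exact: (refeq_common (refines_refl D) h hD). Qed.

Lemma exchange g h (l m r : word) :
  [:: (l, g, m ++ gsrc h ++ r); (l ++ gtgt g ++ m, h, r)] ≃
  [:: (l ++ gsrc g ++ m, h, r); (l, g, m ++ gtgt h ++ r)].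
Proof.
have := interchange1 (l, g, [::]) ([::], h, r) m.
by rewrite /ssrc /stgt /= -!catA !cats0.
Qed.

Section Rotations.
Implicit Types (o : bool) (a b c : sign) (l r s t : word).

(** One of the two crossings of [slide_cup] is brought to the other side by a second Reidemeister
    move. *)
Lemma slide_cup' o a b :
  [:: ([:: b], Cup a, [::]); ([::], Cross o b a, [:: ~~ a])] ≃
  [:: ([::], Cup a, [:: b]); ([:: a], Cross (~~ o) (~~ a) b, [::])].
Proof.
symmetry; apply: (refines_refeq (s := [:: b]) (t := [:: a; b; ~~ a])) => //; last by case: a b => [] [].
apply: (@refines_step [::] [:: ([:: a], Cross (~~ o) (~~ a) b, [::])] [::] [::] _ _ _ _
  (slide_cup o a b).1) => //=.
by apply: (@refines_step [:: ([:: b], Cup a, [::]); ([::], Cross o b a, [:: ~~ a])] [::] [:: a] [::]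
  _ _ _ _ (reidemeister2 o b (~~ a))).
Qed.

Lemma slide_cap' o a b :
  [:: ([::], Cross (~~ o) a b, [:: ~~ a]); ([:: b], Cap a, [::])] ≃
  [:: ([:: a], Cross o b (~~ a), [::]); ([::], Cap a, [:: b])].
Proof.
apply: (refines_refeq (s := [:: a; b; ~~ a]) (t := [:: b])) => //; last by case: a b => [] [].
apply: (@refines_step [:: ([::], Cross (~~ o) a b, [:: ~~ a])] [::] [::] [::] _ _ _ _
  (slide_cap o a b).1) => //=.
apply: (@refines_step [::] [:: ([:: a], Cross o b (~~ a), [::]); ([::], Cap a, [:: b])] [::] [:: ~~ a]
  _ _ _ _ (reidemeister2 (~~ o) a b)) => //=.
by rewrite negbK.
Qed.

(** A quarter turn reverses the orientation of one strand of a crossing. The same strand stays on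
    top, but the other one now runs from bottom left to top right, whence [~~ o]. *)
Lemma rotate_left o a b :
  [:: ([:: ~~ a; b], Cup a, [::]); ([:: ~~ a], Cross o b a, [:: ~~ a]);
      ([::], Cap (~~ a), [:: b; ~~ a])] ≃
  [:: ([::], Cross (~~ o) (~~ a) b, [::])].
Proof.
apply: (refines_refeq (s := [:: ~~ a; b]) (t := [:: b; ~~ a])) => //; last by case: a b => [] [].
apply: (@refines_step [::] [:: ([::], Cap (~~ a), [:: b; ~~ a])] [:: ~~ a] [::] _ _ _ _
  (slide_cup' o a b).1) => //=.
have := (exchange (Cap (~~ a)) (Cross (~~ o) (~~ a) b) [::] [::] [::]).2 => /= h.
apply: (@refines_step [:: ([:: ~~ a], Cup a, [:: b])] [::] [::] [::] _ _ _ _ h) => /=.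
  by rewrite negbK.
apply: (@refines_step [::] [:: ([::], Cross (~~ o) (~~ a) b, [::])] [::] [:: b]
  _ _ _ _ (zigzagR (~~ a))) => //=.
by rewrite negbK.
Qed.

Lemma rotate_right o a b :
  [:: ([::], Cup (~~ a), [:: b; ~~ a]); ([:: ~~ a], Cross (~~ o) a b, [:: ~~ a]);
      ([:: ~~ a; b], Cap a, [::])] ≃
  [:: ([::], Cross o b (~~ a), [::])].
Proof.
apply: (refines_refeq (s := [:: b; ~~ a]) (t := [:: ~~ a; b])) => //; last by case: a b => [] [].
apply: (@refines_step [:: ([::], Cup (~~ a), [:: b; ~~ a])] [::] [:: ~~ a] [::] _ _ _ _
  (slide_cap' o a b).1) => //=.
have := (exchange (Cup (~~ a)) (Cross o b (~~ a)) [::] [::] [::]).1 => /= h.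
apply: (@refines_step [::] [:: ([:: ~~ a], Cap a, [:: b])] [::] [::] _ _ _ _ h) => /=.
  by rewrite negbK.
apply: (@refines_step [:: ([::], Cross o b (~~ a), [::])] [::] [::] [:: b]
  _ _ _ _ (zigzagL (~~ a))) => //=.
by rewrite negbK.
Qed.
End Rotations.

Lemma whisker_cons l r e D :
  whisker l r (e :: D) = (l ++ e.1.1, e.1.2, e.2 ++ r) :: whisker l r D.
Proof. by []. Qed.

Arguments whisker : simpl never.

Ltac diagram_norm :=
  rewrite ?(whisker_cat, whisker_cons, whisker_whisker) /= ?cats0 -?catA /= -?catA ?cats0.

(* The strand a crosses t from left to right, over it iff o = true. *)
Fixpoint cross_word (o : bool) (a : sign) (t : word) : seq slice :=
  if t is b :: t' then ([::], Cross o a b, t') :: whisker [:: b] [::] (cross_word o a t')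
  else [::].

Lemma cross_word_diag o a t : is_diag (a :: t) (cross_word o a t) (t ++ [:: a]).
Proof.
elim: t => [|b t IHt] /=; first by rewrite eqxx.
by rewrite /ssrc /stgt /= eqxx /=; exact: (is_diag_whiskerl [:: b] IHt).
Qed.

Lemma cross_word_cat o a s t : cross_word o a (s ++ t) =
  whisker [::] t (cross_word o a s) ++ whisker s [::] (cross_word o a t).
Proof.
elim: s => [|b s IHs] /=; first by rewrite whisker0.
by rewrite IHs whisker_cat !whisker_whisker !cats0.
Qed.

(** Cups and caps are the slide moves. [Reidemeister3] has three crossings with the same [o]; if the
    crossing [g] has the opposite one, it is conjugated by that crossing and its inverse. *)
Lemma cross_gen_natural o a g :
  ([:: a], g, [::]) :: cross_word o a (gtgt g) ≃
  cross_word o a (gsrc g) ++ [:: ([::], g, [:: a])].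
Proof.
case: g => [o' b c|b|b] /=; last 2 first.
- by symmetry; exact: slide_cup.
- exact: slide_cap.
have [<-|e] := eqVneq o o'.
  by symmetry; exact: reidemeister3.
have {e}-> : o' = ~~ o by case: o o' e => [] [].
apply: (@refeq_common [:: a; b; c] [:: c; b; a] [:: ([:: a], Cross (~~ o) b c, [::]);
  ([::], Cross o a c, [:: b]); ([:: c], Cross o a b, [::]);
  ([::], Cross o c b, [:: a]); ([::], Cross (~~ o) b c, [:: a])]) => //; last first.
- by case: a b c => [] [] [].
- apply: (@refines_step [:: ([:: a], Cross (~~ o) b c, [::])]
    [:: ([::], Cross (~~ o) b c, [:: a])] [::] [::] _ _ _ _ (reidemeister3 o a c b).1) => //=.
  apply: (@refines_step [::] [:: ([::], Cross o a b, [:: c]); ([:: b], Cross o a c, [::]);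
    ([::], Cross (~~ o) b c, [:: a])] [:: a] [::] _ _ _ _ (reidemeister2 (~~ o) b c)) => //=.
  by rewrite negbK.
- by apply: (@refines_step [:: ([:: a], Cross (~~ o) b c, [::]);
    ([::], Cross o a c, [:: b]); ([:: c], Cross o a b, [::])] [::] [::] [:: a]
    _ _ _ _ (reidemeister2 o c b)).
Qed.

Lemma cross_slice_natural o a (e : slice) :
  whisker [:: a] [::] [:: e] ++ cross_word o a (stgt e) ≃
  cross_word o a (ssrc e) ++ whisker [::] [:: a] [:: e].
Proof.
case: e => [[l g] r]; rewrite /stgt /ssrc /= !cross_word_cat.
have h1 := diag_interchange [::] (cross_word_diag o a l) (gen_diag g).
have h2 := diag_interchange [::] (gen_diag g) (cross_word_diag o a r).
apply: (refeq_step (P := [::]) (Q := whisker l r (cross_word o a (gtgt g)) ++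
  whisker (l ++ gtgt g) [::] (cross_word o a r)) (l := [::]) (r := r) (refeq_sym h1)).
  by diagram_norm.
apply: (refeq_step (P := whisker [::] (gsrc g ++ r) (cross_word o a l))
  (Q := whisker (l ++ gtgt g) [::] (cross_word o a r)) (l := l) (r := r)
  (cross_gen_natural o a g)).
  by diagram_norm.
apply: (refeq_step (P := whisker [::] (gsrc g ++ r) (cross_word o a l) ++
  whisker l r (cross_word o a (gsrc g)))
  (Q := [::]) (l := l) (r := [::]) h2).
  by diagram_norm.
by diagram_norm.
Qed.

Lemma cross_natural o a s t D : is_diag s D t ->
  whisker [:: a] [::] D ++ cross_word o a t ≃ cross_word o a s ++ whisker [::] [:: a] D.
Proof.
elim: D s => [|e D IHD] s; first by move=> /eqP ->; rewrite cats0.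
move=> /andP[/eqP -> /IHD{}IHD].
rewrite -(cat1s e D) !whisker_cat -catA IHD !catA.
by rewrite (cross_slice_natural o a e).
Qed.

Lemma is_diag_eq s t s' t' D : is_diag s D t -> s' = s -> t = t' -> is_diag s' D t'.
Proof. by move=> h -> <-. Qed.
Lemma is_diag_whisker_eq l r s t s' t' D : is_diag s D t ->
  s' = l ++ s ++ r -> l ++ t ++ r = t' -> is_diag s' (whisker l r D) t'.
Proof. by move=> h -> <-; exact: is_diag_whisker. Qed.
Lemma is_diag_nil_eq s t : s = t -> is_diag s [::] t.
Proof. by move=> ->; exact: eqxx. Qed.
Lemma is_diag_cons_eq s t e D : s = ssrc e -> is_diag (stgt e) D t -> is_diag s (e :: D) t.
Proof. by move=> -> h; rewrite /= eqxx. Qed.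

Lemma nseq_cat_cons n (T : Type) (x : T) s : nseq n x ++ x :: s = x :: nseq n x ++ s.
Proof. by elim: n => //= n ->. Qed.

Ltac word_norm := rewrite /ssrc /stgt /= ?rev_cons ?rev_cat -?cats1 /= ?negbK -?catA /= -?catA
  ?nseq_cat_cons ?cats0 /= ?cats0.
Ltac word_eq := solve [reflexivity | word_norm; reflexivity].
Ltac diag_ok := lazymatch goal with
  | |- is_true (is_diag _ (_ ++ _) _) => eapply is_diag_cat; [diag_ok | diag_ok]
  | |- is_true (is_diag _ (whisker _ _ _) _) =>
      eapply is_diag_whisker_eq; [diag_ok | word_eq | word_eq]
  | |- is_true (is_diag _ (cross_word _ _ _) _) =>
      eapply is_diag_eq; [apply: cross_word_diag | word_eq | word_eq]
  | |- is_true (is_diag _ [::] _) => apply: is_diag_nil_eq; word_eq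
  | |- is_true (is_diag _ (_ :: _) _) => eapply is_diag_cons_eq; [word_eq | diag_ok]
  | _ => eapply is_diag_eq; [eassumption | word_eq | word_eq]
  end.

Section Curls.
Implicit Types (o : bool) (a b c : sign) (l r s t : word).

Lemma left_curl_diag o a : is_diag [:: a] (left_curl o a) [:: a].
Proof. by case: a. Qed.

(** The crossing, rotated by [rotate_left], contributes a second cup. The two cups commute, and the
    first one becomes part of a curl. *)
Lemma cup_curl o a :
  [:: ([::], Cup (~~ a), [::]); ([::], Cross o (~~ a) a, [::])] ≃
  ([::], Cup a, [::]) :: whisker [::] [:: ~~ a] (left_curl (~~ o) a).
Proof.
apply: (refeq_step (P := [:: ([::], Cup (~~ a), [::])]) (Q := [::]) (l := [::]) (r := [::])
  (refeq_sym (rotate_left (~~ o) a a))); first by rewrite negbK.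
have := exchange (Cup (~~ a)) (Cup a) [::] [::] [::] => /= h.
apply: (refeq_step (P := [::]) (l := [::]) (r := [::]) (Q := [:: ([:: ~~ a], Cross (~~ o) a a, [:: ~~ a]);
  ([::], Cap (~~ a), [:: a; ~~ a])]) h); first by rewrite /= negbK.
by [].
Qed.

Lemma cap_curl o a :
  [:: ([::], Cross o a (~~ a), [::]); ([::], Cap (~~ a), [::])] ≃
  whisker [::] [:: ~~ a] (left_curl (~~ o) a) ++ [:: ([::], Cap a, [::])].
Proof.
apply: (refeq_step (P := [::]) (Q := [:: ([::], Cap (~~ a), [::])]) (l := [::]) (r := [::])
  (refeq_sym (rotate_right o a a))) => //.
have := exchange (Cap (~~ a)) (Cap a) [::] [::] [::] => /= h.
apply: (refeq_step (Q := [::]) (l := [::]) (r := [::])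
  (P := [:: ([::], Cup (~~ a), [:: a; ~~ a]); ([:: ~~ a], Cross (~~ o) a a, [:: ~~ a])])
  (refeq_sym h)); first by rewrite /= negbK.
by [].
Qed.

(* The Whitney trick. *)
Lemma curl_cancel o a : right_curl o a ++ left_curl (~~ o) a ⊑ [::].
Proof.
have hL := left_curl_diag (~~ o) a.
have h1 := diag_interchange [::] hL (gen_diag (Cap a)).
(* The second curl is pulled down along its strand to the cup of the first. There [cup_curl] makes
   it a crossing, which cancels against the first crossing once [slide_cap'] has rotated that
   one. *)
apply: (refines_step (P := [:: ([:: a], Cup a, [::]); ([::], Cross o a a, [:: ~~ a])])
  (Q := [::]) (l := [::]) (r := [::]) h1.2).
  by rewrite whisker0 cats0; case: a {hL h1}; case: o.
apply: (refines_step (P := [:: ([:: a], Cup a, [::])]) (Q := [:: ([:: a], Cap a, [::])])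
  (l := [::]) (r := [:: ~~ a]) (cross_natural o a hL).2) => //.
apply: (refines_step (P := [::]) (Q := [:: ([::], Cross o a a, [:: ~~ a]); ([:: a], Cap a, [::])])
  (l := [:: a]) (r := [::]) (cup_curl o a).2) => //.
apply: (refines_step (P := [:: ([:: a], Cup (~~ a), [::]); ([:: a], Cross o (~~ a) a, [::])]) (Q := [::])
  (l := [::]) (r := [::]) (slide_cap' (~~ o) a a).1); first by rewrite negbK.
apply: (refines_step (P := [:: ([:: a], Cup (~~ a), [::])]) (Q := [:: ([::], Cap a, [:: a])])
  (l := [:: a]) (r := [::]) (reidemeister2 o (~~ a) a)) => //.
apply: (refines_step (P := [::]) (Q := [::]) (l := [::]) (r := [::]) (zigzagR a)) => //.
Qed.

(* The right evaluation ev tau (theta ⊗ id) is the clockwise cap. *)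
Lemma cap_twist o a : whisker [::] [:: ~~ a] (right_curl o a) ++
  [:: ([::], Cross o a (~~ a), [::]); ([::], Cap (~~ a), [::])] ⊑ [:: ([::], Cap a, [::])].
Proof.
rewrite cap_curl.
apply: (refines_step (P := [::]) (Q := [:: ([::], Cap a, [::])])
  (l := [::]) (r := [:: ~~ a]) (curl_cancel o a)) => //.
Qed.

(** [cross_natural] moves diagrams out of the word being crossed, whereas here [D] lies on the
    strand running from left to right; hence the detour through the inverse crossing. *)
Lemma curl_cross o a b D : is_diag [:: a] D [:: a] ->
  whisker [::] [:: b] D ++ [:: ([::], Cross o a b, [::])] ≃
  [:: ([::], Cross o a b, [::])] ++ whisker [:: b] [::] D.
Proof.
move=> hD; have h := cross_natural (~~ o) b hD; symmetry.
have n0 X (x : slice) : X ++ [:: x] <> [::] by case: X.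
apply: (@refeq_common [:: a; b] [:: b; a] ([:: ([::], Cross o a b, [::])] ++
  (whisker [:: b] [::] D ++ cross_word (~~ o) b [:: a]) ++ [:: ([::], Cross o a b, [::])])) => //.
- apply: (refines_step (P := ([::], Cross o a b, [::]) :: whisker [:: b] [::] D) (Q := [::])
    (l := [::]) (r := [::]) (reidemeister2 (~~ o) b a)); first by rewrite /= negbK -!catA.
  by rewrite /= cats0.
- rewrite h.
  exact: (refines_step (P := [::]) (Q := whisker [::] [:: b] D ++ [:: ([::], Cross o a b, [::])])
    (l := [::]) (r := [::]) (reidemeister2 o a b)).
- by diag_ok.
Qed.

Lemma cap_twist' o a : [:: ([::], Cross o a (~~ a), [::])] ++
   whisker [:: ~~ a] [::] (right_curl o a) ++ [:: ([::], Cap (~~ a), [::])] ⊑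
   [:: ([::], Cap a, [::])].
Proof.
rewrite catA -(curl_cross o (~~ a) (right_curl_diag o a)) -catA.
exact: cap_twist.
Qed.
End Curls.

Notation plus n := (nseq n true).

Definition npos (v : word) := count id v.
Definition nneg (v : word) := count negb v.

Fixpoint uncross_word (o : bool) (a : sign) (t : word) : seq slice :=
  if t is b :: t' then
    whisker [:: b] [::] (uncross_word o a t') ++ [:: ([::], Cross (~~ o) b a, t')]
  else [::].

Lemma cross_uncross o a t : cross_word o a t ++ uncross_word o a t ⊑ [::].
Proof.
elim: t => [|b t IHt]; first by [].
apply: (refines_step (P := [:: ([::], Cross o a b, t)]) (Q := [:: ([::], Cross (~~ o) b a, t)])
  (l := [:: b]) (r := [::]) IHt).
  by rewrite /= whisker_cat -!catA.
by apply: (refines_step (P := [::]) (Q := [::]) (l := [::]) (r := t) (reidemeister2 o a b)).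
Qed.

(** * Bending downward strands *)

(* Bends the downward strands of the word rev v to the right, where they leave
   through the bottom: rev v ++ plus (nneg v) -> plus (npos v). *)
Fixpoint comb (v : word) : seq slice :=
  match v with
  | [::] => [::]
  | true :: v' => whisker (rev v') [::] (cross_word true true (plus (nneg v')))
                  ++ whisker [::] [:: true] (comb v')
  | false :: v' => (rev v', Cap false, plus (nneg v')) :: comb v'
  end.

Lemma comb_diag v : is_diag (rev v ++ plus (nneg v)) (comb v) (plus (npos v)).
Proof.
elim: v => [|[] v IHv] //; rewrite [comb _]/=.
- rewrite -[nneg (true :: v)]/(nneg v) -[npos (true :: v)]/(npos v).+1; diag_ok.
- by rewrite -[nneg (false :: v)]/(nneg v).+1 -[npos (false :: v)]/(npos v); diag_ok.
Qed.

(** The correction terms [X] and [Y] of the bending lemmas: products of crossings and curls, on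
    which the two functors are compared directly in [agree_upward]. *)
Inductive upward : nat -> seq slice -> Prop :=
| UpNil n : upward n [::]
| UpCross o : upward 2 [:: ([::], Cross o true true, [::])]
| UpCurl o : upward 1 (right_curl o true)
| UpCat n D E : upward n D -> upward n E -> upward n (D ++ E)
| UpWhisker a b n D : upward n D -> upward (a + n + b) (whisker (plus a) (plus b) D).

Lemma upward_diag n D : upward n D -> is_diag (plus n) D (plus n).
Proof.
elim=> {n D} [n|o|o|n D E _ hD _ hE|a b n D _ hD].
- exact: eqxx.
- by [].
- by case: o.
- exact: is_diag_cat hD hE.
- by rewrite !nseqD -catA; exact: is_diag_whisker.
Qed.

Lemma upward_whisker a b n m D : upward n D -> m = a + n + b ->
  upward m (whisker (plus a) (plus b) D).
Proof. by move=> h ->; exact: UpWhisker. Qed.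

Lemma upward_cross_word o n : upward n.+1 (cross_word o true (plus n)).
Proof.
elim: n => [|n IHn] /=; first exact: UpNil.
rewrite -cat1s; apply: UpCat.
  by have := UpWhisker 0 n (UpCross o).
by have := UpWhisker 1 0 IHn; rewrite add1n addn0.
Qed.

Lemma upward_uncross_word o n : upward n.+1 (uncross_word o true (plus n)).
Proof.
elim: n => [|n IHn] /=; first exact: UpNil.
apply: UpCat.
  by have := UpWhisker 1 0 IHn; rewrite add1n addn0.
by have := UpWhisker 0 n (UpCross (~~ o)).
Qed.

Arguments nneg : simpl never.
Arguments npos : simpl never.

Lemma combT v : comb (true :: v) = whisker (rev v) [::] (cross_word true true (plus (nneg v)))
                  ++ whisker [::] [:: true] (comb v).
Proof. by []. Qed.
Lemma combF v : comb (false :: v) = whisker (rev v) (plus (nneg v)) [:: ([::], Cap false, [::])] ++ comb v.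
Proof. by rewrite whisker_cons /= cats0. Qed.
Lemma nnegT v : nneg (true :: v) = nneg v. Proof. by []. Qed.
Lemma nnegF v : nneg (false :: v) = (nneg v).+1. Proof. by []. Qed.
Lemma nposT v : npos (true :: v) = (npos v).+1. Proof. by []. Qed.
Lemma nposF v : npos (false :: v) = npos v. Proof. by []. Qed.
Lemma nneg_cat u v : nneg (u ++ v) = nneg u + nneg v. Proof. exact: count_cat. Qed.
Lemma npos_cat u v : npos (u ++ v) = npos u + npos v. Proof. exact: count_cat. Qed.

Lemma whisker_nil l r : whisker l r [::] = [::]. Proof. by []. Qed.

Ltac comb_norm :=
  rewrite ?(nnegT, nnegF, nposT, nposF) /=
    ?(whisker0, whisker_cat, whisker_cons, whisker_nil, whisker_whisker) /= ?rev_cons ?rev_cat ?rev_cons -?cats1 /=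
    ?cats0 -?catA /= -?catA ?cats0 ?nseq_cat_cons /= ?cats0.

(** For [o = true] this is naturality of one strand with respect to the diagram in which the other
    crosses [t]. The case [o = false] follows by conjugation with the inverse crossing. *)
Lemma cross_pair o a b t :
  ([::], Cross o a b, t) :: whisker [:: b] [::] (cross_word true a t)
    ++ whisker [::] [:: a] (cross_word true b t) ≃
  whisker [:: a] [::] (cross_word true b t) ++ whisker [::] [:: b] (cross_word true a t)
    ++ [:: (t, Cross o a b, [::])].
Proof.
have key c d : ([::], Cross true c d, t) :: whisker [:: d] [::] (cross_word true c t)
    ++ whisker [::] [:: c] (cross_word true d t) ≃
  whisker [:: c] [::] (cross_word true d t) ++ whisker [::] [:: d] (cross_word true c t)
    ++ [:: (t, Cross true c d, [::])].
  have h := refeq_sym (cross_natural true c (cross_word_diag true d t)).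
  apply: (refeq_step (P := [::]) (Q := [::]) (l := [::]) (r := [::]) h).
    by rewrite whisker0 cats0.
  by rewrite /= whisker0 cats0 cross_word_cat whisker_cons /= cats0.
case: o; first exact: key.
have hZ := key b a.
have e1 (X : seq slice) x : X ++ [:: x] <> [::] by case: X.
apply: (@refeq_common (a :: b :: t) (t ++ [:: b; a]) (([::], Cross false a b, t) ::
  (([::], Cross true b a, t) ::  whisker [:: a] [::] (cross_word true b t) ++
  whisker [::] [:: b] (cross_word true a t)) ++ [:: (t, Cross false a b, [::])])) => //; last first.
- by rewrite catA.
- by diag_ok.
- apply: (refines_step (P := [::]) (Q := (whisker [:: a] [::] (cross_word true b t) ++
    whisker [::] [:: b] (cross_word true a t)) ++ [:: (t, Cross false a b, [::])])
    (l := [::]) (r := t) (reidemeister2 false a b)) => //.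
  by rewrite -catA.
- rewrite -cat1s hZ.
  apply: (refines_step (P := ([::], Cross false a b, t) :: whisker [:: b] [::] (cross_word true a t) ++
    whisker [::] [:: a] (cross_word true b t)) (Q := [::])
    (l := t) (r := [::]) (reidemeister2 true b a)).
    by comb_norm.
  by comb_norm.
Qed.

(** Induction on the strands [v2] to the right of the crossing, which the comb treats before it; at
    the crossing itself, [cross_pair] applies. *)
Lemma comb_cross o v1 v2 (V := v2 ++ [:: true, true & v1]) :
  exists a b, a + 2 + b = npos V /\ (rev v1, Cross o true true, rev v2 ++ plus (nneg V)) :: comb V ⊑
    comb V ++ [:: (plus a, Cross o true true, plus b)].
Proof.
rewrite {}/V; elim: v2 => [|c v2].
  exists (npos v1), 0; split; first by rewrite !nposT addn0 addn2.
  rewrite cat0s !combT.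
  apply: (refines_step (P := [::]) (Q := whisker [::] [:: true; true] (comb v1)) (l := rev v1) (r := [::])
     (cross_pair o true true (plus (nneg v1))).1); first by comb_norm.
  have h := diag_interchange [::] (comb_diag v1) (gen_diag (Cross o true true)).
  apply: (refines_step (P := whisker (rev v1) [::]
     (whisker [:: true] [::] (cross_word true true (plus (nneg v1)))
      ++ whisker [::] [:: true] (cross_word true true (plus (nneg v1))))) (Q := [::]) (l := [::]) (r := [::]) h.2);
    by comb_norm.
case: c => -[a [b [eab IH]]]; set V := v2 ++ _ in eab IH *.
  exists a, b.+1; split; first by rewrite nposT -eab addnS.
  rewrite cat_cons combT nnegT.
  have h := diag_interchange (rev v2) (gen_diag (Cross o true true)) (cross_word_diag true true (plus (nneg V))).
  apply: (refines_step (P := [::]) (Q := whisker [::] [:: true] (comb V)) (l := rev v1) (r := [::]) h.1).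
    by rewrite /V; comb_norm.
  apply: (refines_step (P := whisker (rev V) [::] (cross_word true true (plus (nneg V)))) (Q := [::])
    (l := [::]) (r := [:: true]) IH).
    by rewrite /V; comb_norm.
  by rewrite /V; comb_norm.
exists a, b; split; first by rewrite nposF -eab.
rewrite cat_cons combF nnegF.
have h := exchange (Cross o true true) (Cap false) (rev v1) (rev v2) (plus (nneg V)).
apply: (refines_step (P := [::]) (Q := comb V) (l := [::]) (r := [::]) h.1).
  by rewrite /V; comb_norm.
apply: (refines_step (P := [:: (rev V, Cap false, plus (nneg V))]) (Q := [::])
    (l := [::]) (r := [::]) IH).
  by rewrite /V; comb_norm.
by rewrite whisker0 cats0; comb_norm.
Qed.

Lemma plus_rcons n : plus n.+1 = plus n ++ [:: true].
Proof. by rewrite nseq_cat_cons cats0. Qed.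

Lemma nneg_pair a (v2 v1 : word) : nneg (v2 ++ [:: ~~ a, a & v1]) = (nneg (v2 ++ v1)).+1.
Proof. by rewrite !nneg_cat -addnS; congr addn; case: a. Qed.

Lemma npos_pair a (v2 v1 : word) : npos (v2 ++ [:: ~~ a, a & v1]) = (npos (v2 ++ v1)).+1.
Proof. by rewrite !npos_cat -addnS; congr addn; case: a. Qed.

Lemma rev_pair a (v2 v1 : word) : rev (v2 ++ [:: ~~ a, a & v1]) = rev v1 ++ [:: a, ~~ a & rev v2].
Proof. by rewrite rev_cat !rev_cons -!cats1 -!catA. Qed.

(** The cup and the comb together straighten to one additional upward strand: [X] leads it to the
    right of [comb U], and [Y] leads it to its place at the top. *)
Lemma comb_cup a v1 v2 (V := v2 ++ [:: ~~ a, a & v1]) (U := v2 ++ v1) :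
  exists X Y, [/\ upward (nneg V) X, upward (npos V) Y &
    (rev v1, Cup a, rev v2 ++ plus (nneg V)) :: comb V ⊑
    whisker (rev U) [::] X ++ whisker [::] [:: true] (comb U) ++ Y].
Proof.
rewrite {}/V {}/U; elim: v2 => [|c v2 [X [Y [hX hY]]]].
  rewrite !cat0s; case: a; [change (~~ true) with false | change (~~ false) with true].
    exists (cross_word true true (plus (nneg v1))), [::].
    split; [exact: upward_cross_word | exact: UpNil |].
    apply: (refines_step (P := [::]) (Q := comb (true :: v1)) (l := rev v1) (r := plus (nneg v1))
      (zigzagL true)); first by rewrite combT; comb_norm.
    by rewrite combT; comb_norm.
  (* In this orientation the new strand crosses the bent strand that it continues, which makes a
     left curl; [reidemeister1] turns it into a right one. *)
  exists (whisker [::] (plus (nneg v1)) (right_curl true true) ++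
    cross_word true true (plus (nneg v1))), [::].
  split.
  - apply: UpCat; last exact: upward_cross_word.
    by apply: (upward_whisker (a := 0) (UpCurl true)).
  - exact: UpNil.
  rewrite combT combF nnegT nnegF.
  have h := diag_interchange [::] (gen_diag (Cap false)) (cross_word_diag true true (plus (nneg v1))).
  apply: (refines_step (P := [:: (rev v1, Cup false, true :: plus (nneg v1));
      (rev v1 ++ [:: false], Cross true true true, plus (nneg v1))])
    (Q := whisker [::] [:: true] (comb v1)) (l := rev v1) (r := [::]) h.2).
    by comb_norm.
  apply: (refines_step (P := [::]) (Q := whisker (rev v1) [::] (cross_word true true (plus (nneg v1)))
     ++ whisker [::] [:: true] (comb v1)) (l := rev v1) (r := plus (nneg v1))
     (reidemeister1 true true).2).
    by rewrite /left_curl; comb_norm.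
  by comb_norm.
have rV := rev_pair a v2 v1; have rU := rev_cat v2 v1.
rewrite !cat_cons.
move: hX hY rV rU; set V := v2 ++ [:: _, _ & _]; set U := v2 ++ v1.
have nV : nneg V = (nneg U).+1 by exact: nneg_pair.
have pV : npos V = (npos U).+1 by exact: npos_pair.
move: V U nV pV => V U nV pV hX hY rV rU IH.
case: c.
  have hX' := upward_diag hX.
  (* The new strand arrives to the right of [c]; one crossing brings it to the left of [c], where
     [Y] applies. *)
  exists X, (whisker (plus (npos U)) [::] [:: ([::], Cross true true true, [::])] ++ whisker [::] [:: true] Y).
  rewrite nnegT nposT; split=> //.
    rewrite pV in hY *; apply: UpCat.
      by apply: (upward_whisker (b := 0) (UpCross true)); rewrite addn0 addn2.
    by apply: (upward_whisker (a := 0) (b := 1) hY); rewrite addn1.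
  have h := diag_interchange (rev v2) (gen_diag (Cup a)) (cross_word_diag true true (plus (nneg V))).
  apply: (refines_step (P := [::]) (Q := whisker [::] [:: true] (comb V)) (l := rev v1) (r := [::]) h.1).
    by rewrite combT rV nV; comb_norm.
  apply: (refines_step (P := whisker (rev U) [::] (cross_word true true (plus (nneg V)))) (Q := [::])
    (l := [::]) (r := [:: true]) IH).
    by rewrite rU nV; comb_norm.
  apply: (refines_step (P := [::]) (Q := whisker [::] [:: true; true] (comb U) ++ whisker [::] [:: true] Y)
    (l := rev U) (r := [::]) (cross_natural true true hX').2).
    by rewrite nV; comb_norm.
  have h2 := diag_interchange [::] (comb_diag U) (gen_diag (Cross true true true)).
  apply: (refines_step (P := whisker (rev U ++ [:: true]) [::] X ++ whisker (rev U) [:: true]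
      (cross_word true true (plus (nneg U)))) (Q := whisker [::] [:: true] Y)
    (l := [::]) (r := [::]) h2.2).
    by rewrite nV plus_rcons cross_word_cat; comb_norm.
  by rewrite combT; comb_norm.
have hX' := upward_diag hX.
exists (whisker [:: true] [::] X), Y; rewrite nnegF nposF; split => //.
  by apply: (upward_whisker (a := 1) (b := 0) hX); rewrite addn0.
have h := exchange (Cup a) (Cap false) (rev v1) (rev v2) (plus (nneg V)).
apply: (refines_step (P := [::]) (Q := comb V) (l := [::]) (r := [::]) h.1).
  by rewrite combF rV nV; comb_norm.
apply: (refines_step (P := [:: (rev U, Cap false, plus (nneg V))]) (Q := [::])
    (l := [::]) (r := [::]) IH).
  by rewrite rU nV; comb_norm.
have h2 := diag_interchange [::] (gen_diag (Cap false)) hX'.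
apply: (refines_step (P := [::]) (Q := whisker [::] [:: true] (comb U) ++ Y) (l := rev U) (r := [::]) h2.1).
  by rewrite nV; comb_norm.
by rewrite combF nV; comb_norm.
Qed.

Lemma curl_cancel' o a : right_curl o a ++ right_curl (~~ o) a ⊑ [::].
Proof. by rewrite (reidemeister1 (~~ o) a); exact: curl_cancel. Qed.

(** An inverse of the crossings and the curl left over by [cross_word_loop]: the opposite curl, then
    the strand crosses back over the same [n] strands. *)
Definition uncurl n : seq slice :=
  whisker (plus n) [::] (right_curl false true) ++ uncross_word true true (plus n).

Lemma uncurl_upward n : upward n.+1 (uncurl n).
Proof.
apply: UpCat; last exact: upward_uncross_word.
by apply: (upward_whisker (b := 0) (UpCurl false)); rewrite addn0 addn1.
Qed.

Lemma uncurl_diag n : is_diag (plus n ++ [:: true]) (uncurl n) (true :: plus n).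
Proof. by have := upward_diag (uncurl_upward n); rewrite -plus_rcons. Qed.

Lemma cross_curl_uncurl n : cross_word true true (plus n) ++
  whisker (plus n) [::] (right_curl true true) ++ uncurl n ⊑ [::].
Proof.
apply: (refines_step (P := cross_word true true (plus n)) (Q := uncross_word true true (plus n))
  (l := plus n) (r := [::]) (curl_cancel' true true)).
  by rewrite /uncurl; comb_norm.
exact: cross_uncross.
Qed.

(* Closing up the strand which travels right across t gives a curl. *)
Lemma cross_word_loop u t t' D : is_diag (u ++ t ++ [:: true]) D t' ->
  (u ++ true :: t, Cup true, [::]) :: whisker u [:: false] (cross_word true true (t ++ [:: true]))
  ++ whisker [::] [:: true; false] D ++ [:: (t', Cap true, [::])] ⊑
  whisker u [::] (cross_word true true t) ++ whisker (u ++ t) [::] (right_curl true true) ++ D.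
Proof.
move=> hD; have hC := diag_interchange [::] hD (gen_diag (Cap true)).
apply: (refines_step (P := (u ++ true :: t, Cup true, [::]) ::
   whisker u [:: false] (cross_word true true (t ++ [:: true]))) (Q := [::]) (l := [::]) (r := [::]) hC.1).
  by comb_norm.
have h := diag_interchange [::] (cross_word_diag true true t) (gen_diag (Cup true)).
apply: (refines_step (P := [::]) (Q := (u ++ t, Cross true true true, [:: false]) ::
   (u ++ t ++ [:: true], Cap true, [::]) :: D) (l := u) (r := [::]) h.2).
  by rewrite cross_word_cat; comb_norm.
by rewrite /right_curl; comb_norm.
Qed.

(* A cap below the comb closes up the last strand, up to crossings and curls X, Y. *)
Lemma comb_cap a v1 v2 (V := v2 ++ [:: ~~ a, a & v1]) (U := v2 ++ v1) :
  exists X Y, [/\ upward (nneg V) X, upward (npos V) Y &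
    (rev V ++ plus (nneg U), Cup true, [::]) ::
    whisker [::] [:: false] (whisker (rev V) [::] X ++ comb V ++ Y)
      ++ [:: (plus (npos U), Cap true, [::])] ⊑
    (rev v1, Cap a, rev v2 ++ plus (nneg U)) :: comb U].
Proof.
rewrite {}/V {}/U; elim: v2 => [|c v2 [X [Y [hX hY]]]].
  rewrite !cat0s; have hv := diag_interchange [::] (comb_diag v1) (gen_diag (Cap true)).
  set q := nneg v1 in hv *.
  case: a; [change (~~ true) with false | change (~~ false) with true].
    have hQ := UpWhisker 0 q (UpCurl true).
    (* After [uncurl] has done its work, [Cross true true false] and [Cap false] remain; the
       additional curl makes them the clockwise cap, by [cap_twist']. *)
    exists (uncurl q ++ whisker [::] (plus q) (right_curl true true)), [::]; split.
    - by apply: UpCat => //; rewrite nnegF; exact: uncurl_upward.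
    - exact: UpNil.
    rewrite combF combT nnegT -/q.
    apply: (refines_step (P := (rev v1 ++ [:: true, false & plus q], Cup true, [::]) ::
      whisker (rev v1 ++ [:: true; false]) [:: false] (uncurl q ++ whisker [::] (plus q) (right_curl true true))
      ++ (rev v1 ++ [:: true], Cap false, plus q ++ [:: false]) ::
      whisker (rev v1) [:: false] (cross_word true true (plus q))) (Q := [::]) (l := [::]) (r := [::]) hv.1).
      by comb_norm.
    pose D := whisker [:: false] [::] (uncurl q ++ whisker [::] (plus q) (right_curl true true)) ++
      [:: ([::], Cap false, plus q)].
    have hD : is_diag ((false :: plus q) ++ [:: true]) D (plus q).
      have := uncurl_diag q; have := right_curl_diag true true.
      by rewrite /D => h1 h2; diag_ok.
    apply: (refines_step (P := [:: (rev v1 ++ [:: true, false & plus q], Cup true, [::])])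
      (Q := (rev v1 ++ plus q, Cap true, [::]) :: comb v1) (l := rev v1) (r := [:: false])
      (cross_natural true true hD).1).
      by rewrite /D; comb_norm.
    apply: (refines_step (P := [::]) (Q := comb v1) (l := rev v1) (r := [::])
      (cross_word_loop (u := [::]) hD)).
      by rewrite /D; comb_norm.
    apply: (refines_step (P := [:: (rev v1, Cross true true false, plus q)])
      (Q := whisker (rev v1 ++ [:: false]) (plus q) (right_curl true true) ++
      (rev v1, Cap false, plus q) :: comb v1) (l := rev v1 ++ [:: false]) (r := [::])
      (cross_curl_uncurl q)).
      by rewrite /D; comb_norm.
    apply: (refines_step (P := [::]) (Q := comb v1) (l := rev v1) (r := plus q) (cap_twist' true true)).
      by comb_norm.
    by comb_norm.
  (* Here the comb itself supplies the required [Cap false], so only the detour of the closed strand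
     has to be undone. *)
  exists (uncurl q), [::]; split; [exact: uncurl_upward | exact: UpNil |].
  rewrite combT combF nnegF -/q.
  apply: (refines_step (P := (rev v1 ++ [:: false, true & plus q], Cup true, [::]) ::
      whisker (rev v1 ++ [:: false; true]) [:: false] (uncurl q)
      ++ whisker (rev v1 ++ [:: false]) [:: false] (cross_word true true (plus q.+1)) ++
      [:: (rev v1, Cap false, plus q ++ [:: true; false])]) (Q := [::]) (l := [::]) (r := [::]) hv.1).
    by comb_norm.
  pose D := whisker [:: false] [::] (uncurl q) ++ [:: ([::], Cap false, plus q)].
  have hD : is_diag ([:: false] ++ plus q ++ [:: true]) D (plus q).
    by have := uncurl_diag q; rewrite /D => h1; diag_ok.
  have hX : is_diag (plus q.+1) (uncurl q) (plus q.+1) by exact: upward_diag (uncurl_upward q).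
  apply: (refines_step (P := [:: (rev v1 ++ [:: false, true & plus q], Cup true, [::])])
      (Q := (rev v1, Cap false, plus q ++ [:: true; false]) ::
      (rev v1 ++ plus q, Cap true, [::]) :: comb v1) (l := rev v1 ++ [:: false]) (r := [:: false])
      (cross_natural true true hX).1).
    by comb_norm.
  apply: (refines_step (P := [::]) (Q := comb v1) (l := rev v1) (r := [::])
      (cross_word_loop (u := [:: false]) hD)).
    by rewrite plus_rcons /D; comb_norm.
  apply: (refines_step (P := [::])
      (Q := (rev v1, Cap false, plus q) :: comb v1) (l := rev v1 ++ [:: false]) (r := [::])
      (cross_curl_uncurl q)).
    by rewrite /D; comb_norm.
  by comb_norm.
have rV := rev_pair a v2 v1; have rU := rev_cat v2 v1.
rewrite !cat_cons.
move: hX hY rV rU; set V := v2 ++ [:: _, _ & _]; set U := v2 ++ v1.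
have nV : nneg V = (nneg U).+1 by exact: nneg_pair.
have pV : npos V = (npos U).+1 by exact: npos_pair.
move: V U nV pV => V U nV pV hX hY rV rU IH.
have hX' := upward_diag hX; have hY' := upward_diag hY; have hV := comb_diag V.
case: c.
  (* After [Y] the strand to be closed lies to the left of [c]; the added crossing makes it the last
     one. Its sign is such that [slide_cap'] turns it into a crossing of [c] over the closing arc,
     which then slides down to the cup. *)
  exists X, (whisker [::] [:: true] Y ++ whisker (plus (npos U)) [::] [:: ([::], Cross false true true, [::])]).
  rewrite nnegT nposT; split=> //.
    rewrite pV in hY *; apply: UpCat.
      by apply: (upward_whisker (a := 0) (b := 1) hY); rewrite addn1.
    by apply: (upward_whisker (b := 0) (UpCross false)); rewrite addn0 addn2.
  apply: (refines_step (P := [:: (rev V ++ true :: plus (nneg U), Cup true, [::])])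
      (Q := whisker [::] [:: true; false] (comb V) ++ whisker [::] [:: true; false] Y ++
       [:: (plus (npos U), Cross false true true, [:: false]); (plus (npos U).+1, Cap true, [::])])
      (l := rev V) (r := [:: false]) (cross_natural true true hX').1).
    by rewrite combT nV; comb_norm.
  apply: (refines_step (P := (rev V ++ true :: plus (nneg U), Cup true, [::]) ::
      whisker (rev V) [:: false] (cross_word true true (plus (nneg V))) ++
      whisker [::] [:: true; false] (whisker (rev V) [::] X ++ comb V ++ Y)) (Q := [::])
      (l := plus (npos U)) (r := [::]) (slide_cap' true true true).1).
    by comb_norm.
  pose Z := whisker (rev V) [::] X ++ comb V ++ Y.
  have hZ : is_diag (rev V ++ plus (nneg V)) Z (plus (npos V)) by rewrite /Z; diag_ok.
  have hc := diag_interchange [::] hZ (gen_diag (Cross true true false)).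
  apply: (refines_step (P := (rev V ++ true :: plus (nneg U), Cup true, [::]) ::
      whisker (rev V) [:: false] (cross_word true true (plus (nneg V))))
      (Q := [:: (plus (npos U), Cap true, [:: true])]) (l := [::]) (r := [::]) hc.1).
    by rewrite /Z pV; comb_norm.
  have hC : is_diag (plus (nneg U)) [:: (plus (nneg U), Cup true, [::])]
     (plus (nneg U) ++ [:: true; false]) by diag_ok.
  apply: (refines_step (P := [::]) (Q := whisker [::] [:: false; true] Z ++
      [:: (plus (npos U), Cap true, [:: true])]) (l := rev V) (r := [::]) (cross_natural true true hC).1).
    by rewrite nV plus_rcons !cross_word_cat; comb_norm.
  apply: (refines_step (P := whisker (rev V) [::] (cross_word true true (plus (nneg U))))
     (Q := [::]) (l := [::]) (r := [:: true]) IH).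
    by rewrite /Z; comb_norm.
  have h := diag_interchange (rev v2) (gen_diag (Cap a)) (cross_word_diag true true (plus (nneg U))).
  apply: (refines_step (P := [::]) (Q := whisker [::] [:: true] (comb U)) (l := rev v1) (r := [::]) h.2).
    by rewrite rV; comb_norm.
  by rewrite combT rU; comb_norm.
exists (whisker [:: true] [::] X), Y; rewrite nnegF nposF; split => //.
  by apply: (upward_whisker (a := 1) (b := 0) hX); rewrite addn0.
have h1 := diag_interchange [::] (gen_diag (Cap false)) hX'.
apply: (refines_step (P := [:: (rev V ++ [:: false, true & plus (nneg U)], Cup true, [::])])
  (Q := whisker [::] [:: false] (comb V ++ Y) ++ [:: (plus (npos U), Cap true, [::])])
  (l := rev V) (r := [:: false]) h1.2).
  by rewrite combF nV; comb_norm.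
have h2 := exchange (Cap false) (Cup true) (rev V) (plus (nneg U)) [::].
apply: (refines_step (P := [::]) (Q := whisker [::] [:: false] (whisker (rev V) [::] X ++ comb V ++ Y)
  ++ [:: (plus (npos U), Cap true, [::])]) (l := [::]) (r := [::]) h2.2).
  by rewrite nV; comb_norm.
apply: (refines_step (P := [:: (rev V, Cap false, plus (nneg U))]) (Q := [::])
  (l := [::]) (r := [::]) IH).
  by comb_norm.
have h := exchange (Cap a) (Cap false) (rev v1) (rev v2) (plus (nneg U)).
apply: (refines_step (P := [::]) (Q := comb U) (l := [::]) (r := [::]) h.2).
  by rewrite rV; comb_norm.
by rewrite combF rU; comb_norm.
Qed.

(** * Colourings *)

(** Signs of strands and of crossings are ignored. The conditions are linear over the field with two
    elements, as [coloring_xor] exploits. *)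
Definition gen_color (g : gen) (c c' : seq bool) : Prop :=
  match g with
  | Cross _ _ _ => exists x y, c = [:: x; y] /\ c' = [:: y; x]
  | Cup _ => c = [::] /\ exists x, c' = [:: x; x]
  | Cap _ => c' = [::] /\ exists x, c = [:: x; x]
  end.

Definition slice_color (e : slice) (c c' : seq bool) : Prop :=
  exists cl cg cg' cr, [/\ size cl = size e.1.1, size cr = size e.2,
    c = cl ++ cg ++ cr, c' = cl ++ cg' ++ cr & gen_color e.1.2 cg cg'].

(* c colours the points of the bottom level of D, and w those of the levels
   above, constantly along the strands. *)
Fixpoint coloring (D : seq slice) (c : seq bool) (w : seq (seq bool)) : Prop :=
  match D, w with
  | [::], [::] => True
  | e :: D', c' :: w' => slice_color e c c' /\ coloring D' c' w'
  | _, _ => False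
  end.

Definition color_rel D c c' := exists2 w, coloring D c w & last c w = c'.

(* No closed component: the boundary determines the colouring. *)
Definition rigid n D := forall c w1 w2, size c = n ->
  coloring D c w1 -> coloring D c w2 -> last c w1 = last c w2 -> w1 = w2.

Definition color_equiv n D E := forall c c', size c = n ->
  color_rel D c c' <-> color_rel E c c'.

Lemma gen_color_size g c c' : gen_color g c c' ->
  size c = size (gsrc g) /\ size c' = size (gtgt g).
Proof.
by case: g => [o a b [x [y [-> ->]]]|a [-> [x ->]]|a [-> [x ->]]].
Qed.

Lemma coloring_size s D t c w : is_diag s D t -> size c = size s -> coloring D c w ->
  size w = size D /\ size (last c w) = size t.
Proof.
elim: D s c w => [|e D IHD] s c [|c' w] //=; first by move=> /eqP <-.
move=> /andP[/eqP -> hD] _ [[cl [cg [cg' [cr [h1 h2 _ -> /gen_color_size [h3 h4]]]]]]].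
move=> /IHD -/(_ _ hD) [|-> ->] //.
by rewrite /stgt !size_cat h1 h2 h4.
Qed.

Lemma coloring_cat D E c w : coloring (D ++ E) c w <->
  exists w1 w2, [/\ w = w1 ++ w2, coloring D c w1 & coloring E (last c w1) w2].
Proof.
elim: D c w => [|e D IHD] c w /=.
  by split=> [h|[[|? ?] [w2 [-> //]]]]; exists [::], w.
split; last by move=> [[|c1 w1] [w2 [-> []]]] // h1 h2 h3; split=> //; apply/IHD; exists w1, w2.
case: w => // c1 w [h1 /IHD [w1 [w2 [-> h2 h3]]]].
by exists (c1 :: w1), w2.
Qed.

Lemma color_rel_cat D E c c' : color_rel (D ++ E) c c' <->
  exists2 c1, color_rel D c c1 & color_rel E c1 c'.
Proof.
split=> [[w /coloring_cat[w1 [w2 [-> h1 h2]]] <-]|[c1 [w1 h1 <-] [w2 h2 <-]]].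
  by exists (last c w1); [exists w1 | exists w2; rewrite ?last_cat].
by exists (w1 ++ w2); [apply/coloring_cat; exists w1, w2 | rewrite last_cat].
Qed.

Lemma cat3_inj (T : Type) (s1 s2 s3 t1 t2 t3 : seq T) : size s1 = size t1 -> size s3 = size t3 ->
  s1 ++ s2 ++ s3 = t1 ++ t2 ++ t3 -> [/\ s1 = t1, s2 = t2 & s3 = t3].
Proof.
elim: s1 t1 => [|x s1 IHs] [|y t1] //=; last first.
  by move=> [h] h3 [-> /IHs -/(_ h h3)[-> -> ->]].
move=> _ h3 e; have h2 : size s2 = size t2.
  by move/(congr1 size): e; rewrite !size_cat h3 => /addIn.
elim: s2 t2 h2 e => [|x s2 IHs] [|y t2] //= [h] [-> e].
by have [_ -> ->] := IHs _ h e.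
Qed.

Lemma cat3_split (T : Type) (s1 s2 s3 t1 t2 t3 : seq T) n m :
  size t1 = size s1 + n -> size t3 = m + size s3 -> s1 ++ s2 ++ s3 = t1 ++ t2 ++ t3 ->
  exists u v, [/\ t1 = s1 ++ u, t3 = v ++ s3, s2 = u ++ t2 ++ v, size u = n & size v = m].
Proof.
move=> h1 h3 e; exists (drop (size s1) t1), (take m t3).
rewrite -{1}(cat_take_drop (size s1) t1) -{1}(cat_take_drop m t3) in e.
rewrite -!catA in e.
have := @cat3_inj T s1 s2 s3 (take (size s1) t1)
   (drop (size s1) t1 ++ t2 ++ take m t3) (drop m t3).
rewrite -!catA => -[| |//|e1 e2 e3].
- by rewrite size_takel // h1 leq_addr.
- by rewrite size_drop h3 addKn.
split=> //; last by rewrite size_takel // h3 leq_addr.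
- by rewrite {1}e1 cat_take_drop.
- by rewrite {1}e3 cat_take_drop.
- by rewrite size_drop h1 addKn.
Qed.

Lemma coloring_whisker l r D cl c cr w : size cl = size l -> size cr = size r ->
  coloring (whisker l r D) (cl ++ c ++ cr) w <->
  exists2 w0, w = [seq cl ++ x ++ cr | x <- w0] & coloring D c w0.
Proof.
move=> hl hr; elim: D c w => [|e D IHD] c [|c' w].
- by split=> // _; exists [::].
- by split=> // -[[]].
- by split=> // -[[]].
rewrite whisker_cons /=; split.
  move=> [[dl [cg [cg' [dr [h1 h2 e1 e2 hg]]]]]].
  rewrite /= !size_cat -hl -hr in h1 h2.
  have [u [v [e3 e4 e5 e6 e7]]] := cat3_split h1 h2 e1.
  have e8 : c' = cl ++ (u ++ cg' ++ v) ++ cr by rewrite e2 e3 e4 -!catA.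
  rewrite e8 => /IHD [w0 -> hw]; exists ((u ++ cg' ++ v) :: w0) => //.
  by split=> //; exists u, cg, cg', v.
move=> [[|c1 w0] //= [-> ->] [[u [cg [cg' [v [e6 e7 e1 e2 hg]]]]] hw]].
split; last by apply/IHD; exists w0.
exists (cl ++ u), cg, cg', (v ++ cr).
by rewrite !size_cat e6 e7 hl hr e1 e2 -!catA.
Qed.

Lemma last_map_whisker cl (c : seq bool) cr (w : seq (seq bool)) :
  last (cl ++ c ++ cr) [seq cl ++ x ++ cr | x <- w] = cl ++ last c w ++ cr.
Proof. exact: (last_map (fun x => cl ++ x ++ cr)). Qed.

Lemma size_split3 (c : seq bool) i j k : size c = i + j + k ->
  exists c1 c2 c3, [/\ c = c1 ++ c2 ++ c3, size c1 = i, size c2 = j & size c3 = k].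
Proof.
move=> h; exists (take i c), (take j (drop i c)), (drop j (drop i c)).
split; first by rewrite !cat_take_drop.
- by rewrite size_takel // h -addnA leq_addr.
- by rewrite size_takel // size_drop h -addnA addKn leq_addr.
- by rewrite !size_drop h -addnA !addKn.
Qed.

Lemma rigid_whisker l r n D : rigid n D -> rigid (size l + n + size r) (whisker l r D).
Proof.
move=> h c w1 w2 /size_split3[cl [c0 [cr [-> e1 e2 e3]]]].
move=> /coloring_whisker-/(_ e1 e3)[w1' -> h1] /coloring_whisker-/(_ e1 e3)[w2' -> h2].
rewrite !last_map_whisker => /cat3_inj[] // _ e _.
by rewrite (h c0 w1' w2').
Qed.

Lemma color_rel_whisker l r D cl c cr c' : size cl = size l -> size cr = size r ->
  color_rel (whisker l r D) (cl ++ c ++ cr) c' <->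
  exists2 c0, c' = cl ++ c0 ++ cr & color_rel D c c0.
Proof.
move=> hl hr; split=> [[w /coloring_whisker-/(_ hl hr)[w0 -> h] <-]|[c0 -> [w h <-]]].
  by exists (last c w0); [rewrite last_map_whisker | exists w0].
exists [seq cl ++ x ++ cr | x <- w]; last by rewrite last_map_whisker.
by apply/coloring_whisker => //; exists w.
Qed.

Lemma color_equiv_whisker l r n D E : color_equiv n D E ->
  color_equiv (size l + n + size r) (whisker l r D) (whisker l r E).
Proof.
move=> h c c' /size_split3[cl [c0 [cr [-> e1 e2 e3]]]].
by split=> /color_rel_whisker-/(_ e1 e3)[c1 -> /h-/(_ e2) ?]; apply/color_rel_whisker => //; exists c1.
Qed.

Lemma color_equiv_sym n D E : color_equiv n D E -> color_equiv n E D.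
Proof. by move=> h c c' /h e; split=> /e. Qed.

Ltac color_inv := repeat match goal with
  | H : coloring (_ :: _) _ ?w |- _ => destruct w as [|? w]; [by destruct H |];
      destruct H as [[? [? [? [? [? ? ? ? ?]]]]] ?]
  | H : coloring [::] _ ?w |- _ => destruct w as [|? w]; [clear H | by destruct H]
  | H : gen_color _ _ _ |- _ => simpl in H
  | H : exists _, _ |- _ => destruct H
  | H : _ /\ _ |- _ => destruct H
  | H : size ?s = _ |- _ => simpl in H;
      (is_var s; destruct s as [|? s]; simpl in H; try discriminate H;
      try (apply eq_add_S in H)) || clear H
  | H : _ = _ |- _ => progress (simpl in H; try discriminate H) || (progress subst) ||
       (injection H; clear H; intros)
  end.

Lemma slice_color_cross l o a b r cl x y cr : size cl = size l -> size cr = size r ->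
  slice_color (l, Cross o a b, r) (cl ++ [:: x; y] ++ cr) (cl ++ [:: y; x] ++ cr).
Proof. by move=> h1 h2; exists cl, [:: x; y], [:: y; x], cr; split=> //; exists x, y. Qed.

Lemma slice_color_cup l a r cl x cr : size cl = size l -> size cr = size r ->
  slice_color (l, Cup a, r) (cl ++ cr) (cl ++ [:: x; x] ++ cr).
Proof. by move=> h1 h2; exists cl, [::], [:: x; x], cr; split=> //; split=> //; exists x. Qed.

Lemma slice_color_cap l a r cl x cr : size cl = size l -> size cr = size r ->
  slice_color (l, Cap a, r) (cl ++ [:: x; x] ++ cr) (cl ++ cr).
Proof. by move=> h1 h2; exists cl, [:: x; x], [::], cr; split=> //; split=> //; exists x. Qed.

Ltac slice_solve :=
  match goal with |- slice_color (?l, ?g, ?r) ?c _ =>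
   let cl := eval lazy in (take (size l) c) in
   let c1 := eval lazy in (drop (size l) c) in
   let cg := eval lazy in (take (size (gsrc g)) c1) in
   let cr := eval lazy in (drop (size (gsrc g)) c1) in
   lazymatch g with
   | Cross _ _ _ => eapply (@slice_color_cross _ _ _ _ _ cl _ _ cr); (lazy; reflexivity)
   | Cup _ => eapply (@slice_color_cup _ _ _ cl _ cr); (lazy; reflexivity)
   | Cap _ => eapply (@slice_color_cap _ _ _ cl _ cr); (lazy; reflexivity)
   end
  end.

Lemma color_rel_cons e D c c1 c' : slice_color e c c1 -> color_rel D c1 c' ->
  color_rel (e :: D) c c'.
Proof. by move=> h [w hw <-]; exists (c1 :: w). Qed.

Lemma color_rel_nil c c' : c = c' -> color_rel [::] c c'.
Proof. by move=> ->; exists [::]. Qed.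

Ltac move_color := split; [move=> ? ? ? ? ? ? ? | move=> ? ? ? ? ? ? ?|
   move=> ? ? ?; split=> -[? ? ?]]; color_inv; try reflexivity;
   repeat (eapply color_rel_cons; [slice_solve|]); apply: color_rel_nil; reflexivity.

Lemma cat_inj_size (T : eqType) (s1 s2 t1 t2 : seq T) : size s1 = size t1 ->
  s1 ++ s2 = t1 ++ t2 -> s1 = t1 /\ s2 = t2.
Proof. by move=> h /eqP; rewrite eqseq_cat // => /andP[/eqP -> /eqP ->]. Qed.

Section ExchangeColor.
Variables (g h : gen) (m : word).
Let L := [:: ([::], g, m ++ gsrc h); (gtgt g ++ m, h, [::])].
Let M := [:: (gsrc g ++ m, h, [::]); ([::], g, m ++ gtgt h)].

(** [Exchange] is the one move with arbitrary generators and an arbitrary word between them, so its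
    colourings are described by hand. *)
Lemma exchangeL_color c w : coloring L c w <-> exists cg cg' cm ch ch',
  [/\ gen_color g cg cg', gen_color h ch ch', size cm = size m, c = cg ++ cm ++ ch &
      w = [:: cg' ++ cm ++ ch; cg' ++ cm ++ ch']].
Proof.
split; last first.
  move=> [cg [cg' [cm [ch [ch' [hg hh hm -> ->]]]]]].
  have [g1 g2] := gen_color_size hg; have [h1 h2] := gen_color_size hh.
  split; first by exists [::], cg, cg', (cm ++ ch); rewrite !size_cat hm h1.
  split=> //; exists (cg' ++ cm), ch, ch', [::].
  by rewrite !size_cat hm g2 !cats0 -!catA.
case: w => [[]|c1 [[_ []]|c2 [[]|? ?]]] //=; last by case=> _ [].
move=> [z1 [cg [cg' [cr [/size0nil ez1 e1 e2 e3 hg]]]]] [[cl [ch [ch' [z2 [e4 /size0nil ez2 e5 e6 hh]]]]] _].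
rewrite /= ?ez1 ?ez2 ?cats0 /= in e1 e2 e3 e4 e5 e6 hg hh.
have [g1 g2] := gen_color_size hg; have [h1 h2] := gen_color_size hh.
exists cg, cg', (take (size m) cr), ch, ch'.
have ecl : cl = cg' ++ take (size m) cr /\ ch = drop (size m) cr.
  apply: cat_inj_size; last by rewrite -e5 e3 -catA cat_take_drop.
  by rewrite e4 !size_cat g2 size_takel // e1 size_cat leq_addr.
case: ecl => ecl ech; split=> //.
- by rewrite size_takel // e1 size_cat leq_addr.
- by rewrite ech cat_take_drop.
- by rewrite {1}ech cat_take_drop e3 e6 ecl -catA.
Qed.

Lemma exchangeM_color c w : coloring M c w <-> exists cg cg' cm ch ch',
  [/\ gen_color g cg cg', gen_color h ch ch', size cm = size m, c = cg ++ cm ++ ch &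
      w = [:: cg ++ cm ++ ch'; cg' ++ cm ++ ch']].
Proof.
split; last first.
  move=> [cg [cg' [cm [ch [ch' [hg hh hm -> ->]]]]]].
  have [g1 g2] := gen_color_size hg; have [h1 h2] := gen_color_size hh.
  split; first by exists (cg ++ cm), ch, ch', [::]; rewrite !size_cat hm g1 !cats0 -!catA.
  by split=> //; exists [::], cg, cg', (cm ++ ch'); rewrite !size_cat hm h2.
case: w => [[]|c1 [[_ []]|c2 [[]|? ?]]] //=; last by case=> _ [].
move=> [cl [ch [ch' [z2 [e4 /size0nil ez2 e5 e6 hh]]]]] [[z1 [cg [cg' [cr [/size0nil ez1 e1 e2 e3 hg]]]]] _].
rewrite /= ?ez1 ?ez2 ?cats0 /= in e1 e2 e3 e4 e5 e6 hg hh.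
have [g1 g2] := gen_color_size hg; have [h1 h2] := gen_color_size hh.
exists cg, cg', (take (size m) cr), ch, ch'.
have ecl : cl = cg ++ take (size m) cr /\ ch' = drop (size m) cr.
  apply: cat_inj_size; last by rewrite -e6 e2 -catA cat_take_drop.
  by rewrite e4 !size_cat g1 size_takel // e1 size_cat leq_addr.
case: ecl => ecl ech; split=> //.
- by rewrite size_takel // e1 size_cat leq_addr.
- by rewrite e5 ecl -catA.
- by rewrite ech cat_take_drop -e2 e3.
Qed.

Lemma exchange_color n : [/\ rigid n L, rigid n M & color_equiv n L M].
Proof.
split.
- move=> c w1 w2 _ /exchangeL_color[cg [cg' [cm [ch [ch' [hg hh hm -> ->]]]]]].
  move=> /exchangeL_color[dg [dg' [dm [dh [dh' [kg kh km e ->]]]]]] /= e'.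
  have [g1 g2] := gen_color_size hg; have [h1 h2] := gen_color_size hh.
  have [g3 g4] := gen_color_size kg; have [h3 h4] := gen_color_size kh.
  have [||_ -> ->] := cat3_inj _ _ e; rewrite ?g1 ?h1 //.
  by have [||-> _ ->] := cat3_inj _ _ e'; rewrite ?g2 ?h2.
- move=> c w1 w2 _ /exchangeM_color[cg [cg' [cm [ch [ch' [hg hh hm -> ->]]]]]].
  move=> /exchangeM_color[dg [dg' [dm [dh [dh' [kg kh km e ->]]]]]] /= e'.
  have [g1 g2] := gen_color_size hg; have [h1 h2] := gen_color_size hh.
  have [g3 g4] := gen_color_size kg; have [h3 h4] := gen_color_size kh.
  have [||-> -> _] := cat3_inj _ _ e; rewrite ?g1 ?h1 //.
  by have [||-> _ ->] := cat3_inj _ _ e'; rewrite ?g2 ?h2.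
move=> c c' _; split=> -[w].
  move=> /exchangeL_color[cg [cg' [cm [ch [ch' [hg hh hm -> ->]]]]]] /= <-.
  exists [:: cg ++ cm ++ ch'; cg' ++ cm ++ ch'] => //.
  by apply/exchangeM_color; exists cg, cg', cm, ch, ch'.
move=> /exchangeM_color[cg [cg' [cm [ch [ch' [hg hh hm -> ->]]]]]] /= <-.
exists [:: cg' ++ cm ++ ch; cg' ++ cm ++ ch'] => //.
by apply/exchangeL_color; exists cg, cg', cm, ch, ch'.
Qed.
End ExchangeColor.

(** Apart from [Exchange], both sides are explicit short lists, whose colourings are solved for by
    inversion. *)
Lemma move_color s t L M : tangle_move L M -> is_diag s L t ->
  [/\ rigid (size s) L, rigid (size s) M & color_equiv (size s) L M].
Proof.
case=> [g h m _|a|a|o a b|o a b|o a|o a b|o a b c].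
- exact: exchange_color.
all: move=> /= /andP[/eqP -> _]; rewrite /ssrc ?size_cat /= ?add0n ?addn0 /=.
all: try change (1 + 2) with 3; try change (2 + 1) with 3; try rewrite /right_curl /left_curl.
all: move_color.
Qed.

Lemma coloring_length D c w : coloring D c w -> size w = size D.
Proof. by elim: D c w => [|e D IHD] c [|c' w] //= [_ /IHD ->]. Qed.

Lemma color_rel_size s D t c c' : is_diag s D t -> size c = size s -> color_rel D c c' ->
  size c' = size t.
Proof. by move=> hD hc [w hw <-]; case: (coloring_size hD hc hw). Qed.

(** A colouring over [D] is traded for one over [E] with the same ends. Rigidity of the second
    diagram fixes the rows outside and the ends of the middle part; rigidity of [D] fixes the rows
    inside. *)
Lemma rigid_context s t P Q D E : is_diag s P t -> color_equiv (size t) D E ->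
  rigid (size t) D -> rigid (size s) (P ++ E ++ Q) -> rigid (size s) (P ++ D ++ Q).
Proof.
move=> hP hDE hD hE c w1 w2 hc.
move=> /coloring_cat[p1 [_ [-> h1 /coloring_cat[l1 [q1 [-> h2 h3]]]]]].
move=> /coloring_cat[p2 [_ [-> k1 /coloring_cat[l2 [q2 [-> k2 k3]]]]]].
have [_ s1] := coloring_size hP hc h1; have [_ s2] := coloring_size hP hc k1.
have [m1 h4 h5] : color_rel E (last c p1) (last (last c p1) l1) by apply/hDE => //; exists l1.
have [m2 k4 k5] : color_rel E (last c p2) (last (last c p2) l2) by apply/hDE => //; exists l2.
have e1 : coloring (P ++ E ++ Q) c (p1 ++ m1 ++ q1).
  by apply/coloring_cat; exists p1, (m1 ++ q1); split=> //; apply/coloring_cat; exists m1, q1; rewrite h5.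
have e2 : coloring (P ++ E ++ Q) c (p2 ++ m2 ++ q2).
  by apply/coloring_cat; exists p2, (m2 ++ q2); split=> //; apply/coloring_cat; exists m2, q2; rewrite k5.
rewrite !last_cat -h5 -k5 => e.
have := hE c _ _ hc e1 e2; rewrite !last_cat => /(_ e) {}e.
have [||ep em eq] := cat3_inj _ _ e.
- by rewrite (coloring_length h1) (coloring_length k1).
- by rewrite (coloring_length h3) (coloring_length k3).
subst; congr (_ ++ _ ++ _).
by apply: (hD (last c p2)) => //; rewrite -h5 k5.
Qed.

Lemma color_equiv_context s t P Q D E : is_diag s P t -> color_equiv (size t) D E ->
  color_equiv (size s) (P ++ D ++ Q) (P ++ E ++ Q).
Proof.
move=> hP h c c' hc; split=> /color_rel_cat[c1 h1 /color_rel_cat[c2 h2 h3]];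
  have hc1 := color_rel_size hP hc h1; apply/color_rel_cat; exists c1 => //;
  by apply/color_rel_cat; exists c2 => //; apply/h.
Qed.

Lemma move_neq0 L M : tangle_move L M -> L <> [::].
Proof. by case. Qed.

Lemma isotopic_color s t D E : isotopic_at s t D E ->
  (rigid (size s) D <-> rigid (size s) E) /\ color_equiv (size s) D E.
Proof.
move=> [D' [E' [<- <- /asboolP h]]] {D E}; elim: h => {D' E'} [D E|D|D E _|D E F _ h1 _ h2].
- move=> [P [Q [l [r [L [M [LM eD eE]]]]]]].
  have hD := diagP D; rewrite eD in hD.
  have [t1 hP /is_diag_catP[t2 hL hQ]] := is_diag_catP _ _ _ _ hD.
  have [s0 [t0 [es et hL0]]] := is_diag_unwhisker (move_neq0 LM) hL.
  have [rL rM LMc] := move_color LM hL0.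
  have esz : size t1 = size l + size s0 + size r by rewrite es !size_cat addnA.
  have rL' := rigid_whisker (l := l) (r := r) rL.
  have rM' := rigid_whisker (l := l) (r := r) rM.
  have LM' := color_equiv_whisker (l := l) (r := r) LMc.
  rewrite -esz in rL' rM' LM'.
  split; last by rewrite eD eE; exact: color_equiv_context hP LM'.
  rewrite eD eE; split; first exact: rigid_context (color_equiv_sym LM') rM'.
  exact: rigid_context LM' rL'.
- by split=> // c c'.
- by move=> [h1 h2]; split; [apply: iff_sym | apply: color_equiv_sym].
- case: h1 h2 => h1 h3 [h2 h4]; split; first exact: (iff_trans h1 h2).
  by move=> c c' hc; apply: (iff_trans (h3 _ _ hc)); exact: h4.
Qed.

(** * Colourings and connected components *)

Definition point_color (w : seq (seq bool)) (p : nat * nat) := nth false (nth [::] w p.1) p.2.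

Lemma coloring_onth D c w i e : coloring D c w -> onth D i = Some e ->
  slice_color e (nth [::] (c :: w) i) (nth [::] (c :: w) i.+1).
Proof.
elim: D c w i => [|e' D IHD] c [|c' w] [|i] //= [h1 h2]; first by case=> <-.
exact: IHD.
Qed.

Lemma nth_cat3 (T : Type) (x0 : T) s1 s2 s3 i :
  [/\ i < size s1 -> nth x0 (s1 ++ s2 ++ s3) i = nth x0 s1 i,
      i < size s2 -> nth x0 (s1 ++ s2 ++ s3) (size s1 + i) = nth x0 s2 i &
      nth x0 (s1 ++ s2 ++ s3) (size s1 + size s2 + i) = nth x0 s3 i].
Proof.
split.
- by move=> h; rewrite nth_cat h.
- by move=> h; rewrite nth_cat ltnNge leq_addr addKn nth_cat h.
- by rewrite catA nth_cat size_cat ltnNge leq_addr addKn.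
Qed.

Lemma point_color_link D c w p q : coloring D c w -> link D p q ->
  point_color (c :: w) p = point_color (c :: w) q.
Proof.
move=> hw; case=> {p q}.
- move=> i l g r j /(coloring_onth hw) [cl [cg [cg' [cr [h1 _ e e' _]]]]] hj.
  rewrite /point_color [nth [::] _ i]e [nth [::] _ i.+1]e'.
  by rewrite -h1 in hj; rewrite !nth_cat hj.
- move=> i l g r j /(coloring_onth hw) [cl [cg [cg' [cr [h1 h2 e e' /gen_color_size[<- <-]]]]]] hj.
  rewrite /point_color [nth [::] _ i]e [nth [::] _ i.+1]e' -h1.
  have [_ _ ->] := nth_cat3 false cl cg cr j.
  by have [_ _ ->] := nth_cat3 false cl cg' cr j.
all: move=> i l.
- move=> o a b r /(coloring_onth hw) [cl [cg [cg' [cr [h1 h2 e e' [x [y [ex ey]]]]]]]].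
  rewrite /point_color [nth [::] _ i]e [nth [::] _ i.+1]e' -h1 ex ey.
  by rewrite !nth_cat ltnn subnn /= ltnNge leqnSn /= subSnn.
- move=> o a b r /(coloring_onth hw) [cl [cg [cg' [cr [h1 h2 e e' [x [y [ex ey]]]]]]]].
  rewrite /point_color [nth [::] _ i]e [nth [::] _ i.+1]e' -h1 ex ey.
  by rewrite !nth_cat ltnn subnn /= ltnNge leqnSn /= subSnn.
- move=> a r /(coloring_onth hw) [cl [cg [cg' [cr [h1 h2 e e' [_ [x ex]]]]]]].
  rewrite /point_color [nth [::] _ i.+1]e' -h1 ex.
  by rewrite !nth_cat ltnn subnn /= ltnNge leqnSn /= subSnn.
- move=> a r /(coloring_onth hw) [cl [cg [cg' [cr [h1 h2 e e' [_ [x ex]]]]]]].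
  rewrite /point_color [nth [::] _ i]e -h1 ex.
  by rewrite !nth_cat ltnn subnn /= ltnNge leqnSn /= subSnn.
Qed.

Lemma point_color_component D c w p q : coloring D c w -> same_component D p q ->
  point_color (c :: w) p = point_color (c :: w) q.
Proof.
move=> hw; elim=> {p q} [p q|p|p q _ ->|p q r _ -> _ ->] //.
exact: point_color_link.
Qed.

(** Makes a colouring of a function on points that is constant along links, in particular of the
    indicator of a component. The shift of [chi] renumbers the levels once the bottom slice is
    removed. *)
Fixpoint rows (chi : nat * nat -> bool) (D : seq slice) : seq (seq bool) :=
  if D is e :: D' then
    mkseq (fun j => chi (1, j)) (size (stgt e)) :: rows (fun p => chi (p.1.+1, p.2)) D'
  else [::].
Definition bottom (chi : nat * nat -> bool) (s : word) := mkseq (fun j => chi (0, j)) (size s).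

Lemma map_iota (T : Type) (f : nat -> T) i j : map f (iota i j) = mkseq (fun n => f (i + n)) j.
Proof. by rewrite -{1}[i]addn0 iotaDl -map_comp. Qed.

Lemma mkseq_cat3 (T : Type) (f : nat -> T) i j k : mkseq f (i + (j + k)) =
  mkseq f i ++ mkseq (fun n => f (i + n)) j ++ mkseq (fun n => f (i + j + n)) k.
Proof. by rewrite {1}/mkseq iotaD map_cat iotaD map_cat !map_iota !add0n. Qed.

Lemma link_cons e D i j i' j' : link D (i, j) (i', j') -> link (e :: D) (i.+1, j) (i'.+1, j').
Proof.
suff gen p q : link D p q -> link (e :: D) (p.1.+1, p.2) (q.1.+1, q.2) by move/gen.
case=> /= {p q i j i' j'}.
- by move=> i l g r j h hj; exact: (@LinkLeft (e :: D) i.+1 l g r).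
- by move=> i l g r j h hj; exact: (@LinkRight (e :: D) i.+1 l g r).
- by move=> i l o a b r h; exact: (@LinkCrossLR (e :: D) i.+1 l o a b r).
- by move=> i l o a b r h; exact: (@LinkCrossRL (e :: D) i.+1 l o a b r).
- by move=> i l a r h; exact: (@LinkCup (e :: D) i.+1 l a r).
- by move=> i l a r h; exact: (@LinkCap (e :: D) i.+1 l a r).
Qed.

Lemma rows_coloring chi s D t : is_diag s D t -> (forall p q, link D p q -> chi p = chi q) ->
  coloring D (bottom chi s) (rows chi D).
Proof.
elim: D s chi => [|e D IHD] s chi //= /andP[/eqP -> hD] h; split; last first.
  have := IHD (stgt e) (fun p => chi (p.1.+1, p.2)) hD; apply.
  by move=> [i j] [i' j'] /(link_cons e) /h.
case: e h {hD} => [[l g] r] h.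
have hl j : j < size l -> chi (0, j) = chi (1, j).
  by move=> hj; apply: h; exact: (@LinkLeft _ 0 l g r).
have hr j : j < size r -> chi (0, size l + size (gsrc g) + j) = chi (1, size l + size (gtgt g) + j).
  by move=> hj; apply: h; exact: (@LinkRight _ 0 l g r).
rewrite /bottom /ssrc /stgt /= !size_cat !mkseq_cat3.
have -> : mkseq (fun j => chi (0, j)) (size l) = mkseq (fun j => chi (1, j)) (size l).
  by apply/eq_in_map => j; rewrite mem_iota add0n => /= /hl.
have -> : mkseq (fun j => chi (0, size l + size (gsrc g) + j)) (size r) =
  mkseq (fun j => chi (1, size l + size (gtgt g) + j)) (size r).
  by apply/eq_in_map => j; rewrite mem_iota add0n => /= /hr.
exists (mkseq (fun j => chi (1, j)) (size l)),
  (mkseq (fun j => chi (0, size l + j)) (size (gsrc g))),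
  (mkseq (fun j => chi (1, size l + j)) (size (gtgt g))),
  (mkseq (fun j => chi (1, size l + size (gtgt g) + j)) (size r)).
split=> //; rewrite ?size_mkseq // {hl hr}.
case: g h => [o a b|a|a] h /=; rewrite /mkseq /= ?addn0 ?addn1.
- exists (chi (0, size l)), (chi (0, (size l).+1)); split=> //.
  by congr [:: _; _]; symmetry; apply: h; [exact: (@LinkCrossRL _ 0 l o a b r)|
     exact: (@LinkCrossLR _ 0 l o a b r)].
- split=> //; exists (chi (1, size l)); congr [:: _; _].
  by symmetry; apply: h; exact: (@LinkCup _ 0 l a r).
- split=> //; exists (chi (0, size l)); congr [:: _; _].
  by symmetry; apply: h; exact: (@LinkCap _ 0 l a r).
Qed.

Lemma rows_point chi s D i j : i <= size D -> j < size (nth [::] (levels s D) i) ->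
  point_color (bottom chi s :: rows chi D) (i, j) = chi (i, j).
Proof.
rewrite /point_color /levels.
elim: D s chi i => [|e D IHD] s chi [|i] //=; try by move=> _ hj; rewrite nth_mkseq.
by move=> hi hj; rewrite (IHD (stgt e) (fun p => chi (p.1.+1, p.2))).
Qed.

Lemma coloring_levels s D t c w i : is_diag s D t -> size c = size s -> coloring D c w ->
  i <= size D -> size (nth [::] (c :: w) i) = size (nth [::] (levels s D) i).
Proof.
elim: D s c w i => [|e D IHD] s c [|c' w] [|i] //= /andP[/eqP -> hD] hc [he hw] hi.
apply: (IHD (stgt e)) => //.
case: he => [cl [cg [cg' [cr [h1 h2 _ -> /gen_color_size [_ h4]]]]]].
by rewrite /stgt !size_cat h1 h2 h4.
Qed.

Lemma size_bottom chi s : size (bottom chi s) = size s.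
Proof. exact: size_mkseq. Qed.

Definition component (D : seq slice) p0 p := `[< same_component D p0 p >].

Lemma component_link D p0 p q : link D p q -> component D p0 p = component D p0 q.
Proof.
move=> h; apply/asboolP/asboolP => h'.
  by apply: rst_trans h' (rst_step _ _ _ _ h).
by apply: rst_trans h' (rst_sym _ _ _ _ (rst_step _ _ _ _ h)).
Qed.

(** Every point is joined to the boundary, where the two colourings agree. *)
Lemma no_closed_component_rigid s t (D : diag s t) : no_closed_component D -> rigid (size s) D.
Proof.
move=> h c w1 w2 hc h1 h2 e.
have hD := diagP D.
suff : c :: w1 = c :: w2 by case.
apply: (@eq_from_nth _ [::]) => [|i].
  by rewrite /= (coloring_length h1) (coloring_length h2).
rewrite [size _]/= ltnS (coloring_length h1) => hi.
have s1 := coloring_levels hD hc h1 hi; have s2 := coloring_levels hD hc h2 hi.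
apply: (@eq_from_nth _ false) => [|j]; first by rewrite s1 s2.
rewrite s1 => hj; have [i' [j' [hij /[dup] k1 k2]]] := h i j hi hj.
rewrite -[LHS]/(point_color (c :: w1) (i, j)) -[RHS]/(point_color (c :: w2) (i, j)).
rewrite (point_color_component h1 k1) (point_color_component h2 k2).
case: hij => [-> //|->]; rewrite /point_color.
have last_nth w : coloring D c w -> nth [::] (c :: w) (size D) = last c w.
  by move=> /coloring_length <-; rewrite nth_last.
by rewrite !last_nth // e.
Qed.

(** The indicator of a component that misses the boundary has the same boundary values as the zero
    colouring. *)
Lemma rigid_no_closed_component s t (D : diag s t) : rigid (size s) D -> no_closed_component D.
Proof.
move=> hr i j hi hj; apply: contrapT => hn.
pose chi := component D (i, j).
have hD := diagP D.
have hb i' j' : (i' = 0 \/ i' = size D) -> chi (i', j') = false.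
  by move=> hi'; apply/asboolP => hc; apply: hn; exists i', j'.
have h1 : coloring D (bottom chi s) (rows chi D).
  exact: rows_coloring hD (@component_link D (i, j)).
have h0 := rows_coloring (chi := fun _ => false) hD (fun _ _ _ => erefl).
have eb : bottom chi s = bottom (fun _ => false) s.
  by apply: eq_map => j' /=; apply: hb; left.
have last_row f w : coloring D (bottom f s) w ->
   last (bottom f s) w = nth [::] (bottom f s :: w) (size D).
  by move=> /coloring_length <-; rewrite nth_last.
have e : last (bottom chi s) (rows chi D) = last (bottom chi s) (rows (fun _ => false) D).
  rewrite last_row // eb last_row //.
  have l1 := coloring_levels hD (size_bottom _ _) h1 (leqnn _).
  have l0 := coloring_levels hD (size_bottom _ _) h0 (leqnn _).
  rewrite eb in l1.
  apply: (@eq_from_nth _ false) => [|j']; first by rewrite l1 l0.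
  rewrite l1 => hj'.
  have := rows_point chi (leqnn _) hj'; rewrite /point_color /= eb => ->.
  have := rows_point (fun _ => false) (leqnn _) hj'; rewrite /point_color /= => ->.
  by apply: hb; right.
rewrite -eb in h0.
have := hr _ _ _ (size_bottom _ _) h1 h0 e => er.
have := rows_point chi hi hj; rewrite er eb rows_point // => /esym/negbT/negP; apply.
exact/asboolP/rst_refl.
Qed.

(** For the converse, the test colouring is the indicator of the component of the bottom point
    [i]. *)
Lemma strand_color s t (D : diag s t) i j : i < size s -> j < size t ->
  strand D i j <-> (forall c c', size c = size s -> color_rel D c c' -> nth false c i = nth false c' j).
Proof.
move=> hi hj; have hD := diagP D.
have last_nth c w : coloring D c w -> nth [::] (c :: w) (size D) = last c w.
  by move=> /coloring_length <-; rewrite nth_last.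
split=> [h c c' hc [w hw <-]|h].
  by have := point_color_component hw h; rewrite /point_color last_nth.
have h1 : coloring D (bottom (component D (0, i)) s) (rows (component D (0, i)) D).
  exact: rows_coloring hD (@component_link D (0, i)).
have := h _ _ (size_bottom _ _) (ex_intro2 _ _ _ h1 erefl).
have [_ sl] := coloring_size hD (size_bottom _ _) h1.
rewrite nth_mkseq // -last_nth // => e.
have := @rows_point (component D (0, i)) s D (size D) j (leqnn _).
rewrite -(coloring_levels hD (size_bottom _ _) h1 (leqnn _)) last_nth // sl => /(_ hj).
rewrite /point_color /= last_nth // -last_nth // -e => /esym.
have -> : component D (0, i) (0, i) = true by apply/asboolP/rst_refl.
by move=> /asboolP.
Qed.

(** * Addition of colourings *)

Definition xor_seq (s t : seq bool) := [seq p.1 (+) p.2 | p <- zip s t].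

Lemma xor_seq_cat s1 s2 t1 t2 : size s1 = size t1 ->
  xor_seq (s1 ++ s2) (t1 ++ t2) = xor_seq s1 t1 ++ xor_seq s2 t2.
Proof. by move=> h; rewrite /xor_seq zip_cat // map_cat. Qed.

Lemma size_xor_seq s t : size s = size t -> size (xor_seq s t) = size s.
Proof. by move=> h; rewrite size_map size1_zip // h. Qed.

Lemma xor_seqK s t : size s = size t -> xor_seq s t = nseq (size s) false -> s = t.
Proof.
elim: s t => [|x s IHs] [|y t] //= [h] [e] /(IHs _ h) ->.
by congr (_ :: _); move: x y e => [] [].
Qed.

Lemma xor_seq_self s : xor_seq s s = nseq (size s) false.
Proof. by elim: s => //= x s; rewrite /xor_seq /= addbb => ->. Qed.

Lemma slice_color_xor e c1 c1' c2 c2' : size c1 = size c2 -> slice_color e c1 c1' -> slice_color e c2 c2' ->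
  slice_color e (xor_seq c1 c2) (xor_seq c1' c2') /\ size c1' = size c2'.
Proof.
move=> hc [cl [cg [cg' [cr [h1 h2 e1 e1' hg]]]]] [dl [dg [dg' [dr [k1 k2 e2 e2' kg]]]]].
have [g1 g2] := gen_color_size hg; have [g3 g4] := gen_color_size kg.
have sl : size cl = size dl by rewrite h1.
have sg : size cg = size dg by rewrite g1.
have sg' : size cg' = size dg' by rewrite g2.
have sr : size cr = size dr by rewrite h2.
split; last by rewrite e1' e2' !size_cat sl sg' sr.
exists (xor_seq cl dl), (xor_seq cg dg), (xor_seq cg' dg'), (xor_seq cr dr).
rewrite !size_xor_seq // e1 e1' e2 e2' !xor_seq_cat //; split=> //.
case: (e.1.2) hg kg => [o a b [x [y [-> ->]]] [x' [y' [-> ->]]]|a|a].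
- by exists (x (+) x'), (y (+) y').
- by move=> [-> [x ->]] [-> [y ->]]; split=> //; exists (x (+) y).
- by move=> [-> [x ->]] [-> [y ->]]; split=> //; exists (x (+) y).
Qed.

Fixpoint xor_rows (w1 w2 : seq (seq bool)) :=
  if w1 is c1 :: w1' then if w2 is c2 :: w2' then xor_seq c1 c2 :: xor_rows w1' w2' else [::]
  else [::].

Lemma coloring_xor D c1 w1 c2 w2 : size c1 = size c2 -> coloring D c1 w1 -> coloring D c2 w2 ->
  coloring D (xor_seq c1 c2) (xor_rows w1 w2) /\
  last (xor_seq c1 c2) (xor_rows w1 w2) = xor_seq (last c1 w1) (last c2 w2).
Proof.
elim: D c1 c2 w1 w2 => [|e D IHD] c1 c2 [|d1 w1] [|d2 w2] //= hc [h1 h2] [k1 k2].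
have [h hs] := slice_color_xor hc h1 k1.
by have [h' ->] := IHD _ _ _ _ hs h2 k2.
Qed.


Lemma coloring0 s D t : is_diag s D t -> exists2 w, coloring D (nseq (size s) false) w &
  last (nseq (size s) false) w = nseq (size t) false.
Proof.
elim: D s => [|e D IHD] s; first by move=> /eqP ->; exists [::].
move=> /andP[/eqP -> /IHD [w h1 h2]]; exists (nseq (size (stgt e)) false :: w) => //.
split=> //; exists (nseq (size e.1.1) false), (nseq (size (gsrc e.1.2)) false),
 (nseq (size (gtgt e.1.2)) false), (nseq (size e.2) false).
rewrite !size_nseq /ssrc /stgt !size_cat !nseqD; split=> //.
by case: (e.1.2) => [o a b|a|a] /=; [exists false, false | split=> //; exists false | split=> //; exists false].
Qed.

Lemma xor_rows_inj D c1 c2 w1 w2 : size c1 = size c2 -> coloring D c1 w1 -> coloring D c2 w2 ->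
  xor_rows w1 w1 = xor_rows w1 w2 -> w1 = w2.
Proof.
elim: D c1 c2 w1 w2 => [|e D IHD] c1 c2 [|d1 w1] [|d2 w2] //= hc [h1 h1'] [h2 h2'] [e1 e2].
have [_ sd] := slice_color_xor hc h1 h2.
rewrite (IHD _ _ _ _ sd h1' h2' e2); congr (_ :: _).
by apply: xor_seqK sd _; rewrite -e1 xor_seq_self.
Qed.

(* The xor of two colourings of P with the same boundary extends by zero over Q. *)
Lemma rigid_prefix s P Q t r : is_diag s P t -> is_diag t Q r ->
  rigid (size s) (P ++ Q) -> rigid (size s) P.
Proof.
move=> hP hQ h c w1 w2 hc h1 h2 e; apply: (xor_rows_inj erefl h1 h2).
have [k1 l1] := coloring_xor erefl h1 h1; have [k2 l2] := coloring_xor erefl h1 h2.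
have [_ s1] := coloring_size hP hc h1.
have [w0 h0 _] := coloring0 hQ.
rewrite -e (xor_seq_self (last c w1)) s1 in l2; rewrite (xor_seq_self (last c w1)) s1 in l1.
have e1 : coloring (P ++ Q) (xor_seq c c) (xor_rows w1 w1 ++ w0).
  by apply/coloring_cat; exists (xor_rows w1 w1), w0; rewrite l1.
have e2 : coloring (P ++ Q) (xor_seq c c) (xor_rows w1 w2 ++ w0).
  by apply/coloring_cat; exists (xor_rows w1 w2), w0; rewrite l2.
have := h _ _ _ _ e1 e2; rewrite size_xor_seq // !last_cat l1 l2 => /(_ hc erefl).
by have /(@cat_inj_size _ _ w0 _ w0) : size (xor_rows w1 w1) = size (xor_rows w1 w2);
  [rewrite (coloring_length k1) (coloring_length k2) | move=> /[apply] -[]].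
Qed.

(** * Colourings of the comb *)

Definition cup_free (D : seq slice) := all (fun e : slice => if e.1.2 is Cup _ then false else true) D.

Lemma cup_free_whisker l r D : cup_free (whisker l r D) = cup_free D.
Proof. by rewrite /cup_free all_map; apply: eq_all => -[[? []] ?]. Qed.

Lemma cup_free_cross_word o a t : cup_free (cross_word o a t).
Proof. by elim: t => //= b t IHt; rewrite cup_free_whisker. Qed.

Lemma cup_free_comb v : cup_free (comb v).
Proof.
elim: v => [|[] v IHv] //=.
by rewrite /cup_free all_cat -!/(cup_free _) !cup_free_whisker cup_free_cross_word.
Qed.

(** Read from bottom to top, only a cup leaves a choice of colour. *)
Lemma coloring_cup_free D c w1 w2 : cup_free D -> coloring D c w1 -> coloring D c w2 -> w1 = w2.
Proof.
elim: D c w1 w2 => [|e D IHD] c [|d1 w1] [|d2 w2] //= /andP[he hD] [h1 h1'] [h2 h2'].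
suff e12 : d1 = d2 by rewrite -e12 in h2' *; rewrite (IHD _ _ _ hD h1' h2').
case: h1 h2 => [cl [cg [cg' [cr [s1 s2 -> -> hg]]]]] [dl [dg [dg' [dr [t1 t2 e1 -> kg]]]]].
have [] := cat3_inj _ _ e1; rewrite ?s1 ?s2 // => -> e2 ->; congr (_ ++ _ ++ _).
case: (e.1.2) he hg kg => // [o a b|a] _.
  by move=> [x [y [h ->]]] [x' [y' [h' ->]]]; move: e2; rewrite h h' => -[-> ->].
by move=> [-> _] [-> _].
Qed.

Lemma color_rel_cross_word o a t x d c : size d = size t ->
  color_rel (cross_word o a t) (x :: d) c -> c = d ++ [:: x].
Proof.
elim: t d c => [|b t IHt] [|y d] c //=; first by move=> _ [[|//] _ <-].
move=> [hd] [[|c1 w] //= [h1 h2] e].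
have ec1 : c1 = [:: y] ++ (x :: d) ++ [::].
  case: h1 => [cl [cg [cg' [cr [/size0nil-> hs e1 -> [x' [y' [e2 ->]]]]]]]].
  by move: e1; rewrite e2 /= => -[-> -> ->]; rewrite cats0.
have : color_rel (whisker [:: b] [::] (cross_word o a t)) ([:: y] ++ (x :: d) ++ [::]) c.
  by exists w; rewrite -?ec1.
move=> /(@color_rel_whisker _ [::] _ [:: y])-/(_ erefl erefl)[c0 -> /(IHt _ _ hd) ->].
by rewrite cats0.
Qed.

(** Each strand entering from [rev v] ends at the top, coloured by [e], or is bent to one of the
    inputs on the right, coloured by [d]. *)
Lemma comb_color v c c' d e : size c = size v -> size c' = size v -> size d = nneg v ->
  color_rel (comb v) (c ++ d) e -> color_rel (comb v) (c' ++ d) e -> c = c'.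
Proof.
elim: v c c' d e => [|a v IHv] c c' d e; first by move=> /size0nil -> /size0nil ->.
case: (lastP c) => [//|{}c x]; case: (lastP c') => [//|{}c' x'].
rewrite !size_rcons => -[hc] [hc']; case: a.
  rewrite nnegT => hd; rewrite combT !cat_rcons.
  have key y z : size z = size v -> color_rel (whisker (rev v) [::] (cross_word true true (plus (nneg v)))
      ++ whisker [::] [:: true] (comb v)) (z ++ y :: d) e ->
      exists2 e0, e = e0 ++ [:: y] & color_rel (comb v) (z ++ d) e0.
    move=> hz; have -> : z ++ y :: d = z ++ (y :: d) ++ [::] by rewrite cats0.
    have hz' : size z = size (rev v) by rewrite size_rev.
    move=> /color_rel_cat[c1 /color_rel_whisker-/(_ hz' erefl)[c2 ->]].
    move=> /color_rel_cross_word; rewrite size_nseq => /(_ hd) ->.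
    have -> : z ++ (d ++ [:: y]) ++ [::] = [::] ++ (z ++ d) ++ [:: y] by rewrite cats0 catA.
    by move=> /color_rel_whisker []// e0 -> h0; exists e0.
  move=> /(key _ _ hc)[e0 ee h1] /(key _ _ hc')[e1].
  rewrite ee !cats1 => /rcons_inj[<- <-] h2.
  by rewrite (IHv _ _ _ _ hc hc' hd h1 h2).
rewrite nnegF; case: d => [//|y d] [hd] /=.
rewrite !cat_rcons.
have key z z' : size z = size v -> color_rel ((rev v, Cap false, plus (nneg v)) :: comb v) (z ++ [:: z', y & d]) e ->
    z' = y /\ color_rel (comb v) (z ++ d) e.
  move=> hz [[|c1 w] //= [[cl [cg [cg' [cr [h1 h2 e1 -> [-> [u eu]]]]]]] hw] ew].
  rewrite /= size_rev in h1; rewrite /= size_nseq in h2.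
  rewrite eu -[[:: z', y & d]]/([:: z'; y] ++ d) in e1.
  have [||-> [-> ->] ->] := cat3_inj _ _ e1; rewrite ?h1 ?h2 //.
  by split=> //; exists w.
move=> /(key _ _ hc)[-> h1] /(key _ _ hc')[-> h2].
by rewrite (IHv _ _ _ _ hc hc' hd h1 h2).
Qed.

(** Bending closes no component: the boundary determines the top row of [P] by [comb_color], then
    the rows of [P] by rigidity, and those of the comb because it has no cups. *)
Lemma comb_rigid s P v : is_diag s P (rev v) -> rigid (size s) P ->
  rigid (size s + nneg v) (whisker [::] (plus (nneg v)) P ++ comb v).
Proof.
move=> hP hr c w1 w2 hc.
have [|c1 [c0 [d [-> /size0nil-> h2 h3]]]] := @size_split3 c 0 (size s) (nneg v); first by rewrite hc.
move=> /coloring_cat[p1 [k1 [-> + +]]] /coloring_cat[p2 [k2 [-> + +]]].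
have hd : size d = size (plus (nneg v)) by rewrite size_nseq.
move=> /coloring_whisker-/(_ erefl hd)[q1 -> hq1] h1 /coloring_whisker-/(_ erefl hd)[q2 -> hq2] h1'.
rewrite !last_cat; rewrite !last_map_whisker /= in h1 h1' *.
move=> e.
have [_ s1] := coloring_size hP h2 hq1; have [_ s2] := coloring_size hP h2 hq2.
rewrite size_rev in s1 s2.
have e' : last c0 q1 = last c0 q2.
  by apply: (comb_color (d := d) s1 s2 h3); [exists k1 | exists k2].
rewrite (hr c0 q1 q2) // in h1 *.
by rewrite (coloring_cup_free (cup_free_comb v) h1 h1').
Qed.

(** * Permutations induced by upwards diagrams *)

Definition perm_fun (n : nat) (f : nat -> nat) : Prop :=
  (forall i, i < n -> f i < n) /\ (forall i j, i < n -> j < n -> f i = f j -> i = j).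

Lemma perm_fun_perm n f : perm_fun n f -> exists p : 'S_n, forall i, p i = f i :> nat.
Proof.
move=> [h1 h2]; pose g (i : 'I_n) := Ordinal (h1 i (ltn_ord i)).
have gi : injective g by move=> i j [/h2 e]; apply: val_inj; apply: e.
by exists (perm gi) => i; rewrite permE.
Qed.

Lemma perm_fun_onto n f j : perm_fun n f -> j < n -> exists2 i, i < n & f i = j.
Proof.
move=> /perm_fun_perm[p hp] hj; exists (p^-1%g (Ordinal hj)) => //.
by rewrite -hp permKV.
Qed.

(* D has no closed component and its strands induce the permutation f. *)
Definition realizes n D f := [/\ rigid n D, perm_fun n f &
  forall c c', size c = n -> size c' = n ->
    (color_rel D c c' <-> forall i, i < n -> nth false c' (f i) = nth false c i)].

Lemma realizes_inj n D f c c1 c2 : realizes n D f -> size c = n -> size c1 = n -> size c2 = n ->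
  color_rel D c c1 -> color_rel D c c2 -> c1 = c2.
Proof.
move=> [_ hf h] hc h1 h2 /h-/(_ hc h1) e1 /h-/(_ hc h2) e2.
apply: (@eq_from_nth _ false) => [|j]; first by rewrite h1 h2.
by rewrite h1 => /(perm_fun_onto hf) [i hi <-]; rewrite e1 ?e2.
Qed.

Lemma realizes_nil n : realizes n [::] id.
Proof.
split=> [c [|? ?] [|? ?] //|//|c c' hc hc'].
split=> [[[|//] _ <-]//|h]; exists [::] => //=.
by apply: (@eq_from_nth _ false) => [|i]; rewrite ?hc' ?hc // => hi; rewrite h.
Qed.

Lemma realizes_cat s D E f g : is_diag s D s -> realizes (size s) D f -> realizes (size s) E g ->
  realizes (size s) (D ++ E) (g \o f).
Proof.
move=> hD rD rE; have [h1 hf h2] := rD; have [k1 hg k2] := rE; split.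
- move=> c w1 w2 hc /coloring_cat[p1 [q1 [-> a1 b1]]] /coloring_cat[p2 [q2 [-> a2 b2]]].
  rewrite !last_cat => e; have [_ s1] := coloring_size hD hc a1; have [_ s2] := coloring_size hD hc a2.
  have e12 : last c p1 = last c p2.
    by apply: (realizes_inj rD hc) => //; [exists p1 | exists p2].
  rewrite (h1 c p1 p2) // in b1 e *.
  by rewrite (k1 _ _ _ s2 b1 b2 e).
- split=> [i hi|i j hi hj] /=; first by apply: hg.1; apply: hf.1.
  by move=> /hg.2 e; apply: hf.2 => //; apply: e; apply: hf.1.
move=> c c' hc hc'; split.
  move=> /color_rel_cat[c1 a1 b1]; have s1 := color_rel_size hD hc a1.
  move: a1 b1 => /h2-/(_ hc s1) a1 /k2-/(_ s1 hc') b1 i hi.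
  by rewrite /= b1 ?a1 //; apply: hf.1.
(* The middle row is forced: its entry [j] has the colour of the end point [g j] in the top row. *)
move=> h; apply/color_rel_cat; exists (mkseq (fun j => nth false c' (g j)) (size s)).
  apply/h2; rewrite ?size_mkseq // => i hi.
  by rewrite nth_mkseq; [rewrite -h | apply: hf.1].
by apply/k2; rewrite ?size_mkseq // => i hi; rewrite nth_mkseq.
Qed.

Lemma realizes_whisker a b n D f : is_diag (plus n) D (plus n) -> realizes n D f ->
  exists f', realizes (a + n + b) (whisker (plus a) (plus b) D) f'.
Proof.
move=> hD [h1 hf h2].
exists (fun i => if a <= i < a + n then a + f (i - a) else i); split.
- by have := @rigid_whisker (plus a) (plus b) n D h1; rewrite !size_nseq.
- split=> [i hi|i j hi hj].
    case: ifP => // /andP[hi1 hi2]; apply: leq_trans (leq_addr b (a + n)).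
    by rewrite ltn_add2l; apply: hf.1; rewrite ltn_subLR.
  have lt k : a <= k < a + n -> f (k - a) < n.
    by move=> /andP[k1 k2]; apply: hf.1; rewrite ltn_subLR.
  case: ifP => hi'; case: ifP => hj'.
  + move=> /addnI /hf.2 e; move: hi' hj' => /andP[i1 i2] /andP[j1 j2].
    by rewrite -(subnKC i1) e ?subnKC // ltn_subLR.
  + by move=> e; move: hj'; rewrite -e leq_addr ltn_add2l (lt _ hi').
  + by move=> e; move: hi'; rewrite e leq_addr ltn_add2l (lt _ hj').
  + by [].
move=> c c' /size_split3[cl [c0 [cr [-> e1 e2 e3]]]] /size_split3[dl [d0 [dr [-> k1 k2 k3]]]].
have hl : size cl = size (plus a) by rewrite size_nseq.
have hr : size cr = size (plus b) by rewrite size_nseq.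
have nth3 s1 s2 s3 i : size s1 = a -> size s2 = n -> 
    nth false (s1 ++ s2 ++ s3) i = if a <= i < a + n then nth false s2 (i - a)
       else if i < a then nth false s1 i else nth false s3 (i - (a + n)).
  move=> l1 l2; rewrite !nth_cat l1 l2.
  by case: (ltnP i a) => //= hi; rewrite ltn_subLR // subnDA.
split.
  move=> /color_rel_whisker-/(_ hl hr)[d e].
  have [||-> <- ->] := cat3_inj _ _ e; rewrite ?k1 ?k3 //.
  move=> /h2-/(_ e2 k2) h i hi.
  rewrite [RHS]nth3 //; case: ifP => hi'; last first.
    by rewrite nth3 // hi'.
  rewrite nth3 // leq_addr ltn_add2l addKn; have : i - a < n.
    by case/andP: hi' => ? ?; rewrite ltn_subLR.
  by move=> /[dup] /hf.1 -> /h.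
move=> h.
have edl : dl = cl.
  apply: (@eq_from_nth _ false) => [|i]; rewrite k1 ?e1 // => hi.
  have hi' : i < a + n + b by apply: (leq_trans hi); rewrite -addnA leq_addr.
  have := h i hi'; rewrite leqNgt hi /= !nth3 //.
  by rewrite leqNgt hi.
have edr : dr = cr.
  apply: (@eq_from_nth _ false) => [|i]; rewrite k3 ?e3 // => hi.
  have hi' : a + n + i < a + n + b by rewrite ltn_add2l.
  have f1 : (a <= a + n + i < a + n) = false by rewrite [_ < _]ltnNge leq_addr andbF.
  have f2 : (a + n + i < a) = false by rewrite ltnNge -addnA leq_addr.
  by have := h _ hi'; rewrite f1 !nth3 // f1 f2 addKn.
apply/color_rel_whisker => //; exists d0; first by rewrite edl edr.
apply/h2 => // i hi; have hi' : a + i < a + n + b.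
  by rewrite -addnA ltn_add2l (leq_trans hi) // leq_addr.
have := h _ hi'; rewrite leq_addr ltn_add2l hi /= addKn !nth3 //.
by rewrite !leq_addr !ltn_add2l hf.1 // hi !addKn.
Qed.

Lemma realizes_cross o : realizes 2 [:: ([::], Cross o true true, [::])] (fun i => 1 - i).
Proof.
split.
- by move=> c w1 w2 hc h1 h2 _; exact: coloring_cup_free h1 h2.
- by split=> [[|[|]]|[|[|]] [|[|]]].
move=> [|x [|y []]] // [|x' [|y' []]] // _ _; split.
  move=> [[//|c1 [|? ?]] /= [] //].
  move=> [cl [cg [cg' [cr [/size0nil-> /size0nil-> e1 -> [u [v [e2 ->]]]]]]]] _.
  by move: e1; rewrite e2 => -[-> ->] [<- <-] [|[|]].
move=> h; have /= := h 0 isT; have /= := h 1 isT; rewrite /subn /= => -> ->.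
exists [:: [:: y; x]] => //; split=> //; exists [::], [:: x; y], [:: y; x], [::].
by split=> //; exists x, y.
Qed.

(** The instance of [closing] at the word [[:: true]], with its whiskers normalised. *)
Definition loop (n : nat) (E : seq slice) : seq slice :=
  (plus n, Cup true, [::]) :: whisker [::] [:: false] E ++ [:: (plus n, Cap true, [::])].

Lemma loop_coloring n E c w : is_diag (plus n.+1) E (plus n.+1) -> size c = n ->
  coloring (loop n E) c w <-> exists x w0 c', [/\
    w = (c ++ [:: x; x]) :: [seq y ++ [:: x] | y <- w0] ++ [:: c'],
    coloring E (c ++ [:: x]) w0 & last (c ++ [:: x]) w0 = c' ++ [:: x]].
Proof.
move=> hE hc.
have sx x : size (c ++ [:: x]) = size (plus n.+1) by rewrite size_nseq size_cat hc addn1.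
split.
  case: w => // c1 w /= [[cl [cg [cg' [cr [h1 h2 e1 -> [ecg [x ->]]]]]]]].
  move: e1 h2; rewrite ecg /= => e1 /size0nil ecr; rewrite ecr cats0 in e1.
  rewrite {}ecr {ecg cg cg' cr} -{cl h1}e1 /=.
  move=> /coloring_cat[w1 [w2 [-> + hw2]]].
  have ecx : c ++ [:: x; x] = [::] ++ (c ++ [:: x]) ++ [:: x] by rewrite -catA.
  rewrite ecx in hw2 *; move=> /coloring_whisker[] // w0 e0 hw0; rewrite e0 in hw2 *.
  move: hw2; rewrite last_map_whisker.
  case: w2 => [//|c' [[h _]|? ? [_ []]]].
  case: h => [cl [cg [cg' [cr [h1 /size0nil -> e1 -> [-> [y ey]]]]]]].
  rewrite ey /= ?cats0 in e1 *.
  have [e2 exy] : last (c ++ [:: x]) w0 = cl ++ [:: y] /\ x = y.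
    by move: e1; rewrite -[[:: y; y]]/([:: y] ++ [:: y]) catA !cats1 => /rcons_inj[-> ->].
  by exists x, w0, cl; split; rewrite -?catA // e2 exy.
move=> [x [w0 [c' [-> h e]]]]; split.
  by exists c, [::], [:: x; x], [::]; rewrite size_nseq !cats0; split=> //; split=> //; exists x.
apply/coloring_cat; exists [seq [::] ++ y ++ [:: x] | y <- w0], [:: c']; split=> //.
  have -> : c ++ [:: x; x] = [::] ++ (c ++ [:: x]) ++ [:: x] by rewrite -catA.
  by apply/coloring_whisker => //; exists w0.
have -> : c ++ [:: x; x] = [::] ++ (c ++ [:: x]) ++ [:: x] by rewrite -catA.
rewrite last_map_whisker e; split=> //; exists c', [:: x; x], [::], [::].
rewrite /= !cats0 -catA size_nseq; split=> //; last by split=> //; exists x.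
by have [_] := coloring_size hE (sx x) h; rewrite e size_nseq size_cat addn1 => -[].
Qed.

Lemma loop_color_rel n E c c' : is_diag (plus n.+1) E (plus n.+1) -> size c = n ->
  color_rel (loop n E) c c' <-> exists x, color_rel E (c ++ [:: x]) (c' ++ [:: x]).
Proof.
move=> hE hc; split.
  move=> [w /(loop_coloring _ hE hc)[x [w0 [c1 [-> h e]]]]].
  by rewrite /= last_cat /= => <-; exists x, w0.
move=> [x [w0 h e]]; exists ((c ++ [:: x; x]) :: [seq y ++ [:: x] | y <- w0] ++ [:: c']).
  by apply/loop_coloring => //; exists x, w0, c'.
by rewrite /= last_cat.
Qed.

Lemma nth_rcons1 n c (x : bool) i : size c = n -> i < n.+1 ->
  nth false (c ++ [:: x]) i = if i == n then x else nth false c i.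
Proof.
move=> <-; rewrite ltnS leq_eqVlt cats1 nth_rcons.
by case: eqP => [->|_ /= ->]; rewrite ?ltnn.
Qed.

(* If f fixed n, both colours of the closed strand would extend the zero boundary. *)
Lemma loop_not_fixed n E f : is_diag (plus n.+1) E (plus n.+1) -> realizes n.+1 E f ->
  rigid n (loop n E) -> f n <> n.
Proof.
move=> hE [hr [h1 h2] h] hl fn.
have ec x : color_rel E (nseq n false ++ [:: x]) (nseq n false ++ [:: x]).
  apply/h; rewrite ?size_cat ?size_nseq ?addn1 // => i hi.
  rewrite !(@nth_rcons1 n) ?size_nseq ?h1 //.
  have -> : (f i == n) = (i == n).
    by apply/eqP/eqP => [e|->//]; apply: h2; rewrite // fn.
  case: ifP => // /negbT hin; have hi' : i < n by rewrite ltn_neqAle hin -ltnS.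
  rewrite !nth_nseq; case: ifP; case: ifP => //.
have [w1 k1 e1] := ec true; have [w2 k2 e2] := ec false.
have sn : size (nseq n false) = n by rewrite size_nseq.
have m1 : coloring (loop n E) (nseq n false)
   ((nseq n false ++ [:: true; true]) :: [seq y ++ [:: true] | y <- w1] ++ [:: nseq n false]).
  by apply/loop_coloring => //; exists true, w1, (nseq n false).
have m2 : coloring (loop n E) (nseq n false)
   ((nseq n false ++ [:: false; false]) :: [seq y ++ [:: false] | y <- w2] ++ [:: nseq n false]).
  by apply/loop_coloring => //; exists false, w2, (nseq n false).
have := hl _ _ _ sn m1 m2; rewrite /= !last_cat /= => /(_ erefl) [].
by move=> /catsI.
Qed.

Lemma realizes_loop n E f : is_diag (plus n.+1) E (plus n.+1) -> realizes n.+1 E f ->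
  rigid n (loop n E) -> exists f', realizes n (loop n E) f'.
Proof.
move=> hE hR hl; have fn := loop_not_fixed hE hR hl; have [hr [h1 h2] h] := hR.
have fnn : f n < n.
  by have := h1 n (ltnSn n); rewrite ltnS leq_eqVlt => /orP[/eqP|].
have fi i : i < n -> (f i == n) = false -> f i < n.
  by move=> hi /negbT e; rewrite ltn_neqAle e -ltnS h1 // ltnS ltnW.
(* The first return map to the points below [n]: the strand that arrives at [n] re-enters there,
   once only because [f n] differs from [n]. *)
exists (fun i => if f i == n then f n else f i); split=> //.
- split=> [i hi|i j hi hj]; first by case: ifP => // /fi -/(_ hi).
  have si : i < n.+1 by rewrite ltnS ltnW.
  have sj : j < n.+1 by rewrite ltnS ltnW.
  case: eqP => ei; case: eqP => ej.
  + by move=> _; apply: h2; rewrite // ei.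
  + by move=> /h2 -/(_ (ltnSn n) sj) e; rewrite -e ltnn in hj.
  + by move=> /h2 -/(_ si (ltnSn n)) e; rewrite e ltnn in hi.
  + exact: h2.
move=> c c' hc hc'.
have sc x : size (c ++ [:: x]) = n.+1 by rewrite size_cat hc addn1.
have sc' x : size (c' ++ [:: x]) = n.+1 by rewrite size_cat hc' addn1.
apply: (iff_trans (loop_color_rel _ hE hc)); split.
  move=> [x /h-/(_ (sc x) (sc' x)) hx] i hi.
  have si : i < n.+1 by rewrite ltnS ltnW.
  have := hx i si; rewrite !(@nth_rcons1 n) ?h1 // (ltn_eqF hi).
  case: eqP => // _ <-.
  by have := hx n (ltnSn n); rewrite !(@nth_rcons1 n) ?h1 // eqxx (ltn_eqF fnn).
move=> hx; exists (nth false c' (f n)); apply/h => // i; rewrite ltnS leq_eqVlt => /orP[/eqP->|hi].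
  by rewrite !(@nth_rcons1 n) ?h1 // eqxx (ltn_eqF fnn).
have si : i < n.+1 by rewrite ltnS ltnW.
rewrite !(@nth_rcons1 n) ?h1 // (ltn_eqF hi) -hx //.
by case: ifP.
Qed.

Lemma realizes_isotopic s t D E f : isotopic_at s t D E -> realizes (size s) D f ->
  realizes (size s) E f.
Proof.
move=> /isotopic_color[h1 h2] [h3 h4 h5]; split=> //; first exact/h1.
by move=> c c' hc hc'; apply: (iff_trans (iff_sym (h2 _ _ hc))); exact: h5.
Qed.

Lemma end_perm_realizes s (D : diag s s) f : realizes (size s) D f ->
  exists p : 'S_(size s), end_perm D = Tagged (fun N => 'S_N) p /\ forall i, p i = f i :> nat.
Proof.
move=> [h1 h2 h3]; have [p0 hp0] := perm_fun_perm h2.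
have hs (i : 'I_(size s)) : strand D i (p0 i).
  apply/strand_color => //.
  move=> c c' hc hcc; have hc' := color_rel_size (diagP D) hc hcc.
  by rewrite hp0; move: hcc => /h3-/(_ hc hc') ->.
rewrite /end_perm; case: pickP => [p /asboolP hp|/(_ p0) /asboolP//].
exists p; split=> // i.
(* This colouring singles out the strand ending at [f i], so it tests whether the permutation found
   by [pick] is the one given by [f]. *)
pose c' := mkseq (fun j => j == f i) (size s).
pose c := mkseq (fun j => nth false c' (f j)) (size s).
have sc : size c = size s by rewrite size_mkseq.
have sc' : size c' = size s by rewrite size_mkseq.
have hcc : color_rel D c c' by apply/h3 => // j hj; rewrite [RHS]nth_mkseq.
have := hp i => /strand_color-/(_ (ltn_ord i) (ltn_ord _) _ _ sc hcc).
have fi : f i < size s by apply: h2.1.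
by rewrite !nth_mkseq // eqxx => /esym/eqP.
Qed.

(** * Arrows up to equality of their objects *)

Lemma arr_inj (C : traced_data) (x y : obj C) (f g : hom x y) : arr f = arr g -> f = g.
Proof.
move=> e; have := projT2_eq e; rewrite /arr /=.
by rewrite (Prop_irrelevance (projT1_eq e) erefl).
Qed.

Lemma arrow_eta (C : traced_data) (a : arrow C) : exists x y (f : hom x y), a = arr f.
Proof. by case: a => -[x y] f; exists x, y, f. Qed.

Lemma arrow_hom (C : traced_data) (a : arrow C) x y : projT1 a = (x, y) ->
  exists f : hom x y, a = arr f.
Proof. by case: a => -[x' y'] f /= [ex ey]; subst; exists f. Qed.

Definition arrow_ten (C : traced_data) (a b : arrow C) : arrow C :=
  arr (tenm (projT2 a) (projT2 b)).

(** A relation, since two arrows compose only when their middle objects are equal, and that equality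
    is usually not definitional. *)
Definition arrow_comp (C : traced_data) (a b c : arrow C) : Prop :=
  exists x y z (f : hom x y) (g : hom y z), [/\ a = arr f, b = arr g & c = arr (comp g f)].

Lemma arrow_compE (C : traced_data) x y z (f : @hom C x y) (g : hom y z) c :
  arrow_comp (arr f) (arr g) c -> c = arr (comp g f).
Proof.
move=> [x' [y' [z' [f' [g' [ef eg ->]]]]]].
have [ex ey] := congr1 (@projT1 _ _) ef; have [_ ez] := congr1 (@projT1 _ _) eg.
by subst; rewrite (arr_inj ef) (arr_inj eg).
Qed.

Lemma arrow_comp_fun (C : traced_data) (a b c c' : arrow C) :
  arrow_comp a b c -> arrow_comp a b c' -> c = c'.
Proof. by move=> [x [y [z [f [g [-> -> ->]]]]]] /arrow_compE. Qed.

(** * Traces of module maps *)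

Section StrictModules.
Import GRing.Theory.
Local Open Scope ring_scope.
Variables (k : comNzRingType) (A : algType k) (H : ribbon_hopf_algebra A).
Local Notation C := (str_fMod H).
Local Notation fm := (fmodule A).

(** A left inverse [a] equals a right inverse [b]. This determines the image of the negative
    crossing from that of the positive one. *)
Lemma inverse_unique (X Y : seq fm) (f : @hom C X Y) (a b : arrow C) :
  arrow_comp (arr f) a (arr (idm (t := C) X)) ->
  arrow_comp b (arr f) (arr (idm (t := C) Y)) -> a = b.
Proof.
move=> [x [y [z [f' [g [ef -> eg]]]]]] [y' [x' [z' [h [f'' [-> ef' eh]]]]]].
have [ex ey] := congr1 (@projT1 _ _) ef; have [ex' ey'] := congr1 (@projT1 _ _) ef'.
have [_ ez] := congr1 (@projT1 _ _) eg; have [ez' _] := congr1 (@projT1 _ _) eh.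
move: f' g h f'' ef eg ef' eh; rewrite -ex -ey -ex' -ey' -ez -ez' => f' g h f'' ef eg ef' eh.
rewrite -(arr_inj ef) in eg; rewrite -(arr_inj ef') in eh.
congr arr; have e1 := arr_inj eg; have e2 := arr_inj eh.
rewrite -[LHS]comp_lfun1r -[RHS]comp_lfun1l.
rewrite -[\1%VF]/(idm (t := C) Y) e2 -[\1%VF in RHS]/(idm (t := C) X) e1.
exact: comp_lfunA.
Qed.

(** Transport along an equality of sequences as a linear map, so that it can be composed with
    associators and unitors. *)
Definition cast_par (X Y : seq fm) (e : X = Y) : 'Hom(par H X, par H Y) :=
  match e with erefl => \1%VF end.

Lemma arr_cast (X Y X' Y' : seq fm) (eX : X' = X) (eY : Y = Y') (f : @hom C X Y) :
  arr f = arr (cast_par eY \o f \o cast_par eX : @hom C X' Y')%VF.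
Proof. by subst; rewrite /= comp_lfun1l comp_lfun1r. Qed.

Definition cast_foldl (V : fm) (X Y : seq fm) (e : X = Y) :
   'Hom(foldl (tensor_mod H) V X, foldl (tensor_mod H) V Y) :=
  match e with erefl => \1%VF end.

Lemma cast_par_cons V X Y (e : V :: X = V :: Y) (e' : X = Y) :
  cast_par e = cast_foldl V e'.
Proof. by subst; rewrite (Prop_irrelevance e erefl). Qed.

Lemma cast_foldl_cons V U X Y (e : U :: X = U :: Y) (e' : X = Y) :
  cast_foldl V e = cast_foldl (tensor_mod H V U) e'.
Proof. by subst; rewrite (Prop_irrelevance e erefl). Qed.

Lemma cast_par_inv X Y (e : X = Y) (e' : Y = X) : (cast_par e \o cast_par e' = \1)%VF.
Proof. by subst; rewrite (Prop_irrelevance e' erefl) comp_lfun1l. Qed.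

Lemma runitH_pure (V : fm) (x : V) (c : k^o) : runitH H V (x ⊗ c) = (c : k) *: x.
Proof.
rewrite /runitH linfunE; first by rewrite tlift_pure //; exact: runit_bil.
exact/tlift_linear/runit_bil.
Qed.

Lemma lunitH_pure (V : fm) (x : V) (c : k^o) : lunitH H V (c ⊗ x) = (c : k) *: x.
Proof.
rewrite /lunitH linfunE; first by rewrite tlift_pure //; exact: lunit_bil.
exact/tlift_linear/lunit_bil.
Qed.

Lemma lfun_tensor3_ext (U V W : fm) (P : vectType k)
    (f g : 'Hom(tensor_mod H (tensor_mod H U V) W, P)) :
  (forall x y z, f (x ⊗ y ⊗ z) = g (x ⊗ y ⊗ z)) -> f = g.
Proof.
move=> h; apply: (@lfun_tensor_ext _ _ _ (tensor_mod H U V) W) => t z.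
apply: (tensor_ext (f := fun t : tensor U V => f (t ⊗ z)) (g := fun t : tensor U V => g (t ⊗ z))).
- by move=> c u v; rewrite tpureDl tpureZl linearP.
- by move=> c u v; rewrite tpureDl tpureZl linearP.
- by move=> x y; exact: h.
Qed.

(** In the strictification the right unitor becomes an identity, that is, a cast along [X ++ [::] =
    X]. *)
Lemma glue_runit (X : seq fm) (e : X ++ [::] = X) :
  (cast_par e \o (glue H X [::]).1)%VF = runitH H (par H X).
Proof.
case: X e => [|V X] e.
  rewrite (Prop_irrelevance e erefl) comp_lfun1l /=.
  apply: (@lfun_tensor_ext _ _ _ (unit_mod H) (unit_mod H)) => c d.
  by rewrite lunitH_pure runitH_pure; exact: mulrC.
have e' : X ++ [::] = X by rewrite cats0.
rewrite (cast_par_cons e e') /= {e}.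
elim: X V e' => [|U X IHX] V e' /=.
  by rewrite (Prop_irrelevance e' erefl) comp_lfun1l.
have e2 : X ++ [::] = X by rewrite cats0.
by rewrite (cast_foldl_cons V e' e2); exact: IHX.
Qed.

Lemma glue_assoc (X : seq fm) (U T : fm) (e : (X ++ [:: U]) ++ [:: T] = X ++ [:: U; T]) :
  (cast_par e \o (glue H (X ++ [:: U]) [:: T]).1 \o tensH H (glue H X [:: U]).1 \1)%VF =
  ((glue H X [:: U; T]).1 \o assocH H (par H X) U T)%VF.
Proof.
case: X e => [|V X] e.
  rewrite (Prop_irrelevance e erefl) comp_lfun1l comp_lfun1l.
  apply: lfun_tensor3_ext => c x y.
  by rewrite comp_lfunE tensH_pure assocH_pure !lunitH_pure id_lfunE tpureZl.
have e' : (X ++ [:: U]) ++ [:: T] = X ++ [:: U; T] by rewrite -catA.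
rewrite (cast_par_cons e e') {e}.
rewrite [glue H _ _]/= [glue H (V :: X) _]/= [glue H (V :: X) _]/=.
elim: X V e' => [|Z X IHX] V e'.
  rewrite (Prop_irrelevance e' erefl) comp_lfun1l /= tensH1 comp_lfun1l comp_lfun1r.
  by have [-> _] := assoc_inv H V U T.
have e2 : (X ++ [:: U]) ++ [:: T] = X ++ [:: U; T] by rewrite -catA.
rewrite (cast_foldl_cons V e' e2); exact: IHX.
Qed.

Lemma glue_runitV (X : seq fm) (e : X = X ++ [::]) :
  ((glue H X [::]).2 \o cast_par e)%VF = runitVH H (par H X).
Proof.
have [_ h] := glue_inv H X [::]; have [h1 h2] := runit_inv H (par H X).
rewrite /= in h1 h2.
rewrite -[LHS]comp_lfun1r -h1 -(glue_runit (esym e)) !comp_lfunA.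
rewrite -[((_ \o cast_par e) \o cast_par _)%VF]comp_lfunA cast_par_inv comp_lfun1r.
by rewrite h comp_lfun1l.
Qed.

Lemma glue_assocV (X : seq fm) (U T : fm) (e : X ++ [:: U; T] = (X ++ [:: U]) ++ [:: T]) :
  ((glue H (X ++ [:: U]) [:: T]).2 \o cast_par e \o (glue H X [:: U; T]).1)%VF =
  (tensH H (glue H X [:: U]).1 \1 \o assocVH H (par H X) U T)%VF.
Proof.
have [_ h] := glue_inv H (X ++ [:: U]) [:: T]; have [h1 _] := assoc_inv H (par H X) U T.
have [_ h2] := assoc_inv H (par H X) U T.
rewrite /= in h h1 h2.
rewrite -[LHS]comp_lfun1r -h2 !comp_lfunA.
rewrite -[(((_ \o _) \o (glue H X [:: U; T]).1) \o assocH _ _ _ _)%VF]comp_lfunA -(glue_assoc (esym e)).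
rewrite !comp_lfunA -[((_ \o cast_par e) \o cast_par _)%VF]comp_lfunA cast_par_inv comp_lfun1r.
by rewrite h comp_lfun1l.
Qed.

Lemma glue_assoc' (X : seq fm) (U T : fm) (e : (X ++ [:: U]) ++ [:: T] = X ++ [:: U; T]) :
  ((glue H X [:: U; T]).2 \o cast_par e \o (glue H (X ++ [:: U]) [:: T]).1)%VF =
  (assocH H (par H X) U T \o tensH H (glue H X [:: U]).2 \1)%VF.
Proof.
have [_ h] := glue_inv H X [:: U; T]; have [h1 _] := glue_inv H X [:: U].
have e1 : tensH H ((glue H X [:: U]).1 \o (glue H X [:: U]).2)%VF
  (\1 \o \1 : 'Hom(T, T))%VF = \1%VF by rewrite h1 comp_lfun1l tensH1.
rewrite -[LHS]comp_lfun1r -e1 -tensH_comp !comp_lfunA.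
congr (_ \o _)%VF; rewrite -!comp_lfunA (comp_lfunA (cast_par e)) glue_assoc.
by rewrite comp_lfunA h comp_lfun1l.
Qed.

(* The trace is the composite of the images of the three layers of a closure;
   the layers only match up to equality of their sources and targets. *)
Lemma trace_layers (X Y : seq fm) (U : fm) (g : @hom C (X ++ [:: U]) (Y ++ [:: U])) c c' :
  arrow_comp (arrow_ten (arr (idm (t := C) X)) (arr (coevH H U : @hom C [::] [:: U; dual_mod H U])))
    (arrow_ten (arr g) (arr (idm (t := C) [:: dual_mod H U]))) c ->
  arrow_comp c (arrow_ten (arr (idm (t := C) Y)) (arr (evrH H U : @hom C [:: U; dual_mod H U] [::]))) c' ->
  c' = arr (@ptr C X Y [:: U] g).
Proof.
pose a := @tenm C X X [::] [:: U; dual_mod H U] (idm (t := C) X) (coevH H U).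
pose b := @tenm C _ _ [:: dual_mod H U] [:: dual_mod H U] g (idm (t := C) [:: dual_mod H U]).
pose d := @tenm C Y Y [:: U; dual_mod H U] [::] (idm (t := C) Y) (evrH H U).
move=> hc hc'; have {}hc : arrow_comp (arr a) (arr b) c := hc.
have {}hc' : arrow_comp c (arr d) c' := hc'.
have eX : X = X ++ [::] by rewrite cats0.
have eX' : X ++ [:: U; dual_mod H U] = (X ++ [:: U]) ++ [:: dual_mod H U] by rewrite -catA.
have eY : (Y ++ [:: U]) ++ [:: dual_mod H U] = Y ++ [:: U; dual_mod H U] by rewrite -catA.
have eY' : Y ++ [::] = Y by rewrite cats0.
rewrite (arr_cast eX eX' a) in hc; move: hc'; rewrite (arrow_compE hc).
rewrite (arr_cast eY eY' d) => /arrow_compE ->.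
congr arr; rewrite /a /b /d {hc a b d} /= /traceH.
have -> : tensH H (((glue H Y [:: U]).2 \o g) \o (glue H X [:: U]).1)%VF
    (\1 : 'Hom(dual_mod H U, dual_mod H U))%VF =
  (tensH H (glue H Y [:: U]).2 \1 \o tensH H g \1 \o tensH H (glue H X [:: U]).1 \1)%VF.
  by rewrite !tensH_comp !comp_lfun1l.
transitivity ((runitH H (par H Y) \o tensH H \1 (evrH H U)) \o
  (assocH H (par H Y) U (dual_mod H U) \o tensH H (glue H Y [:: U]).2 \1) \o tensH H g \1 \o
  (tensH H (glue H X [:: U]).1 \1 \o assocVH H (par H X) U (dual_mod H U)) \o
  tensH H \1 (coevH H U) \o runitVH H (par H X))%VF; last by rewrite !comp_lfunA.
rewrite -(glue_assoc' eY) -(glue_assocV eX') -(glue_runit eY') -(glue_runitV eX).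
by rewrite !comp_lfunA.
Qed.
End StrictModules.

(** * Images of diagrams under a functor *)

Section Image.
Variables (S : subcat tangles) (C : traced_data) (S' : subcat C) (F : functor S S').

Definition has_class (s t : word) (D : seq slice) : Prop :=
  [/\ sobj S s, sobj S t & exists hD : is_diag s D t, sarr S (@arr tangles s t (tclass hD))].

(** Hides the typing proof and the proofs of membership in [S], so that an image depends on the
    slice list and its two words alone. *)
Definition image_at (s t : word) (D : seq slice) (b : arrow C) : Prop :=
  exists hD : is_diag s D t, sends F (@arr tangles s t (tclass hD)) b.

Lemma sends_fun a b b' : sends F a b -> sends F a b' -> b = b'.
Proof.
move=> [[x hx] [[y hy] [[f hf] /= [ef <-]]]] [[x' hx'] [[y' hy'] [[f' hf'] /= [ef' <-]]]].
rewrite -ef in ef'; have [ex ey] := congr1 (@projT1 _ _) ef'; rewrite /= in ex ey.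
subst; have e := arr_inj ef'; rewrite /= in e; subst.
by rewrite (Prop_irrelevance hx hx') (Prop_irrelevance hy hy') in hf hf' *;
   rewrite (Prop_irrelevance hf hf').
Qed.

Lemma sends_obj_fun x X X' : sends_obj F x X -> sends_obj F x X' -> X = X'.
Proof.
move=> [[y hy] [/= e1 <-]] [[y' hy'] [/= e2 <-]]; subst.
by rewrite (Prop_irrelevance hy hy').
Qed.

Lemma image_fun s t D b b' : image_at s t D b -> image_at s t D b' -> b = b'.
Proof. by move=> [h1 h] [h2]; rewrite (bool_irrelevance h2 h1); exact: sends_fun. Qed.

Lemma image_at_diag s t D b : image_at s t D b -> is_diag s D t.
Proof. by case. Qed.

Lemma image_exists s t D : has_class s t D -> exists b, image_at s t D b.
Proof.
move=> [hs ht [hD hS]]; pose x : sub_obj S := exist _ s hs; pose y : sub_obj S := exist _ t ht.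
pose f : sub_hom x y := exist _ (tclass hD : @hom tangles s t) hS.
by exists (arr (sval (fmap F f))), hD, x, y, f.
Qed.

Lemma image_isotopic s t D E b : isotopic_at s t D E -> image_at s t D b -> image_at s t E b.
Proof.
move=> h [hD hb]; have [_ hE] := isotopic_at_diag h; exists hE.
by rewrite -(isotopic_at_tclass hD hE h).
Qed.

Lemma sends_typed s t (f : @hom tangles s t) b : sends F (arr f) b ->
  exists (hs : sobj S s) (ht : sobj S t) (hf : sarr S (arr f)),
    b = arr (sval (fmap F (exist _ f hf : sub_hom (exist _ s hs : sub_obj S) (exist _ t ht)))).
Proof.
move=> [[x hx] [[y hy] [[f' hf] /= [ef <-]]]].
have [ex ey] := congr1 (@projT1 _ _) ef; rewrite /= in ex ey; subst.
by have e := arr_inj ef; rewrite /= in e; subst; exists hx, hy, hf.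
Qed.

Lemma image_nil s b : image_at s s [::] b -> exists2 X, sends_obj F s X & b = arr (idm X).
Proof.
move=> [hD /sends_typed [hs [ht [hf ->]]]].
rewrite (Prop_irrelevance ht hs); eexists; first by exists (exist _ s hs).
by rewrite fmap_id //= (bool_irrelevance hD (eqxx s)).
Qed.

(** A [subcat] need not be closed under composition, so membership of the composite in [S] has to be
    supplied; for [Tup] it comes from [realizes_class]. *)
Lemma image_cat s t r D E a b : image_at s t D a -> image_at t r E b -> has_class s r (D ++ E) ->
  exists2 c, image_at s r (D ++ E) c & arrow_comp a b c.
Proof.
move=> [hD /sends_typed[hs [ht [hf ea]]]] [hE /sends_typed[ht' [hr [hg eb]]]] [hs' hr' [hDE hh]].
rewrite (Prop_irrelevance ht' ht) in eb.
pose x : sub_obj S := exist _ s hs; pose z : sub_obj S := exist _ r hr.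
pose h : sub_hom x z := exist _ (tclass hDE : @hom tangles s r) hh.
exists (arr (sval (fmap F h))); first by exists hDE, x, z, h.
rewrite ea eb; do 5!eexists; split=> //; congr arr; apply: fmap_comp.
have := comp_tclass (Diag hD) (Diag hE).
rewrite (bool_irrelevance (diagP (Diag hD)) hD) (bool_irrelevance (diagP (Diag hE)) hE).
by rewrite (bool_irrelevance (is_diag_cat hD hE) hDE) => /esym.
Qed.

Lemma image_ten s t s' t' D E a b : strict_monoidal F -> image_at s t D a -> image_at s' t' E b ->
  has_class (s ++ s') (t ++ t') (whisker [::] s' D ++ whisker t [::] E) ->
  image_at (s ++ s') (t ++ t') (whisker [::] s' D ++ whisker t [::] E) (arrow_ten a b).
Proof.
move=> [_ _ hm] [hD ha] [hE hb] hc; have [c] := image_exists hc; move=> /[dup] hc' [hDE hs].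
have [X [X' [f ef]]] := arrow_eta a; have [Y [Y' [g eg]]] := arrow_eta b; subst.
have := hm _ _ _ _ _ _ _ _ _ _ f g c ha hb.
have := tenm_tclass (Diag hD) (Diag hE).
rewrite (bool_irrelevance (diagP (Diag hD)) hD) (bool_irrelevance (diagP (Diag hE)) hE) => ->.
rewrite (bool_irrelevance (tensor_diag (Diag hD) (Diag hE)) hDE) => /(_ hs) ec.
by rewrite /arrow_ten /= -ec.
Qed.

End Image.

(** [Tup] inspects the representative chosen by [repr]; isotopy invariance of rigidity carries the
    property over from [D]. *)
Lemma realizes_class n D f : is_diag (plus n) D (plus n) -> realizes n D f ->
  has_class Tup (plus n) (plus n) D.
Proof.
move=> hD hf; split; rewrite /= ?all_nseq ?orbT //; exists hD; rewrite /=.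
apply: rigid_no_closed_component.
have h : isotopic_at (plus n) (plus n) (repr (tclass hD : tangle _ _)) D.
  by exists (repr (tclass hD : tangle _ _)), (Diag hD); split=> //; exact: (repr_tclass (D := Diag hD)).
by apply/(isotopic_color h).1; rewrite size_nseq; case: hf.
Qed.

Lemma admissible_loop n E f (hE : is_diag (plus n ++ [:: true]) E (plus n ++ [:: true])) :
  realizes n.+1 E f -> f n <> n ->
  admissible (size (plus n)) 1 (end_perm (repr (tclass hE : tangle _ _))).
Proof.
move=> hf fn.
have h : isotopic_at (plus n ++ [:: true]) (plus n ++ [:: true]) E (repr (tclass hE : tangle _ _)).
  apply: isotopic_at_sym; exists (repr (tclass hE : tangle _ _)), (Diag hE).
  by split=> //; exact: (repr_tclass (D := Diag hE)).
have hs : size (plus n ++ [:: true]) = n.+1 by rewrite size_cat size_nseq addn1.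
rewrite -hs in hf; have hf' := realizes_isotopic h hf.
have [p [-> hp]] := end_perm_realizes hf'.
move=> c /= /imsetP[x _ ->] [_ hc].
(* With [m = 1] and points numbered from 0, the closed points are [n] alone; a forbidden cycle would
   be the fixed point [n]. *)
have hx (y : 'I__) : y \in porbit p x -> nat_of_ord y = n.
  by move=> /hc; rewrite size_nseq addn1 ltnS -eqn_leq => /eqP.
apply: fn; rewrite -{1}(hx x (porbit_id p x)) -hp.
by apply: hx; exact: (mem_porbit p 1 x).
Qed.

Section Objects.
Variables (S : subcat tangles) (C : traced_data) (S' : subcat C) (F : functor S S').
Hypothesis hF : strict_monoidal F.

Lemma image_type s t D b X Y : image_at F s t D b -> sends_obj F s X -> sends_obj F t Y ->
  projT1 b = (X, Y).
Proof.
move=> [hD /sends_typed[hs [ht [hf ->]]]] hX hY /=.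
congr pair; first by apply: sends_obj_fun hX; exists (exist _ s hs).
by apply: sends_obj_fun hY; exists (exist _ t ht).
Qed.

Lemma image_whisker a b n D X Z w :
  image_at F (plus a) (plus a) [::] (arr (idm X)) -> image_at F (plus b) (plus b) [::] (arr (idm Z)) ->
  image_at F (plus n) (plus n) D w ->
  has_class S (plus (a + n)) (plus (a + n)) (whisker (plus a) [::] D) ->
  has_class S (plus (a + n + b)) (plus (a + n + b)) (whisker (plus a) (plus b) D) ->
  image_at F (plus (a + n + b)) (plus (a + n + b)) (whisker (plus a) (plus b) D)
   (arrow_ten (arrow_ten (arr (idm X)) w) (arr (idm Z))).
Proof.
move=> ha hb hw; rewrite !nseqD => h1 h2.
have h3 := image_ten hF (image_ten hF ha hw h1) hb.
have e : whisker [::] (plus b) (whisker [::] (plus n) [::] ++ whisker (plus a) [::] D) ++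
  whisker (plus a ++ plus n) [::] [::] = whisker (plus a) (plus b) D.
  by rewrite /= whisker_whisker !cats0.
by rewrite e in h3; apply: h3.
Qed.

End Objects.

Section RT.
Variables (k : comNzRingType) (A : algType k) (H : ribbon_hopf_algebra A) (W : fmodule A).
Local Notation C := (str_fMod H).

Section OneFunctor.
Variables (S : subcat tangles) (S' : subcat C) (F : functor S S').
Hypothesis hF : strict_monoidal F.
Hypothesis hS : forall n, sobj S (plus n).
Hypothesis hW : forall X, sends_obj F [:: true] X -> X = [:: W].
Hypothesis hbraid : preserves_braiding F.

Lemma sends_obj_plus n : sends_obj F (plus n) (nseq n W).
Proof.
have ex m : exists X, sends_obj F (plus m) X.
  by eexists; exists (exist _ (plus m) (hS m)).
have [hu ht _] := hF; elim: n => [|n IHn].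
  by have [X /[dup] /hu ->] := ex 0.
have [X hX] := ex n.+1; have [Y hY] := ex 1.
have := ht _ _ _ _ _ hY IHn hX; rewrite (hW hY) => e.
by rewrite e in hX.
Qed.

Lemma image_plus_nil n : has_class S (plus n) (plus n) [::] ->
  image_at F (plus n) (plus n) [::] (arr (idm (t := C) (nseq n W))).
Proof.
move=> /(image_exists F)[b hb]; have [X hX eb] := image_nil hb.
by rewrite eb (sends_obj_fun hX (sends_obj_plus n)) in hb.
Qed.

Lemma image_cross : has_class S (plus 2) (plus 2) [:: ([::], Cross true true true, [::])] ->
  image_at F (plus 2) (plus 2) [:: ([::], Cross true true true, [::])]
    (arr (braid (t := C) [:: W] [:: W])).
Proof.
move=> /(image_exists F)[b [hD hb]]; have h1 := sends_obj_plus 1.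
suff <- : b = arr (braid (t := C) [:: W] [:: W]) by exists hD.
apply: (hbraid h1 h1).
have -> : braid (t := tangles) [:: true] [:: true] = tclass hD.
  exact: (congr1 (@tclass _ _ _) (bool_irrelevance (crossing_diag [:: true] [:: true]) hD)).
exact: hb.
Qed.

End OneFunctor.
End RT.

Lemma tclass_eq s t D E (hD : is_diag s D t) (hE : is_diag s E t) : D = E -> tclass hD = tclass hE.
Proof. by move=> e; subst; rewrite (bool_irrelevance hD hE). Qed.

(** Arrows of [fMod_W] are images under a composite with [Tup_incl_plus]; this makes them images
    under [RTplus], whose trace property then applies. *)
Lemma sends_comp_incl (C D : traced_data) (S S1 : subcat C) (S' : subcat D)
    (ho : forall x, sobj S x -> sobj S1 x) (ha : forall a, sarr S a -> sarr S1 a)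
    (G : functor S1 S') a b : sends (functor_comp G (functor_incl ho ha)) a b -> sends G a b.
Proof.
move=> [x [y [f [<- <-]]]]; exists (fobj (functor_incl ho ha) x), (fobj (functor_incl ho ha) y).
by exists (fmap (functor_incl ho ha) f).
Qed.

Lemma sends_obj_comp_incl (C D : traced_data) (S S1 : subcat C) (S' : subcat D)
    (ho : forall x, sobj S x -> sobj S1 x) (ha : forall a, sarr S a -> sarr S1 a)
    (G : functor S1 S') x X : sends_obj (functor_comp G (functor_incl ho ha)) x X -> sends_obj G x X.
Proof. by move=> [x' [<- <-]]; exists (fobj (functor_incl ho ha) x'). Qed.

(** * The two functors on upwards tangles *)

Section Main.
Variables (k : comNzRingType) (A : algType k) (H : ribbon_hopf_algebra A) (W : fmodule A).
Local Notation C := (str_fMod H).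
Local Notation dW := (dual_mod H W).
Variables (RT : functor Tall (fMod H)) (hRT : is_RT W RT).

Lemma class_all s t D : is_diag s D t -> has_class Tall s t D.
Proof. by move=> h; split=> //; exists h. Qed.

Let monoidal : strict_monoidal RT. Proof. by case: hRT => -[]. Qed.
Let braiding : preserves_braiding RT. Proof. by case: hRT => _ []. Qed.
Let obj_pos X : sends_obj RT [:: true] X -> X = [:: W].
Proof. by case: hRT => -[h _ _] _; exact: h. Qed.
Let obj_neg X : sends_obj RT [:: false] X -> X = [:: dW].
Proof. by case: hRT => -[_ h _] _; exact: h. Qed.
Let objS n : sobj Tall (plus n). Proof. by []. Qed.

Lemma RT_obj_plus n : sends_obj RT (plus n) (nseq n W).
Proof. exact: sends_obj_plus. Qed.

Lemma RT_nil_neg : image_at RT [:: false] [:: false] [::] (arr (idm (t := C) [:: dW])).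
Proof.
have [b hb] := image_exists RT (@class_all [:: false] [:: false] [::] isT).
have [X hX eb] := image_nil hb.
by rewrite eb (obj_neg hX) in hb.
Qed.

Lemma RT_nil n : image_at RT (plus n) (plus n) [::] (arr (idm (t := C) (nseq n W))).
Proof.
apply: image_plus_nil => //.
by apply: class_all; exact: eqxx.
Qed.

(** The clauses of [is_RT] constrain images without asserting that any exist; in [Tall] every
    diagram has one. *)
Lemma RT_sends s t (D : seq slice) (hD : is_diag s D t) (f : @hom tangles s t) b :
  f = tclass hD -> (forall b', sends RT (arr f) b' -> b' = b) -> image_at RT s t D b.
Proof.
move=> ef h; have [b' /[dup] hb' [hD' hs]] := image_exists RT (class_all hD).
by rewrite -(h b') // ef (bool_irrelevance hD hD').
Qed.

Lemma RT_cup : image_at RT [::] [:: true; false] [:: ([::], Cup true, [::])]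
  (arr (coevH H W : @hom C [::] [:: W; dW])).
Proof.
apply: (RT_sends (hD := gen_diag (Cup true)) erefl).
by case: hRT => _ [_ _ _]; exact.
Qed.

Lemma RT_cap_false : image_at RT [:: false; true] [::] [:: ([::], Cap false, [::])]
  (arr (evH H W : @hom C [:: dW; W] [::])).
Proof.
apply: (RT_sends (hD := gen_diag (Cap false)) erefl).
by case: hRT => _ [_ _ h _]; exact: h.
Qed.

Lemma RT_twist : image_at RT [:: true] [:: true] (right_curl true true)
  (arr (twist (t := C) [:: W])).
Proof.
apply: (RT_sends (hD := full_twist_diag [:: true]) erefl) => b hb.
case: hRT => _ [_ ht _ _]; apply: ht hb; exact: (RT_obj_plus 1).
Qed.

Lemma RT_cross_neg : image_at RT [:: true; false] [:: false; true] [:: ([::], Cross true true false, [::])]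
  (arr (braid (t := C) [:: W] [:: dW])).
Proof.
apply: (RT_sends (hD := crossing_diag [:: true] [:: false]) erefl) => b.
apply: braiding; first exact: (RT_obj_plus 1).
pose x : sub_obj Tall := exist _ ([:: false] : obj tangles) I.
have hx : sends_obj RT [:: false] (sval (fobj RT x)) by exists x.
by rewrite -(obj_neg hx).
Qed.

Lemma RT_cap : image_at RT [:: true; false] [::] [:: ([::], Cap true, [::])]
  (arr (evrH H W : @hom C [:: W; dW] [::])).
Proof.
have h1 : image_at RT [:: true; false] [:: true; false] (whisker [::] [:: false] (right_curl true true))
  (arrow_ten (arr (twist (t := C) [:: W])) (arr (idm (t := C) [:: dW]))).
  have := image_ten monoidal RT_twist RT_nil_neg; rewrite cats0.
  by apply; exact: class_all.
have [c2 h2 e2] := image_cat h1 RT_cross_neg (class_all (is_diag_cat (image_at_diag h1) (image_at_diag RT_cross_neg))).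
have [c3 h3 e3] := image_cat h2 RT_cap_false (class_all (is_diag_cat (image_at_diag h2) (image_at_diag RT_cap_false))).
have {}e2 := arrow_compE e2; rewrite e2 in e3; have {}e3 := arrow_compE e3.
have hc := refines_at (cap_twist true true) (s := [:: true; false]) (t := [::]) isT.
rewrite -catA in h3; have := image_isotopic hc h3.
by rewrite e3 /= comp_lfun1l comp_lfun1l !comp_lfun1r comp_lfunA.
Qed.

(** Cup, diagram and clockwise cap, each next to idle strands, are sent to the three layers that
    [trace_layers] assembles into the module trace. *)
Lemma RT_loop n E (g : @hom C (nseq n W ++ [:: W]) (nseq n W ++ [:: W])) :
  image_at RT (plus n ++ [:: true]) (plus n ++ [:: true]) E (arr g) ->
  image_at RT (plus n) (plus n) (loop n E) (arr (@ptr C (nseq n W) (nseq n W) [:: W] g)).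
Proof.
move=> hE; have dE := image_at_diag hE.
have h1 := image_ten monoidal (RT_nil n) RT_cup.
have h2 := image_ten monoidal hE RT_nil_neg.
have h3 := image_ten monoidal (RT_nil n) RT_cap.
have d1 : is_diag (plus n) [:: (plus n, Cup true, [::])] (plus n ++ [:: true; false]) by diag_ok.
have d2 : is_diag (plus n ++ [:: true; false]) (whisker [::] [:: false] E) (plus n ++ [:: true; false]).
  by have := is_diag_whiskerr [:: false] dE; rewrite -catA.
have d3 : is_diag (plus n ++ [:: true; false]) [:: (plus n, Cap true, [::])] (plus n) by diag_ok.
rewrite /= !whisker_cons /= !cats0 whisker_nil in h1.
rewrite /= !cats0 -catA in h2.
rewrite /= !whisker_cons /= !cats0 whisker_nil in h3.
have {}h1 := h1 (class_all d1); have {}h2 := h2 (class_all d2); have {}h3 := h3 (class_all d3).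
have [c4 h4 e4] := image_cat h1 h2 (class_all (is_diag_cat d1 d2)).
have [c5 h5 e5] := image_cat h4 h3 (class_all (is_diag_cat (is_diag_cat d1 d2) d3)).
by rewrite (trace_layers e4 e5) -catA in h5.
Qed.

(** * Agreement on generators, products and traces *)

Variables (RTplus : functor Tplus (fMod H)) (hRTplus : is_traced_RT W RTplus).
Variables (RTup : functor Tup (fMod_W RTplus)) (hRTup : is_open_traced_RT W RTup).

Let up_monoidal : strict_monoidal RTup. Proof. by case: hRTup. Qed.
Let up_braiding : preserves_braiding RTup. Proof. by case: hRTup. Qed.
Let up_pos X : sends_obj RTup [:: true] X -> X = [:: W].
Proof. by case: hRTup => h _ _ _ _; exact: h. Qed.
Let up_objS n : sobj Tup (plus n). Proof. by rewrite /= all_nseq orbT. Qed.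

Lemma RTup_obj_plus n : sends_obj RTup (plus n) (nseq n W).
Proof. exact: sends_obj_plus. Qed.

Lemma RTup_loop n E f (g : @hom C (nseq n W ++ [:: W]) (nseq n W ++ [:: W])) :
  realizes n.+1 E f -> f n <> n -> has_class Tup (plus n) (plus n) (loop n E) ->
  image_at RTup (plus n ++ [:: true]) (plus n ++ [:: true]) E (arr g) ->
  image_at RTup (plus n) (plus n) (loop n E) (arr (@ptr C (nseq n W) (nseq n W) [:: W] g)).
Proof.
move=> hf fn hl [hE hg]; have [b /[dup] hb [hD hs]] := image_exists RTup hl.
have [h' eh'] := arrow_hom (image_type hb (RTup_obj_plus n) (RTup_obj_plus n)).
have eptr : @ptr tangles (plus n) (plus n) [:: true] (tclass hE) = tclass hD.
  have := ptr_tclass (Diag hE); rewrite (bool_irrelevance (diagP (Diag hE)) hE) => ->.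
  have eD : closing (plus n) (plus n) [:: true] E = loop n E.
    by rewrite /closing /cups /caps /loop !whisker_nil /= !whisker_cons /= !cats0 !whisker_nil.
  exact: tclass_eq.
have [_ _ _ _ [_ _ htr]] := hRTup.
rewrite eh' -eptr in hs.
have [hu [hv [hS eg]]] := sends_typed hg.
have := htr (plus n) (plus n) [:: true] (tclass hE) _ _ _ _ g h' (RTup_obj_plus n) (RTup_obj_plus n)
   (RTup_obj_plus 1) hg hs.
case; first by split=> //; exact: admissible_loop hf fn.
(* The open trace on the image only yields some tangle [f0] sent to [g], not necessarily the class
   of [E], with trace sent to [h']. As [RTplus] preserves traces, [h'] is the module trace of [g]
   all the same. *)
move=> x [y [u [f0 [h0 [[hx hy hu0] [hf0 hh0 [_ _ eh0]]]]]]].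
have [_ _ _ _ hplus] := hRTplus.
have := hplus x y u f0 _ _ _ g (arr h') (sends_obj_comp_incl hx) (sends_obj_comp_incl hy)
  (sends_obj_comp_incl hu0) (sends_comp_incl hf0).
rewrite -eh0 => /(_ (sends_comp_incl hh0)) <-.
by rewrite -eh'.
Qed.

(** The permutation is carried along because it shows that composites lie in [Tup] and decides
    admissibility of the next trace. *)
Definition agree n D := exists f b, [/\ realizes n D f,
  image_at RTup (plus n) (plus n) D b & image_at RT (plus n) (plus n) D b].

Lemma agree_diag n D : agree n D -> is_diag (plus n) D (plus n).
Proof. by move=> [f [b [_ /image_at_diag]]]. Qed.

Lemma agree_isotopic n D E : isotopic_at (plus n) (plus n) D E -> agree n D -> agree n E.
Proof.
move=> h [f [b [hf h1 h2]]]; exists f, b; split; [|exact: image_isotopic h _|exact: image_isotopic h _].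
by rewrite -[n](size_nseq n true) in hf *; exact: realizes_isotopic h hf.
Qed.

Lemma agree_refines n D E : D ⊑ E -> is_diag (plus n) D (plus n) -> agree n E -> agree n D.
Proof. by move=> h hD; apply: agree_isotopic; apply: isotopic_at_sym; exact: refines_at h hD. Qed.

Lemma agree_refined n D E : D ⊑ E -> agree n D -> agree n E.
Proof. by move=> h hD; apply: agree_isotopic (hD); apply: refines_at h _; exact: agree_diag. Qed.

Lemma agree_nil n : agree n [::].
Proof.
exists id, (arr (idm (t := C) (nseq n W))); split; [exact: realizes_nil | | exact: RT_nil].
apply: image_plus_nil => //.
by apply: realizes_class (realizes_nil n); exact: eqxx.
Qed.

Lemma agree_cat n D E : agree n D -> agree n E -> agree n (D ++ E).
Proof.
move=> aD aE; have dD := agree_diag aD; have dE := agree_diag aE.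
move: aD aE => [f [b [hf h1 h2]]] [g [c [hg h3 h4]]].
have dDE := is_diag_cat dD dE.
have hfg : realizes n (D ++ E) (g \o f).
  by rewrite -[n](size_nseq n true) in hf hg *; exact: realizes_cat dD hf hg.
have [w hw ew] := image_cat h1 h3 (realizes_class dDE hfg).
have [w' hw' ew'] := image_cat h2 h4 (class_all dDE).
rewrite -(arrow_comp_fun ew ew') in hw'.
by exists (g \o f), w.
Qed.

Lemma agree_whisker a b n D : agree n D -> agree (a + n + b) (whisker (plus a) (plus b) D).
Proof.
move=> aD; have dD := agree_diag aD; have [f [w [hf h1 h2]]] := aD.
have [f1] := realizes_whisker a 0 dD hf; rewrite addn0 => hf1.
have [f2 hf2] := realizes_whisker a b dD hf.
have d1 : is_diag (plus (a + n)) (whisker (plus a) [::] D) (plus (a + n)).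
  by have := is_diag_whiskerl (plus a) dD; rewrite -nseqD.
have d2 : is_diag (plus (a + n + b)) (whisker (plus a) (plus b) D) (plus (a + n + b)).
  by have := is_diag_whisker (plus a) (plus b) dD; rewrite !nseqD -catA.
have up_nil m : image_at RTup (plus m) (plus m) [::] (arr (idm (t := C) (nseq m W))).
  apply: image_plus_nil => //.
  by apply: realizes_class (realizes_nil m); exact: eqxx.
have i1 := image_whisker up_monoidal (up_nil a) (up_nil b) h1 (realizes_class d1 hf1)
  (realizes_class d2 hf2).
have i2 := image_whisker monoidal (RT_nil a) (RT_nil b) h2 (class_all d1) (class_all d2).
by exists f2, (arrow_ten (arrow_ten (arr (idm (t := C) (nseq a W))) w) (arr (idm (t := C) (nseq b W)))).
Qed.

(** The positive crossing is a braiding, preserved by both functors. The negative one is its inverse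
    on both sides, so [inverse_unique] identifies its two images. *)
Lemma agree_cross o : agree 2 [:: ([::], Cross o true true, [::])].
Proof.
have d o' : is_diag (plus 2) [:: ([::], Cross o' true true, [::])] (plus 2) by [].
have up_class o' := realizes_class (d o') (realizes_cross o').
exists (fun i => 1 - i).
have h1 := image_cross up_monoidal up_objS up_pos up_braiding (up_class true).
have h2 := image_cross monoidal objS obj_pos braiding (class_all (d true)).
case: o.
  by exists (arr (braid (t := C) [:: W] [:: W])); split; [exact: realizes_cross | |].
have [b hb] := image_exists RTup (up_class false).
have [b' hb'] := image_exists RT (class_all (d false)).
exists b; split=> //; first exact: realizes_cross.
suff -> : b = b' by [].
have [f0 [n0 [_ up_nil RT_nil']]] := agree_nil 2.
have r2 o' : isotopic_at (plus 2) (plus 2) [::]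
   [:: ([::], Cross o' true true, [::]); ([::], Cross (~~ o') true true, [::])].
  by apply: isotopic_at_sym; apply: refines_at (reidemeister2 o' true true) _.
have nilE : n0 = arr (idm (t := C) [:: W; W]) by apply: image_fun RT_nil' (RT_nil 2).
have cup o' : has_class Tup (plus 2) (plus 2)
   ([:: ([::], Cross o' true true, [::])] ++ [:: ([::], Cross (~~ o') true true, [::])]).
  apply: (@realizes_class 2 _ id) => //.
  have := realizes_isotopic (r2 o'); rewrite size_nseq; apply; exact: realizes_nil.
have [c1 hc1 ec1] := image_cat h1 hb (cup true).
have [c2 hc2 ec2] := image_cat hb' h2 (class_all (isT : is_diag (plus 2)
   ([:: ([::], Cross false true true, [::])] ++ [:: ([::], Cross true true true, [::])]) (plus 2))).
have e1 : c1 = n0 by apply: image_fun hc1 (image_isotopic (r2 true) up_nil).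
have e2 : c2 = n0 by apply: image_fun hc2 (image_isotopic (r2 false) RT_nil').
rewrite e1 nilE in ec1; rewrite e2 nilE in ec2.
exact: inverse_unique ec1 ec2.
Qed.

(** Rigidity of the loop makes the trace admissible, as [RTup_loop] requires; both functors then
    give the same module trace. *)
Lemma agree_loop n E : agree n.+1 E -> rigid n (loop n E) -> agree n (loop n E).
Proof.
move=> aE hr; have dE := agree_diag aE; have [f [b [hf h1 h2]]] := aE.
have fn := loop_not_fixed dE hf hr; have [f' hf'] := realizes_loop dE hf hr.
have eW : nseq n.+1 W = nseq n W ++ [:: W] by rewrite nseq_cat_cons cats0.
have := image_type h2 (RT_obj_plus n.+1) (RT_obj_plus n.+1).
rewrite eW => /arrow_hom[g eb]; rewrite eb plus_rcons in h1 h2.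
exists f', (arr (@ptr C (nseq n W) (nseq n W) [:: W] g)); split=> //; last exact: RT_loop.
apply: RTup_loop hf fn _ h1; apply: realizes_class hf'.
exact: image_at_diag (RT_loop h2).
Qed.

Lemma agree_upward n D : upward n D -> agree n D.
Proof.
elim=> {n D} [n|o|o|n D E _ hD _ hE|a b n D _ hD].
- exact: agree_nil.
- exact: agree_cross.
(* [right_curl o true] is literally the crossing with its second strand closed, that is, [loop 1].
   Its rigidity was checked with the first Reidemeister move. *)
- have [hr _ _] := move_color (Reidemeister1 o true) (s := [:: true]) (t := [:: true]) isT.
  exact: (@agree_loop 1 _ (agree_cross o) hr).
- exact: agree_cat.
- exact: agree_whisker.
Qed.

(** * Induction on the slices of a diagram *)

Lemma nneg_plus n : nneg (plus n) = 0. Proof. by elim: n. Qed.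

Lemma npos_plus n : npos (plus n) = n.
Proof. by elim: n => // n IHn; rewrite -[in RHS]IHn. Qed.

Lemma diag_balance s D t : is_diag s D t -> npos s + nneg t = npos t + nneg s.
Proof.
elim: D s => [|[[l g] r] D IHD] s; first by move=> /eqP ->.
move=> /andP[/eqP -> /IHD]; rewrite /ssrc /stgt /= !npos_cat !nneg_cat.
by case: g => [o a b|a|a] /=; rewrite /npos /nneg /= => h; lia.
Qed.

(* The prefix P of a diagram, with the downward strands at its top bent to the
   bottom. *)
Definition sharp (v : word) (P : seq slice) := whisker [::] (plus (nneg v)) P ++ comb v.

(** Stated for lists, since a crossing with a downward strand is replaced by three slices. Rigidity
    is required of [P ++ es] because a cap may close a component. *)
Definition stackable (es : seq slice) := forall n P v0 v, is_diag (plus n) P (rev v0) ->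
  is_diag (rev v0) es (rev v) -> rigid n (P ++ es) ->
  agree (n + nneg v0) (sharp v0 P) -> agree (n + nneg v) (sharp v (P ++ es)).

Lemma sharp_diag n P v : is_diag (plus n) P (rev v) ->
  is_diag (plus (n + nneg v)) (sharp v P) (plus (n + nneg v)) /\ npos v = n + nneg v.
Proof.
move=> hP; have e : npos v = n + nneg v.
  have := diag_balance hP; rewrite npos_plus nneg_plus addn0.
  by rewrite /npos /nneg !count_rev => ->.
split=> //; rewrite -[in X in is_diag _ _ X]e; apply: is_diag_cat (comb_diag v).
by rewrite nseqD; exact: is_diag_whiskerr.
Qed.

Lemma sharp_refines v P Q : P ⊑ Q -> sharp v P ⊑ sharp v Q.
Proof. by move=> h; apply: refines_cat => //; exact: refines_whisker. Qed.

(** The intermediate diagram inherits rigidity from the whole one by [rigid_prefix]. *)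
Lemma stackable_cat D E : stackable D -> stackable E -> stackable (D ++ E).
Proof.
move=> hD hE n P v0 v dP /is_diag_catP[t dD dE] hr aP.
have dPD := is_diag_cat dP dD; rewrite catA in hr *.
rewrite -[t]revK in dD dE dPD.
apply: (hE n _ (rev t)) => //; apply: (hD n _ v0) => //.
by have := rigid_prefix dPD dE; rewrite size_nseq; apply.
Qed.

Lemma stackable_refeq D E : D ≃ E -> stackable E -> stackable D.
Proof.
move=> h hE n P v0 v dP dD hr aP.
have i := refines_at h.1 dD; have [_ dE] := isotopic_at_diag i.
have hPD : P ++ D ⊑ P ++ E by apply: refines_cat => //; case: h.
have dPD := is_diag_cat dP dD.
apply: (agree_refines (sharp_refines v hPD)).
  by case: (sharp_diag dPD).
apply: (hE n P v0) => //.
have [+ _] := isotopic_color (refines_at hPD dPD).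
by rewrite size_nseq => -[+ _]; apply.
Qed.

Lemma stackable_cross l r o : stackable [:: (l, Cross o true true, r)].
Proof.
move=> n P v0 v dP /andP[/eqP e0 /eqP ev] hr aP.
have ev0 : v0 = rev r ++ [:: true, true & rev l].
  by rewrite -[v0]revK e0 /ssrc /= rev_cat !rev_cons -!cats1 -!catA.
have evv : v = v0 by rewrite -[v]revK -ev -[v0]revK e0.
rewrite {v ev}evv; have [a [b [eab hc]]] := comb_cross o (rev l) (rev r).
rewrite -ev0 !revK in eab hc.
have [dS ep] := sharp_diag dP.
have dPe : is_diag (plus n) (P ++ [:: (l, Cross o true true, r)]) (rev v0).
  by apply: is_diag_cat dP _; rewrite e0 /= !eqxx.
have [dS' _] := sharp_diag dPe.
apply: (@agree_refines _ _ (sharp v0 P ++ [:: (plus a, Cross o true true, plus b)])).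
- apply: (refines_step (P := whisker [::] (plus (nneg v0)) P) (Q := [::]) (l := [::]) (r := [::]) hc).
    by rewrite /sharp; comb_norm.
  by rewrite whisker0 cats0 /sharp catA.
- by [].
apply: agree_cat aP _; rewrite -ep -eab.
apply: agree_upward; have := UpWhisker a b (UpCross o).
by rewrite whisker_cons /= cats0.
Qed.

Lemma stackable_cup l r a : stackable [:: (l, Cup a, r)].
Proof.
move=> n P v0 v dP /andP[/eqP e0 /eqP ev] hr aP.
have ev0 : v0 = rev r ++ rev l by rewrite -[v0]revK e0 /ssrc /= rev_cat.
have evv : v = rev r ++ [:: ~~ a, a & rev l].
  by rewrite -[v]revK -ev /stgt /= rev_cat !rev_cons -!cats1 -!catA.
have dPe : is_diag (plus n) (P ++ [:: (l, Cup a, r)]) (rev v).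
  by apply: is_diag_cat dP _; rewrite e0 /= -ev !eqxx.
have [dS' ep'] := sharp_diag dPe; have [dS ep] := sharp_diag dP.
have [X [Y [hX hY hc]]] := comb_cup a (rev l) (rev r).
rewrite -ev0 -evv !revK in hX hY hc.
have nv : nneg v = (nneg v0).+1 by rewrite evv ev0 nneg_pair.
have pv : npos v = (npos v0).+1 by rewrite evv ev0 npos_pair.
have hx := diag_interchange [::] dP (upward_diag hX).
apply: (@agree_refines _ _ (whisker (plus n) [::] X ++ whisker [::] [:: true] (sharp v0 P) ++ Y)).
- apply: (refines_step (P := whisker [::] (plus (nneg v)) P) (Q := [::]) (l := [::]) (r := [::]) hc).
    by rewrite /sharp; comb_norm.
  apply: (refines_step (P := [::]) (Q := whisker [::] [:: true] (comb v0) ++ Y) (l := [::]) (r := [::]) hx.1).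
    by comb_norm.
  by rewrite /sharp nv; comb_norm.
- by [].
apply: agree_cat; [|apply: agree_cat].
- by apply: agree_upward; apply: (upward_whisker (b := 0) hX); rewrite addn0.
- by have := agree_whisker 0 1 aP; rewrite add0n addn1 nv addnS.
- by apply: agree_upward; rewrite -ep'.
Qed.

(** The one case that uses the trace: its admissibility comes from rigidity of the diagram with the
    cap, preserved under bending by [comb_rigid]. *)
Lemma stackable_cap l r a : stackable [:: (l, Cap a, r)].
Proof.
move=> n P v0 v dP /andP[/eqP e0 /eqP ev] hr aP.
have evv : v = rev r ++ rev l by rewrite -[v]revK -ev /stgt /= rev_cat.
have ev0 : v0 = rev r ++ [:: ~~ a, a & rev l].
  by rewrite -[v0]revK e0 /ssrc /= rev_cat !rev_cons -!cats1 -!catA.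
have dPe : is_diag (plus n) (P ++ [:: (l, Cap a, r)]) (rev v).
  by apply: is_diag_cat dP _; rewrite e0 /= -ev !eqxx.
have [dS' ep'] := sharp_diag dPe; have [dS ep] := sharp_diag dP.
have [X [Y [hX hY hc]]] := comb_cap a (rev l) (rev r).
rewrite -ev0 -evv !revK in hX hY hc.
have nv : nneg v0 = (nneg v).+1 by rewrite evv ev0 nneg_pair.
have pv : npos v0 = (npos v).+1 by rewrite evv ev0 npos_pair.
have dX := upward_diag hX; have dY := upward_diag hY; have dC := comb_diag v0.
(* The bent prefix with the corrections of [comb_cap] inserted; closing its last strand gives the
   bent diagram with the cap added. *)
pose E := whisker [::] (plus (nneg v0)) P ++ whisker (rev v0) [::] X ++ comb v0 ++ Y.
have dE : is_diag (plus (n + nneg v).+1) E (plus (n + nneg v).+1).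
  by rewrite -addnS -nv -{2}ep nseqD /E; diag_ok.
have hx := diag_interchange [::] dP dX.
have aE : agree (n + nneg v).+1 E.
  apply: (@agree_refines _ _ (whisker (plus n) [::] X ++ sharp v0 P ++ Y)) => //.
    apply: (refines_step (P := [::]) (Q := comb v0 ++ Y) (l := [::]) (r := [::]) hx.1).
      by rewrite /E; comb_norm.
    by rewrite /sharp; comb_norm.
  rewrite -addnS -nv; apply: agree_cat; [|apply: agree_cat] => //.
    by apply: agree_upward; apply: (upward_whisker (b := 0) hX); rewrite addn0.
  by apply: agree_upward; rewrite -ep.
have dCup : is_diag (plus (nneg v)) [:: (plus (nneg v), Cup true, [::])]
    (plus (nneg v) ++ [:: true; false]) by diag_ok.
have hy := diag_interchange [::] dP dCup.
have hL : loop (n + nneg v) E ⊑ sharp v (P ++ [:: (l, Cap a, r)]).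
  apply: (refines_step (P := [::]) (Q := whisker [::] [:: false]
     (whisker (rev v0) [::] X ++ comb v0 ++ Y) ++ [:: (plus (npos v), Cap true, [::])])
     (l := [::]) (r := [::]) hy.2).
    by rewrite /loop /E nv ep' nseqD; comb_norm.
  apply: (refines_step (P := whisker [::] (plus (nneg v)) P) (Q := [::]) (l := [::]) (r := [::]) hc).
    by comb_norm.
  by rewrite /sharp; comb_norm.
have dL : is_diag (plus (n + nneg v)) (loop (n + nneg v) E) (plus (n + nneg v)).
  by rewrite /loop; diag_ok.
apply: (agree_refined hL); apply: agree_loop => //.
(* Rigidity is known for the bent diagram with its cap and is carried back to the isotopic loop. *)
have [+ _] := isotopic_color (refines_at hL dL).
rewrite size_nseq => ->; rewrite /sharp.
have := comb_rigid (s := plus n) dPe; rewrite size_nseq; exact.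
Qed.

(** A quarter turn makes a downward strand upward at the cost of a cup and a cap; for two downward
    strands it is applied twice. *)
Lemma stackable_crossing l r o a b : stackable [:: (l, Cross o a b, r)].
Proof.
have h3 (e1 e2 e3 : slice) : stackable [:: e1] -> stackable [:: e2] -> stackable [:: e3] ->
    stackable [:: e1; e2; e3].
  by move=> h1 h2 h3; apply: (stackable_cat (D := [:: e1])) => //; apply: (stackable_cat (D := [:: e2])).
have right l' r' o' b' : (forall o l r, stackable [:: (l, Cross o true b', r)]) ->
    stackable [:: (l', Cross o' b' false, r')].
  move=> hb; apply: (stackable_refeq (E := whisker l' r'
    [:: ([::], Cup false, [:: b'; false]); ([:: false], Cross (~~ o') true b', [:: false]);
      ([:: false; b'], Cap true, [::])])).
    apply: (refeq_step (P := [::]) (Q := [::]) (l := l') (r := r') (refeq_sym (rotate_right o' true b'))).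
      by comb_norm.
    by rewrite cats0.
  by apply: h3; [exact: stackable_cup | exact: hb | exact: stackable_cap].
have left l' r' o' : stackable [:: (l', Cross o' false true, r')].
  apply: (stackable_refeq (E := whisker l' r'
    [:: ([:: false; true], Cup true, [::]); ([:: false], Cross (~~ o') true true, [:: false]);
      ([::], Cap false, [:: true; false])])).
    apply: (refeq_step (P := [::]) (Q := [::]) (l := l') (r := r') (refeq_sym (rotate_left (~~ o') true true))).
      by rewrite negbK; comb_norm.
    by rewrite cats0.
  by apply: h3; [exact: stackable_cup | exact: stackable_cross | exact: stackable_cap].
have pn o' l' r' : stackable [:: (l', Cross o' true false, r')].
  by apply: right => *; exact: stackable_cross.
by case: a b => [] []; [exact: stackable_cross | exact: pn | exact: left | apply: right].
Qed.

Lemma stackable_all es : stackable es.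
Proof.
elim: es => [|[[l g] r] es IHes].
  move=> n P v0 v _ /eqP e0 _; have -> : v = v0 by rewrite -[v]revK -e0 revK.
  by rewrite cats0.
apply: (stackable_cat (D := [:: (l, g, r)])) => //.
by case: g => [o a b|a|a]; [exact: stackable_crossing|exact: stackable_cup|exact: stackable_cap].
Qed.

Lemma comb_plus n : comb (plus n) = [::].
Proof.
elim: n => // n IHn; rewrite -[plus n.+1]/(true :: plus n) combT IHn nneg_plus.
by rewrite !whisker_nil.
Qed.

(** At both ends the word is [plus n], whose comb is empty; the induction thus starts from the empty
    diagram and ends with [D] itself. *)
Lemma agree_all n D : is_diag (plus n) D (plus n) -> rigid n D -> agree n D.
Proof.
move=> hD hr; have rn : rev (plus n) = plus n.
  by elim: n {hD hr} => //= n IHn; rewrite rev_cons IHn -cats1 nseq_cat_cons cats0.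
have := @stackable_all D n [::] (plus n) (plus n).
rewrite rn /sharp comb_plus nneg_plus addn0 !whisker0 !cats0; apply=> //.
- exact: eqxx.
- exact: agree_nil.
Qed.

Lemma word_plus (s : word) : all id s -> s = plus (size s).
Proof. by elim: s => // -[] s IHs //= /IHs <-. Qed.

Lemma agree_Tup s t (f : @hom tangles s t) : sarr Tup (arr f) -> all id s -> all id t ->
  exists2 b, sends RTup (arr f) b & sends RT (arr f) b.
Proof.
move=> /= hf /word_plus es /word_plus et; move: f hf; rewrite es et => f hf.
(* The difference of the numbers of upward and downward strands is the same at all levels. *)
have est : size t = size s.
  have := diag_balance (diagP (repr (f : tangle _ _))).
  by rewrite !npos_plus !nneg_plus !addn0.
move: f hf; rewrite est => f hf.
pose D : diag _ _ := repr (f : tangle _ _).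
have ef : f = tclass (diagP D).
  by rewrite -[LHS](@reprK _ (tangle _ _)); congr (\pi_(_) _)%qT; exact: val_inj.
have hr := no_closed_component_rigid hf; rewrite size_nseq in hr.
have [g [b [_ [hD h1] [hD' h2]]]] := agree_all (diagP D) hr.
exists b; rewrite ef.
  by rewrite (bool_irrelevance (diagP D) hD).
by rewrite (bool_irrelevance (diagP D) hD').
Qed.

End Main.

Theorem lemma3p14 (k : comNzRingType) (A : algType k)
    (H : ribbon_hopf_algebra A) (W : fmodule A)
    (RT : functor Tall (fMod H)) (hRT : is_RT W RT)
    (RTplus : functor Tplus (fMod H)) (hRTplus : is_traced_RT W RTplus)
    (RTup : functor Tup (fMod_W RTplus)) (hRTup : is_open_traced_RT W RTup) :
  functor_eq (functor_comp (fMod_W_incl RTplus) RTup)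
             (functor_comp RT Tup_incl).
Proof.
split=> [[s hs]|[s hs] [t ht] [f hf]].
  have es := word_plus hs.
  transitivity (nseq (size s) W).
    apply: sends_obj_fun (RTup_obj_plus hRTup (size s)); rewrite -es.
    by exists (exist _ s hs).
  apply: sends_obj_fun (RT_obj_plus hRT (size s)) _; rewrite -es.
  by exists (exist _ s I).
have [b h1 h2] := agree_Tup hRT hRTplus hRTup hf hs ht.
transitivity b.
  apply: sends_fun h1.
  by exists (exist _ s hs), (exist _ t ht), (exist _ f hf).
apply: sends_fun h2 _.
by exists (exist _ s I), (exist _ t I), (exist _ f I).
Qed.
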